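(* Let $E$ be a Dedekind-complete normed Riesz space with order continuous norm, let $X$ be a Banach space, and let $T:E\rightarrow X$ be a continuous operator. Then $T$ is generalized $b$-weakly compact if and only if there exist a KB-space $H$, a continuous interval preserving lattice homomorphism $R:E\rightarrow H$, and a continuous operator $S:H\rightarrow X$ such that $T=SR$.
   Context: Conventions: Riesz spaces are real and archimedean, and an operator is a linear map. A normed Riesz space is a Riesz space with a lattice norm (not necessarily complete); its norm is order continuous if every net $x_\alpha\downarrow 0$ satisfies $\|x_\alpha\|\to 0$. $E^{\prime}$ is the norm dual, $E^{\prime\prime}$ the norm bidual, and $E$ is regarded as a Riesz subspace of $E^{\prime\prime}$ via the canonical embedding. A subset $A\subset E$ is topologically $b$-order bounded if it is order bounded as a subset of $E^{\prime\prime}$. An operator $T:E\to X$ into a Banach space is generalized $b$-weakly compact if it maps topologically $b$-order bounded subsets of $E$ to relatively weakly compact subsets of $X$. A KB-space is a Banach lattice $H$ in which every increasing norm bounded sequence (equivalently, net) in $H^{+}$ is norm convergent. A positive operator $R:E\to H$ is interval preserving if $R([0,x])=[0,Rx]$ for every $x\in E^{+}$. *)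

(* Defs.v *)
From HB Require Import structures.
From mathcomp Require Import all_boot all_order all_algebra.
From mathcomp Require Import all_classical all_reals all_analysis.
Import Order.TTheory GRing.Theory Num.Theory.
Import numFieldNormedType.Exports.

Set Implicit Arguments.
Unset Strict Implicit.
Unset Printing Implicit Defensive.

Local Open Scope classical_set_scope.
Local Open Scope ring_scope.

(* The order is not taken from [porderType]: Hierarchy Builder refuses a
   structure joining [NormedModule] and [Order.POrder], because
   [Num.NumDomain], declared earlier, inherits from [Order.POrder] and from
   the norm hierarchy without such a join. *)
HB.mixin Record Lmodule_isRiesz (R : realType) V & GRing.Lmodule R V := {
  rle : V -> V -> Prop ;
  rsup : V -> V -> V ;
  rinf : V -> V -> V ;
  rle_refl : forall x, rle x x ;
  rle_anti : forall x y, rle x y -> rle y x -> x = y ;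
  rle_trans : forall x y z, rle x y -> rle y z -> rle x z ;
  rsup_le : forall x y z, rle (rsup x y) z <-> rle x z /\ rle y z ;
  le_rinf : forall x y z, rle z (rinf x y) <-> rle z x /\ rle z y ;
  rle_add2r : forall z x y, rle x y -> rle (x + z) (y + z) ;
  scaler_rge0 : forall (a : R) x, 0 <= a -> rle 0 x -> rle 0 (a *: x)
}.

#[short(type="rieszType")]
HB.structure Definition Riesz (R : realType) :=
  {V of GRing.Lmodule R V & Lmodule_isRiesz R V}.

Arguments rle_trans {R s} [x y z].
Arguments rle_anti {R s} [x y].
Arguments rle_add2r {R s} z [x y].
Arguments scaler_rge0 {R s} [a x].

Notation "x <=^r y" := (rle x y) (at level 70, no associativity) : ring_scope.

Section RieszDefs.
Context {R : realType} {V : rieszType R}.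
Implicit Types (x y : V) (A : set V).

Definition rabs x : V := rsup x (- x).

Definition order_interval x y : set V := [set z | x <=^r z /\ z <=^r y].

Definition rubound A : set V := [set y | forall x, A x -> x <=^r y].

Definition rlbound A : set V := [set y | forall x, A x -> y <=^r x].

Definition is_rsup A x := rubound A x /\ forall y, rubound A y -> x <=^r y.

Definition is_rinf A x := rlbound A x /\ forall y, rlbound A y -> y <=^r x.

End RieszDefs.

Definition Dedekind_complete (R : realType) (V : rieszType R) :=
  forall A : set V, A !=set0 -> rubound A !=set0 -> exists x, is_rsup A x.

Definition positive_operator (R : realType) (V W : rieszType R)
    (T : {linear V -> W}) :=
  forall x, 0 <=^r x -> 0 <=^r T x.

Definition lattice_homomorphism (R : realType) (V W : rieszType R)
    (T : {linear V -> W}) :=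
  {morph T : x y / rsup x y} /\ {morph T : x y / rinf x y}.

Definition interval_preserving (R : realType) (V W : rieszType R)
    (T : {linear V -> W}) :=
  positive_operator T /\
  forall x, 0 <=^r x -> T @` order_interval 0 x = order_interval 0 (T x).

HB.mixin Record NormedModule_Riesz_isNormedRiesz (R : realType) V
    & NormedModule R V & Riesz R V := {
  lattice_norm : forall x y : V, rabs x <=^r rabs y -> `|x| <= `|y|
}.

#[short(type="normedRieszType")]
HB.structure Definition NormedRiesz (R : realType) :=
  {V of NormedModule R V & Riesz R V & NormedModule_Riesz_isNormedRiesz R V}.

#[short(type="banachLatticeType")]
HB.structure Definition BanachLattice (R : realType) :=
  {V of NormedRiesz R V & CompleteNormedModule R V}.

Lemma rabs_ge0_id (R : realType) (V : rieszType R) (x : V) :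
  0 <=^r x -> rabs x = x.
Proof.
move=> x0; have [xs _] := (rsup_le x (- x) (rabs x)).1 (rle_refl _).
apply: rle_anti => //; apply/rsup_le; split; first exact: rle_refl.
apply: (rle_trans _ x0); have := rle_add2r (- x) x0.
by rewrite add0r subrr.
Qed.

(* A Riesz space with a lattice norm is archimedean, so that this need not be
   an axiom of [normedRieszType]. *)
Lemma normed_riesz_archimedean (R : realType) (V : normedRieszType R)
    (x y : V) :
  0 <=^r x -> 0 <=^r y -> (forall n : nat, (x *+ n) <=^r y) -> x = 0.
Proof.
move=> x0 y0 xy; have [//|xN0] := eqVneq x 0.
have nx : 0 < `|x| by rewrite normr_gt0.
have xn n : `|x| * n%:R <= `|y|.
  rewrite mulr_natr -normrMn; apply: lattice_norm.
  rewrite !rabs_ge0_id// -scaler_nat; exact: scaler_rge0.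
have [n _ /(_ n (leqnn n))] : \forall n \near \oo, `|y| / `|x| < n%:R.
  exact: nbhs_infty_gtr.
by rewrite /= ltr_pdivrMr// mulrC ltNge xn.
Qed.

Section Dual.
Context {R : realType} {V : normedModType R}.

Definition continuous_functional : {pred (V -> R)} :=
  [pred f | `[< linear f /\ continuous f >]].

Record dual := Dual {
  dual_fun :> V -> R ;
  dual_funP : dual_fun \in continuous_functional }.

HB.instance Definition _ := [isSub for dual_fun].
HB.instance Definition _ := [Choice of dual by <:].

Lemma continuous_functional_submod : submod_closed continuous_functional.
Proof.
split; first by rewrite inE; split=> [a x y|x] /=;
  [rewrite scaler0 addr0|exact: cvg_cst].
move=> a f g /asboolP[lf cf] /asboolP[lg cg]; apply/asboolP; split.
  move=> b x y.
  rewrite /= !fctE lf lg !scalerDr !scalerA (mulrC a b) addrACA; reflexivity.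
move=> x; apply: cvgD; last exact: cg.
by apply: cvgZr; exact: cf.
Qed.

HB.instance Definition _ := GRing.isSubmodClosed.Build R (V -> R)
  continuous_functional continuous_functional_submod.

HB.instance Definition _ := [SubChoice_isSubLmodule of dual by <:].

Lemma dual_linear (f : dual) : linear f.
Proof. by have /asboolP[] := dual_funP f. Qed.

HB.instance Definition _ (f : dual) :=
  GRing.isLinear.Build R V R *:%R f (dual_linear f).

Lemma dual_continuous (f : dual) : continuous f.
Proof. by have /asboolP[] := dual_funP f. Qed.

Definition dual_norm (f : dual) : R :=
  sup [set `|f x| | x in [set x | `|x| <= 1]].

Lemma dual_norm_has_sup (f : dual) :
  has_sup [set `|f x| | x in [set x | `|x| <= 1]].
Proof.
split; first by exists `|f 0|, 0 => //=; rewrite normr0.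
have /bounded_funP/(_ 1)[M fM] : bounded_near f (nbhs (0 : V)).
  by apply/linear_bounded_continuous; exact: dual_continuous.
by exists M => _ [x x1 <-]; exact: fM.
Qed.

Lemma dual_norm_ub (f : dual) (x : V) : `|f x| <= dual_norm f * `|x|.
Proof.
have [->|x0] := eqVneq x 0; first by rewrite linear0 !normr0 mulr0.
have nx : 0 < `|x| by rewrite normr_gt0.
rewrite -ler_pdivrMr// -[X in _ / X]normr_id -normfV -normrM.
apply: ub_le_sup; first by have [] := dual_norm_has_sup f.
exists (`|x|^-1 *: x); last by rewrite linearZ/= mulrC.
by rewrite /= normrZ normfV normr_id mulVf// gt_eqF.
Qed.

Lemma dual_norm_le (f : dual) (M : R) :
  (forall x, `|x| <= 1 -> `|f x| <= M) -> dual_norm f <= M.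
Proof.
move=> fM; apply: ge_sup; first by have [] := dual_norm_has_sup f.
by move=> _ [x x1 <-]; exact: fM.
Qed.

Lemma dual_norm_ball (f : dual) (x : V) : `|x| <= 1 -> `|f x| <= dual_norm f.
Proof.
move=> x1; apply: ub_le_sup; first by have [] := dual_norm_has_sup f.
by exists x.
Qed.

Lemma dual_normD (f g : dual) :
  dual_norm (f + g) <= dual_norm f + dual_norm g.
Proof.
apply: dual_norm_le => x x1; apply: (le_trans (ler_normD _ _)).
by apply: lerD; exact: dual_norm_ball.
Qed.

Lemma dual_normZ (a : R) (f : dual) : dual_norm (a *: f) = `|a| * dual_norm f.
Proof.
have le_norm b (g : dual) : dual_norm (b *: g) <= `|b| * dual_norm g.
  apply: dual_norm_le => x x1.
  rewrite [X in `|X|](_ : _ = b * g x)// normrM.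
  by apply: ler_wpM2l => //; exact: dual_norm_ball.
have [->|a0] := eqVneq a 0.
  rewrite scale0r normr0 mul0r; apply/eqP; rewrite eq_le; apply/andP; split.
    by apply: dual_norm_le => x _; rewrite normr0.
  by rewrite -(normr0 R) -[X in `|X|](_ : (0 : dual) 0 = 0)// dual_norm_ball// normr0.
apply/eqP; rewrite eq_le le_norm/= -ler_pdivlMl ?normr_gt0//.
by rewrite -normfV -{1}[f](scalerK a0) le_norm.
Qed.

Lemma dual_norm0_eq0 (f : dual) : dual_norm f = 0 -> f = 0.
Proof.
move=> f0; apply: val_inj; apply/funext => x /=.
by apply/eqP; rewrite -normr_le0 (le_trans (dual_norm_ub f x))// f0 mul0r.
Qed.

HB.instance Definition _ :=
  Lmodule_isNormed.Build R dual dual_normD dual_normZ dual_norm0_eq0.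

End Dual.
Arguments dual {R} V.

Section Evaluation.
Context {R : realType} {V : normedModType R}.

Lemma evaluation_subproof (x : V) :
  (fun f : dual V => f x) \in @continuous_functional R (dual V).
Proof.
apply/asboolP; split=> [a f g|] //.
pose ev : dual V -> R := fun f => f x.
have lev : linear ev by [].
pose evL : {linear dual V -> R} := HB.pack ev (GRing.isLinear.Build _ _ _ _ _ lev).
suff : continuous evL by [].
apply/linear_bounded_continuous/bounded_funP => r; exists (r * `|x|) => f fr.
by rewrite (le_trans (dual_norm_ub f x))// ler_wpM2r.
Qed.

Definition evaluation (x : V) : dual (dual V) := Dual (evaluation_subproof x).

End Evaluation.

(* The order on V' induced by the positive cone of [leV]; the order on E'' is
   obtained by iterating it, with [leV] the order on E'. *)
Definition dual_le (R : realType) (V : normedModType R) (leV : V -> V -> Prop)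
    (f g : dual V) : Prop :=
  forall x, leV 0 x -> f x <= g x.

Definition bidual_le (R : realType) (E : normedRieszType R) :
    dual (dual E) -> dual (dual E) -> Prop :=
  dual_le (dual_le (@rle R E)).

Definition topologically_b_order_bounded (R : realType) (E : normedRieszType R)
    (A : set E) :=
  exists F G : dual (dual E),
    forall x, A x -> bidual_le F (evaluation x) /\ bidual_le (evaluation x) G.

Definition directed (I : Type) (leI : I -> I -> Prop) :=
  [/\ exists i : I, True, forall i, leI i i,
      forall i j k, leI i j -> leI j k -> leI i k &
      forall i j, exists2 k, leI i k & leI j k].

Definition net_filter (I : Type) (leI : I -> I -> Prop) : set_system I :=
  [set A | exists i, forall j, leI i j -> A j].

Definition order_continuous_norm (R : realType) (E : normedRieszType R) :=
  forall (I : Type) (leI : I -> I -> Prop) (x : I -> E),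
    directed leI ->
    (forall i j, leI i j -> x j <=^r x i) -> is_rinf (range x) 0 ->
    `|x i| @[i --> net_filter leI] --> (0 : R).

Definition KB_space (R : realType) (H : banachLatticeType R) :=
  forall x : nat -> H,
    (forall n, 0 <=^r x n) ->
    (forall m n, (m <= n)%N -> x m <=^r x n) ->
    bounded_fun x -> cvgn x.

Definition weak_space (R : realType) (X : normedModType R) : Type :=
  sup_topology
    (fun f : dual X => Topological.on (initial_topology (f : X -> R))).

HB.instance Definition _ (R : realType) (X : normedModType R) :=
  PointedTopological.on (weak_space X).

Lemma weak_cvgP (R : realType) (X : normedModType R) (F : set_system X)
    (x : X) :
  Filter F -> F --> (x : weak_space X) <->
  forall f : dual X, f y @[y --> F] --> f x.
Proof.
move=> FF; rewrite cvg_sup; split => [h f A Ax|h f A /=].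
  by apply: (h f); exact: (@initial_continuous _ _ (f : X -> R)).
rewrite (@nbhsE (initial_topology (f : X -> R))).
by move=> -[B [[C oC <-] Cx] BA]; apply: filterS BA _; apply: h;
  exact: open_nbhs_nbhs.
Qed.

Definition relatively_weakly_compact (R : realType) (X : normedModType R)
    (A : set X) :=
  compact (closure (A : set (weak_space X))).

Definition generalized_b_weakly_compact (R : realType) (E : normedRieszType R)
    (X : completeNormedModType R) (T : {linear E -> X}) :=
  forall A : set E, topologically_b_order_bounded A ->
    relatively_weakly_compact (T @` A).

(* Main.v *)
Require Import Defs.
From HB Require Import structures.
From mathcomp Require Import all_boot all_order all_algebra.
From mathcomp Require Import all_classical all_reals all_analysis.
From mathcomp Require Import ring lra.
Import Order.TTheory GRing.Theory Num.Theory.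
Import numFieldNormedType.Exports.

Set Implicit Arguments.
Unset Strict Implicit.
Unset Printing Implicit Defensive.

Local Open Scope classical_set_scope.
Local Open Scope ring_scope.

(** In a normed Riesz space whose increasing order bounded sequences converge in
    norm, order intervals are weakly compact: on [0, u] there is a strictly positive
    functional f, and minimizing the strictly convex function f(x^2) over a decreasing
    family of closed convex subsets of [0, u] produces a common point.

    If T = S Q with Q positive into a KB-space H, the image under Q of a topologically
    b-order bounded set is order bounded in H, because the elements of H below a
    functional of H'' form a directed norm bounded set; so S maps it into a weakly
    compact set.

    Conversely, let q(x) be the supremum of |T y| over |y| <= |x|. A gliding hump
    shows that increasing norm bounded sequences are q-Cauchy. The l^1 interpolation
    norm p = sum_n p_n, where p_n is the gauge of 2^n B + 2^-n Q (unit balls of the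
    norm and of q), satisfies q <= c p <= 2 c |.|, and increasing p-bounded sequences
    are p-Cauchy. Hence the completion H of (E, p) is a KB-space through which T
    factors; order intervals of E are p-complete by order continuity, so that E -> H
    is interval preserving. *)

(** * Linear identities in modules *)

(** Completing [E] for [q] alone would not do: an increasing [q]-bounded sequence need not be norm
    bounded, and then the gliding hump says nothing about it. Interpolation repairs this, because at
    level [n] a [p]-bounded element is a norm bounded one up to a [q]-error of order [2^-n]. The l^1
    sum is chosen for its tails, which are themselves monotone on the positive cone: along an
    increasing sequence the tail at a difference is controlled by the tail at a term.

    The obstacle is that [E] may be incomplete, so weak limits have to be found inside [E]. Weak
    compactness of order intervals is therefore derived from monotone convergence within intervals,
    a property that [E] shares with KB-spaces. Pointwise limits of functionals along ultrafilters
    play the role of weak-star compactness. In particular, such a limit of the evaluations at an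
    increasing norm bounded sequence bounds it in the bidual, which is how generalized b-weak
    compactness is brought to bear on the sequence. *)

Module ModuleTactic.

(** Reflection of linear identities: both sides are compared through their coefficients at the
    atoms, which leaves finitely many scalar equations for [field]. *)
Inductive expr (R : Type) :=
  Atom of nat | Zero | Add of expr R & expr R | Opp of expr R |
  Scale of R & expr R | Muln of expr R & nat.

Section Eval.
Context {R : comRingType} {V : lmodType R}.

Fixpoint eval (env : seq V) (e : expr R) : V :=
  match e with
  | Atom n => nth 0 env n
  | Zero => 0
  | Add a b => eval env a + eval env b
  | Opp a => - eval env a
  | Scale c a => c *: eval env a
  | Muln a n => eval env a *+ n
  end.

Fixpoint coef (i : nat) (e : expr R) : R :=
  match e with
  | Atom n => if i == n then 1 else 0
  | Zero => 0
  | Add a b => coef i a + coef i b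
  | Opp a => - coef i a
  | Scale c a => c * coef i a
  | Muln a n => coef i a * n%:R
  end.

Fixpoint eq_coef (n : nat) (a b : expr R) : Prop :=
  match n with
  | 0 => True
  | m.+1 => coef m a = coef m b /\ eq_coef m a b
  end.

Lemma eval_coef (env : seq V) (e : expr R) :
  eval env e = \sum_(i < size env) coef i e *: nth 0 env i.
Proof.
elim: e => [n||a iha b ihb|a iha|c a iha|a iha n] /=; rewrite ?iha ?ihb.
- have [nl|nl] := ltnP n (size env).
    rewrite (bigD1 (Ordinal nl))//= eqxx scale1r big1 ?addr0// => i ni.
    by rewrite ifN ?scale0r//.
  rewrite nth_default// big1// => i _.
  by rewrite ifN ?scale0r// neq_ltn (leq_trans (ltn_ord i) nl).
- by rewrite big1// => i _; rewrite scale0r.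
- by rewrite -big_split; apply: eq_bigr => i _; rewrite scalerDl.
- by rewrite -sumrN; apply: eq_bigr => i _; rewrite scaleNr.
- by rewrite scaler_sumr; apply: eq_bigr => i _; rewrite scalerA.
- rewrite -scaler_nat scaler_sumr; apply: eq_bigr => i _.
  by rewrite scalerA mulrC.
Qed.

Lemma eval_eq (env : seq V) (a b : expr R) :
  eq_coef (size env) a b -> eval env a = eval env b.
Proof.
move=> ab; rewrite !eval_coef.
suff h i : (i < size env)%N -> coef i a = coef i b.
  by apply: eq_bigr => i _; rewrite h.
elim: (size env) ab => // n ih /= [e1 /ih e2].
by rewrite ltnS leq_eqVlt => /orP[/eqP->|/e2].
Qed.

End Eval.

Ltac head t := lazymatch t with ?f _ => head f | _ => t end.

(* The same vector may occur with different, convertible, structure projections. *)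
Ltac same x y :=
  first [constr_eq x y
        |let hx := head x in let hy := head y in constr_eq hx hy; unify x y].

Ltac mem x l :=
  match l with
  | nil => constr:(false)
  | cons ?y _ =>
      let _ := match goal with _ => same x y end in constr:(true)
  | cons _ ?l' => mem x l'
  end.

Ltac index x l :=
  match l with
  | cons ?y _ =>
      let _ := match goal with _ => same x y end in constr:(0%N)
  | cons _ ?l' => let n := index x l' in constr:(S n)
  end.

Ltac atoms l t :=
  match t with
  | @GRing.zero _ => l
  | @GRing.add _ ?a ?b => let l1 := atoms l a in atoms l1 b
  | @GRing.opp _ ?a => atoms l a
  | @GRing.scale _ _ _ ?a => atoms l a
  | @GRing.natmul _ ?a _ => atoms l a
  | _ => let b := mem t l in
      match b with true => l | false => constr:(cons t l) end
  end.

Ltac reify R l t :=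
  match t with
  | @GRing.zero _ => constr:(@Zero R)
  | @GRing.add _ ?a ?b =>
      let ra := reify R l a in let rb := reify R l b in constr:(@Add R ra rb)
  | @GRing.opp _ ?a => let ra := reify R l a in constr:(@Opp R ra)
  | @GRing.scale _ _ ?c ?a => let ra := reify R l a in constr:(@Scale R c ra)
  | @GRing.natmul _ ?a ?n => let ra := reify R l a in constr:(@Muln R ra n)
  | _ => let n := index t l in constr:(@Atom R n)
  end.

End ModuleTactic.

Ltac module R V :=
  match goal with |- ?a = ?b =>
    let l0 := constr:(@nil V) in
    let l1 := ModuleTactic.atoms l0 a in
    let l := ModuleTactic.atoms l1 b in
    let ra := ModuleTactic.reify R l a in
    let rb := ModuleTactic.reify R l b in
    apply: (@ModuleTactic.eval_eq _ _ l ra rb);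
    rewrite /=; do ?[split]; try by field
  end.


(** * Riesz spaces *)

Section RieszTheory.
Context {R : realType} {V : rieszType R}.
Implicit Types x y z a b c d : V.

Local Ltac mod := module (R : Type) (V : Type).

Lemma rsubge0 x y : 0 <=^r y - x <-> x <=^r y.
Proof.
by split=> [/(rle_add2r x)|/(rle_add2r (- x))]; rewrite ?add0r ?subrK ?subrr.
Qed.

Lemma raddge0 x y : 0 <=^r x -> 0 <=^r y -> 0 <=^r x + y.
Proof.
by move=> x0 /(rle_add2r x); rewrite add0r addrC; apply: rle_trans.
Qed.

Lemma rle_lin1 a b x y : a <=^r b -> y - x = b - a -> x <=^r y.
Proof. by move=> /rsubge0 ab e; apply/rsubge0; rewrite e. Qed.

Lemma rle_lin2 a b c d x y : a <=^r b -> c <=^r d ->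
  y - x = (b - a) + (d - c) -> x <=^r y.
Proof.
by move=> /rsubge0 ab /rsubge0 cd e; apply/rsubge0; rewrite e; exact: raddge0.
Qed.

Lemma rle_scale (k : R) x y : 0 <= k -> x <=^r y -> k *: x <=^r k *: y.
Proof.
by move=> k0 /rsubge0 xy; apply/rsubge0; rewrite -scalerBr; exact: scaler_rge0.
Qed.

Lemma rleD a b c d : a <=^r b -> c <=^r d -> a + c <=^r b + d.
Proof. by move=> ab cd; apply: (rle_lin2 ab cd); mod. Qed.

Lemma rleN x y : x <=^r y -> - y <=^r - x.
Proof. by move=> xy; apply: (rle_lin1 xy); mod. Qed.

Lemma rsupl x y : x <=^r rsup x y.
Proof. by have [] := (rsup_le x y (rsup x y)).1 (rle_refl _). Qed.

Lemma rsupr x y : y <=^r rsup x y.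
Proof. by have [] := (rsup_le x y (rsup x y)).1 (rle_refl _). Qed.

Lemma rinfl x y : rinf x y <=^r x.
Proof. by have [] := (le_rinf x y (rinf x y)).1 (rle_refl _). Qed.

Lemma rinfr x y : rinf x y <=^r y.
Proof. by have [] := (le_rinf x y (rinf x y)).1 (rle_refl _). Qed.

Lemma rsup_lub x y z : x <=^r z -> y <=^r z -> rsup x y <=^r z.
Proof. by move=> xz yz; apply/rsup_le. Qed.

Lemma rinf_glb x y z : z <=^r x -> z <=^r y -> z <=^r rinf x y.
Proof. by move=> xz yz; apply/le_rinf. Qed.

Lemma rsup_mono a b c d : a <=^r b -> c <=^r d -> rsup a c <=^r rsup b d.
Proof.
move=> ab cd; apply: rsup_lub; first exact: rle_trans ab (rsupl _ _).
exact: rle_trans cd (rsupr _ _).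
Qed.

Lemma rinf_mono a b c d : a <=^r b -> c <=^r d -> rinf a c <=^r rinf b d.
Proof.
move=> ab cd; apply: rinf_glb; first exact: rle_trans (rinfl _ _) ab.
exact: rle_trans (rinfr _ _) cd.
Qed.

Lemma rsupC x y : rsup x y = rsup y x.
Proof. by apply: rle_anti; apply: rsup_lub; (exact: rsupr || exact: rsupl). Qed.

Lemma rsup_idl x y : y <=^r x -> rsup x y = x.
Proof.
by move=> yx; apply: rle_anti; [apply: rsup_lub => //; exact: rle_refl|exact: rsupl].
Qed.

Lemma rinf_idl x y : x <=^r y -> rinf x y = x.
Proof.
by move=> xy; apply: rle_anti; [exact: rinfl|apply: rinf_glb => //; exact: rle_refl].
Qed.

Lemma rsup_id x : rsup x x = x.
Proof. by apply: rsup_idl; exact: rle_refl. Qed.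

Lemma rsupDr x y z : rsup x y + z = rsup (x + z) (y + z).
Proof.
apply: rle_anti.
  have h : rsup x y <=^r rsup (x + z) (y + z) - z.
    apply: rsup_lub; [apply: (rle_lin1 (rsupl (x + z) (y + z)))|
      apply: (rle_lin1 (rsupr (x + z) (y + z)))]; mod.
  by apply: (rle_lin1 h); mod.
by apply: rsup_lub; apply: rle_add2r; [exact: rsupl|exact: rsupr].
Qed.

Lemma roppinf x y : - rinf x y = rsup (- x) (- y).
Proof.
apply: rle_anti.
  rewrite -[X in _ <=^r X]opprK; apply: rleN; apply: rinf_glb;
    rewrite -[X in _ <=^r X]opprK; apply: rleN; [exact: rsupl|exact: rsupr].
by apply: rsup_lub; apply: rleN; [exact: rinfl|exact: rinfr].
Qed.

Lemma rinfE x y : rinf x y = - rsup (- x) (- y).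
Proof. by rewrite -roppinf opprK. Qed.

Lemma rsup_rinfD x y : rsup x y + rinf x y = x + y.
Proof.
suff -> : rinf x y = x + y - rsup x y by mod.
rewrite rinfE; suff -> : rsup x y = rsup (- x) (- y) + (x + y) by mod.
by rewrite rsupDr rsupC; congr rsup; mod.
Qed.

Definition rpos x : V := rsup x 0.

Lemma rpos_ge0 x : 0 <=^r rpos x. Proof. exact: rsupr. Qed.

Lemma rpos_ge x : x <=^r rpos x. Proof. exact: rsupl. Qed.

Lemma rsub_rinf x y : x - rinf x y = rpos (x - y).
Proof. by rewrite /rpos roppinf addrC rsupDr rsupC; congr rsup; mod. Qed.

Lemma rsup_pos x y : rsup x y = y + rpos (x - y).
Proof. by rewrite /rpos addrC rsupDr; congr rsup; mod. Qed.

Lemma rposD x y : rpos (x + y) <=^r rpos x + rpos y.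
Proof.
apply: rsup_lub; first exact: rleD (rpos_ge _) (rpos_ge _).
by apply: raddge0; exact: rpos_ge0.
Qed.

Lemma rscale_sup (k : R) x y : 0 <= k -> k *: rsup x y = rsup (k *: x) (k *: y).
Proof.
move=> k0; have [->|kn0] := eqVneq k 0; first by rewrite !scale0r rsup_id.
have kV : 0 <= k^-1 by rewrite invr_ge0.
apply: rle_anti; last first.
  by apply: rsup_lub; apply: rle_scale => //; [exact: rsupl|exact: rsupr].
rewrite -[X in _ <=^r X](scalerKV kn0); apply: rle_scale => //.
by apply: rsup_lub; rewrite -[X in X <=^r _](scalerK kn0); apply: rle_scale => //;
  [exact: rsupl|exact: rsupr].
Qed.

Lemma rposZ (k : R) x : 0 <= k -> rpos (k *: x) = k *: rpos x.
Proof. by move=> k0; rewrite /rpos rscale_sup// scaler0. Qed.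

Lemma rpos_id x : 0 <=^r x -> rpos x = x.
Proof. exact: rsup_idl. Qed.

Lemma rpos_le0 x : x <=^r 0 -> rpos x = 0.
Proof. by move=> x0; rewrite /rpos rsupC; exact: rsup_idl. Qed.

Lemma rabs_ge x : x <=^r rabs x. Proof. exact: rsupl. Qed.

Lemma rabs_geN x : - x <=^r rabs x. Proof. exact: rsupr. Qed.

Lemma rabs_le x y : x <=^r y -> - x <=^r y -> rabs x <=^r y.
Proof. exact: rsup_lub. Qed.

Lemma rhalf_ge0 x : 0 <=^r x + x -> 0 <=^r x.
Proof.
move=> /(@scaler_rge0 _ _ (2^-1 : R)); rewrite (_ : 2^-1 *: (x + x) = x); last by mod.
by apply; lra.
Qed.

Lemma rabs_ge0 x : 0 <=^r rabs x.
Proof.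
apply: rhalf_ge0.
by apply: (rle_lin2 (rabs_ge x) (rabs_geN x)); mod.
Qed.

Lemma rabsN x : rabs (- x) = rabs x.
Proof. by rewrite /rabs opprK rsupC. Qed.

Lemma rabs0 : rabs 0 = 0 :> V.
Proof. by rewrite /rabs oppr0 rsup_id. Qed.

Lemma rabs_rabs x : rabs (rabs x) = rabs x.
Proof. by apply: rabs_ge0_id; exact: rabs_ge0. Qed.

Lemma rabsD x y : rabs (x + y) <=^r rabs x + rabs y.
Proof.
apply: rabs_le; first exact: rleD (rabs_ge _) (rabs_ge _).
by rewrite opprD; exact: rleD (rabs_geN _) (rabs_geN _).
Qed.

Lemma rabsBC x y : rabs (x - y) = rabs (y - x).
Proof. by rewrite -rabsN opprB. Qed.

Lemma rabsZ (k : R) x : rabs (k *: x) = `|k| *: rabs x.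
Proof.
wlog k0 : k / 0 <= k => [hw|].
  have [|k0] := leP 0 k; first exact: hw.
  rewrite -rabsN -scaleNr hw ?normrN//; lra.
by rewrite ger0_norm// /rabs -scalerN rscale_sup.
Qed.

Lemma rpos_le_rabs x : rpos x <=^r rabs x.
Proof. by apply: rsup_lub; [exact: rabs_ge|exact: rabs_ge0]. Qed.

Lemma rposBN x : rpos x - rpos (- x) = x.
Proof. by have := rsup_rinfD x 0; rewrite rinfE oppr0 addr0. Qed.

Lemma rabs_pos x : rabs x = rpos x + rpos (- x).
Proof.
have /subr0_eq xE : x - (rpos x - rpos (- x)) = 0 by rewrite rposBN subrr.
rewrite /rabs rsup_pos (_ : x - - x = (2 : R) *: x) ?rposZ//; last by mod.
by rewrite {1}xE; mod.
Qed.

Lemma rpos_le x y : x <=^r y -> rpos x <=^r rpos y.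
Proof. by move=> xy; apply: rsup_mono => //; exact: rle_refl. Qed.

Lemma rsup_dist x y z : rabs (rsup x z - rsup y z) <=^r rabs (x - y).
Proof.
have h a b : rsup a z - rsup b z <=^r rabs (a - b).
  suff : rsup a z <=^r rsup b z + rabs (a - b).
    by move=> k; apply: (rle_lin1 k); mod.
  apply: rsup_lub.
    by apply: (rle_lin2 (rsupl b z) (rabs_ge (a - b))); mod.
  by apply: (rle_lin2 (rsupr b z) (rabs_ge0 (a - b))); mod.
by apply: rabs_le; [exact: h|rewrite opprB rabsBC; exact: h].
Qed.

Lemma rsup_dist2 a b c d :
  rabs (rsup a b - rsup c d) <=^r rabs (a - c) + rabs (b - d).
Proof.
have -> : rsup a b - rsup c d = (rsup a b - rsup c b) + (rsup b c - rsup d c).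
  by rewrite (rsupC b) (rsupC d); mod.
by apply: (rle_trans (rabsD _ _)); apply: rleD; exact: rsup_dist.
Qed.

Lemma rinf_dist2 a b c d :
  rabs (rinf a b - rinf c d) <=^r rabs (a - c) + rabs (b - d).
Proof.
rewrite !rinfE opprK addrC; apply: (rle_trans (rsup_dist2 _ _ _ _)).
have -> : - c - - a = a - c by mod.
have -> : - d - - b = b - d by mod.
exact: rle_refl.
Qed.

Lemma rabs_dist x y : rabs (rabs x - rabs y) <=^r rabs (x - y).
Proof.
apply: rabs_le; rewrite ?opprB; last rewrite rabsBC.
  by have := rabsD (x - y) y; rewrite subrK => h; apply: (rle_lin1 h); mod.
by have := rabsD (y - x) x; rewrite subrK => h; apply: (rle_lin1 h); mod.
Qed.

(** Riesz decomposition. The part of [z] under [x] is their infimum; what remains is the positive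
    part of [z - x], which lies under [y] because [z - x] does and [y] is positive. *)
Lemma rdecomp z x y : 0 <=^r z -> 0 <=^r x -> 0 <=^r y -> z <=^r x + y ->
  [/\ 0 <=^r rinf z x, rinf z x <=^r x, 0 <=^r z - rinf z x &
      z - rinf z x <=^r y].
Proof.
move=> z0 x0 y0 zxy; split; [exact: rinf_glb|exact: rinfr| |].
- by rewrite rsub_rinf; exact: rpos_ge0.
- by rewrite rsub_rinf; apply: rsup_lub => //; apply: (rle_lin1 zxy); mod.
Qed.

Lemma rabs_interval x y : rabs y <=^r x <-> - x <=^r y /\ y <=^r x.
Proof.
split=> [yx|[xy yx]].
  split; last exact: rle_trans (rabs_ge _) yx.
  by rewrite -[y]opprK; apply: rleN; apply: rle_trans (rabs_geN _) yx.
by apply: rabs_le => //; rewrite -[x]opprK; exact: rleN.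
Qed.

Lemma rsum_ge0 (I : Type) (r : seq I) (P : pred I) (F : I -> V) :
  (forall i, P i -> 0 <=^r F i) -> 0 <=^r \sum_(i <- r | P i) F i.
Proof.
move=> h; elim/big_ind: _ => //; [exact: rle_refl|exact: raddge0].
Qed.

Lemma rle_sum (I : Type) (r : seq I) (P : pred I) (F G : I -> V) :
  (forall i, P i -> F i <=^r G i) ->
  \sum_(i <- r | P i) F i <=^r \sum_(i <- r | P i) G i.
Proof.
move=> h; elim/big_ind2: _ => //; [exact: rle_refl|by move=> *; exact: rleD].
Qed.

Lemma rabs_sum (I : Type) (r : seq I) (P : pred I) (F : I -> V) :
  rabs (\sum_(i <- r | P i) F i) <=^r \sum_(i <- r | P i) rabs (F i).
Proof.
elim/big_ind2: _ => //; [rewrite rabs0; exact: rle_refl| |].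
  by move=> a b c d ab cd; apply: (rle_trans (rabsD _ _)); exact: rleD.
by move=> *; exact: rle_refl.
Qed.

End RieszTheory.

Section LatticeNorm.
Context {R : realType} {V : normedRieszType R}.
Implicit Types x y z : V.

Lemma norm_rabs x : `|rabs x| = `|x|.
Proof.
by apply/eqP; rewrite eq_le; apply/andP; split; apply: lattice_norm;
  rewrite rabs_rabs; exact: rle_refl.
Qed.

Lemma norm_mono x y : 0 <=^r x -> x <=^r y -> `|x| <= `|y|.
Proof.
move=> x0 xy; apply: lattice_norm; rewrite !rabs_ge0_id//.
exact: rle_trans x0 xy.
Qed.

Lemma norm_rabs_le x y : rabs x <=^r y -> `|x| <= `|y|.
Proof. by move=> xy; rewrite -norm_rabs norm_mono//; exact: rabs_ge0. Qed.

Lemma norm_rpos x : `|rpos x| <= `|x|.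
Proof.
by rewrite -(norm_rabs x) norm_mono//; [exact: rpos_ge0|exact: rpos_le_rabs].
Qed.

Lemma norm_rpos_eq0 x : `|rpos (- x)| = 0 -> 0 <=^r x.
Proof.
move/eqP; rewrite normr_eq0 => /eqP x0; rewrite -(rposBN x) x0 subr0.
exact: rpos_ge0.
Qed.

End LatticeNorm.

(** * Hahn-Banach theorem and functionals *)

Section HahnBanach.
Context {R : realType} {V : lmodType R}.
Implicit Types (P Q : V -> R) (x y : V).

(** Homogeneity is stated as an inequality because infima inherit it directly; [sublinearZ] recovers
    equality. *)
Definition sublinear P :=
  (forall x y, P (x + y) <= P x + P y) /\
  (forall (k : R) x, 0 <= k -> P (k *: x) <= k * P x).

Lemma sublinear0 P : sublinear P -> P 0 = 0.
Proof.
move=> [PD PZ]; have := PZ 0 0 (lexx _); rewrite scale0r mul0r.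
by have := PD 0 0; rewrite addr0; lra.
Qed.

Lemma sublinear_opp P x : sublinear P -> - P (- x) <= P x.
Proof.
by move=> sP; have := sP.1 x (- x); rewrite subrr (sublinear0 sP); lra.
Qed.

Lemma sublinearZ P (k : R) x : sublinear P -> 0 <= k -> P (k *: x) = k * P x.
Proof.
move=> sP k0; have [->|kn0] := eqVneq k 0.
  by rewrite scale0r mul0r sublinear0.
apply/eqP; rewrite eq_le sP.2//=.
have kp : 0 < k by rewrite lt_neqAle eq_sym kn0.
have := sP.2 k^-1 (k *: x); rewrite scalerK// invr_ge0 => /(_ k0).
by rewrite mulrC ler_pdivlMr// mulrC.
Qed.

(** A near minimizer at [x] and one at [y] merge into an index that serves [x + y]. Both the infimum
    over a chain and the infimum over [t] in [sharpen] have this form. *)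
Lemma inf_sublinear (I : Type) (A : set I) (F : I -> V -> R) (B : V -> R) :
  A !=set0 ->
  (forall i x, A i -> B x <= F i x) ->
  (forall i j x y, A i -> A j -> exists2 k, A k & F k (x + y) <= F i x + F j y) ->
  (forall i (k : R) x, A i -> 0 <= k ->
    exists2 j, A j & F j (k *: x) <= k * F i x) ->
  sublinear (fun x => inf [set F i x | i in A]).
Proof.
move=> [i0 Ai0] lb hD hZ.
have hi x : has_inf [set F i x | i in A].
  by split; [exists (F i0 x), i0|exists (B x) => _ [i Ai <-]; exact: lb].
have le_inf i x : A i -> inf [set F i x | i in A] <= F i x.
  by move=> Ai; apply: ge_inf; [exact: (hi x).2|exists i].
split=> [x y|k x k0].
  apply/ler_addgt0Pr => e e0; have e20 : 0 < e / 2 by rewrite divr_gt0.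
  have [_ [i Ai <-] ix] := inf_adherent e20 (hi x).
  have [_ [j Aj <-] jy] := inf_adherent e20 (hi y).
  have [l Al ll] := hD i j x y Ai Aj.
  by apply: (le_trans (le_inf _ _ Al)); apply: (le_trans ll); lra.
apply/ler_addgt0Pr => e e0.
(* Dividing by [k + 1] instead of [k] covers [k = 0], and [k] times this error is still at most
   [e]. *)
have e1 : 0 < e / (k + 1) by rewrite divr_gt0//; lra.
have [_ [i Ai <-] ix] := inf_adherent e1 (hi x).
have [l Al ll] := hZ i k x Ai k0.
apply: (le_trans (le_inf _ _ Al)); apply: (le_trans ll).
have : k * F i x <= k * (inf [set F i x | i in A] + e / (k + 1)).
  by apply: ler_wpM2l => //; exact: ltW.
move=> /le_trans; apply; rewrite mulrDr lerD2l mulrCA ler_piMr//; first exact: ltW.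
by rewrite ler_pdivrMr ?mul1r; lra.
Qed.

(* Sharpens [Q] along the ray through [y]; a minimal [Q] is therefore fixed by
   every [sharpen y], which makes it additive. *)
Definition sharpen Q y x : R :=
  inf [set Q (x + t *: y) - t * Q y | t in [set t : R | 0 <= t]].

Lemma sharpen_lb Q y x (t : R) : sublinear Q -> 0 <= t ->
  - Q (- x) <= Q (x + t *: y) - t * Q y.
Proof.
move=> sQ t0; have := sQ.1 (x + t *: y) (- x).
by rewrite addrAC subrr add0r sublinearZ//; lra.
Qed.

Lemma sharpen_le Q y x (t : R) : sublinear Q -> 0 <= t ->
  sharpen Q y x <= Q (x + t *: y) - t * Q y.
Proof.
move=> sQ t0; apply: ge_inf; last by exists t.
by exists (- Q (- x)) => _ [s /= s0 <-]; exact: sharpen_lb.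
Qed.

Lemma sharpen_sublinear Q y : sublinear Q -> sublinear (sharpen Q y).
Proof.
move=> sQ; apply: (@inf_sublinear R _ (fun t x => Q (x + t *: y) - t * Q y)
  (fun x => - Q (- x))).
- by exists 0; rewrite /=.
- by move=> t x /= t0; exact: sharpen_lb.
- move=> s t x z /= s0 t0; exists (s + t); first by rewrite /= addr_ge0.
  have := sQ.1 (x + s *: y) (z + t *: y).
  by rewrite addrACA -scalerDl; lra.
- move=> s k x /= s0 k0; exists (k * s); first by rewrite /= mulr_ge0.
  have := sQ.2 k (x + s *: y) k0; rewrite scalerDr scalerA mulrBr mulrA.
  by lra.
Qed.

Lemma sharpen_self Q y x : sublinear Q -> sharpen Q y x <= Q x.
Proof.
by move=> sQ; have := sharpen_le y x sQ (lexx 0); rewrite scale0r addr0 mul0r subr0.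
Qed.

(** Zorn's lemma for the reversed pointwise order. Every sublinear function below [P] is at least
    [- P (- x)], so the infimum over a chain is finite; the empty chain is bounded by [P]. *)
Lemma sublinear_minimal P : sublinear P ->
  exists Q, [/\ sublinear Q, forall x, Q x <= P x &
    forall Q', sublinear Q' -> (forall x, Q' x <= Q x) -> Q' = Q].
Proof.
move=> sP; pose T := {Q : V -> R | sublinear Q /\ forall x, Q x <= P x}.
pose r (A B : T) := `[< forall x, sval B x <= sval A x >].
have lb (Q : T) x : - P (- x) <= sval Q x.
  have [sQ QP] := svalP Q; apply: le_trans (sublinear_opp x sQ).
  by rewrite lerN2.
have [|||A tA|M hM] := @Zorn T r.
- by move=> t; apply/asboolP.
- by move=> a b c /asboolP ab /asboolP bc; apply/asboolP => x; exact: le_trans (bc x) (ab x).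
- move=> [a ha] [b hb] /asboolP /= ab /asboolP /= ba.
  have e : a = b by apply/funext => x; apply/eqP; rewrite eq_le ab ba.
  by rewrite {}e in ha *; congr exist; exact: Prop_irrelevance.
- have [[t0 At0]|/set0P/negP] := pselect (A !=set0); last first.
    rewrite negbK => /eqP ->.
    have hP : sublinear P /\ forall x, P x <= P x by [].
    by exists (exist _ P hP).
  pose q x := inf [set sval t x | t in A].
  have sq : sublinear q.
    apply: (@inf_sublinear T A (fun t => sval t) (fun x => - P (- x))).
    - by exists t0.
    - by move=> i x _; exact: lb.
    - move=> i j x y Ai Aj; have [/asboolP ij|/asboolP ji] := tA _ _ Ai Aj.
        exists j => //; apply: (le_trans ((svalP j).1.1 _ _)).
        by rewrite lerD2r.
      exists i => //; apply: (le_trans ((svalP i).1.1 _ _)).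
      by rewrite lerD2l.
    - by move=> i k x Ai k0; exists i => //; exact: (svalP i).1.2.
  have qA t x : A t -> q x <= sval t x.
    move=> At; apply: ge_inf; last by exists t.
    by exists (- P (- x)) => _ [s _ <-].
  have qP : sublinear q /\ forall x, q x <= P x.
    split=> // x; apply: (le_trans (qA t0 x At0)); exact: (svalP t0).2.
  by exists (exist _ q qP) => s As; apply/asboolP => x /=; exact: qA.
- exists (sval M); split; [exact: (svalP M).1|exact: (svalP M).2|].
  move=> Q' sQ' Q'M.
  have hQ' : sublinear Q' /\ forall x, Q' x <= P x.
    by split=> // x; apply: (le_trans (Q'M x)); exact: (svalP M).2.
  have := hM (exist _ Q' hQ'); rewrite /r asboolE => /(_ Q'M) h.
  by rewrite -h.
Qed.

(** The minimal function is taken below [sharpen P y] rather than below [P]: at [- y], with [t = 1],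
    the former is at most [- P y], which forces [F y = P y]. *)
Lemma hahn_banach_sublinear P y : sublinear P ->
  exists F : V -> R, [/\ linear F, forall x, F x <= P x & F y = P y].
Proof.
move=> sP; have [F [sF FP minF]] := sublinear_minimal (sharpen_sublinear y sP).
have FD x z : F (x + z) = F x + F z.
  apply/eqP; rewrite eq_le sF.1/=.
  have e := minF _ (sharpen_sublinear z sF) (fun x => sharpen_self z x sF).
  have := sharpen_le z x sF ler01; rewrite e scale1r mul1r; lra.
have F0 := sublinear0 sF.
have FN x : F (- x) = - F x by have := FD x (- x); rewrite subrr F0; lra.
have FPP x : F x <= P x by exact: le_trans (FP x) (sharpen_self _ _ sP).
exists F; split=> //; last first.
  apply/eqP; rewrite eq_le FPP/=; have := FP (- y); rewrite FN => h.
  have := sharpen_le y (- y) sP ler01.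
  by rewrite scale1r mul1r addNr (sublinear0 sP); lra.
move=> k x z; rewrite FD; congr (_ + _).
have [k0|k0] := leP 0 k; first by rewrite sublinearZ.
rewrite -{1}[k]opprK scaleNr FN sublinearZ ?mulNr ?opprK//.
by rewrite oppr_ge0 ltW.
Qed.

End HahnBanach.

(** * Limits along ultrafilters *)

Section UltraFilters.

Lemma ultra_fmap (I J : Type) (r : I -> J) (U : set_system I) :
  UltraFilter U -> UltraFilter (r @ U).
Proof.
move=> uU; split; first exact: fmap_proper_filter.
move=> G pG UG; apply/seteqP; split=> // A GA.
have [//|UA] := in_ultra_setVsetC (r @^-1` A) uU.
have GA' : G (~` A) by apply: UG.
have : G set0 by rewrite -(setICr A); exact: filterI.
by move/filter_not_empty.
Qed.

Lemma ultra_bounded_cvg (R : realType) (I : Type) (U : set_system I)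
    (r : I -> R) (C : R) :
  UltraFilter U -> (\forall i \near U, `|r i| <= C) ->
  exists2 l : R, r i @[i --> U] --> l & `|l| <= C.
Proof.
move=> uU rC; have := @segment_compact R (- C) C; rewrite compact_ultra => cC.
have [|l [lC Ul]] := cC (r @ U) (ultra_fmap r uU).
  by apply: filterS rC => i /=; rewrite in_itv/= ler_norml.
by exists l => //; move: lC; rewrite /= in_itv/= ler_norml.
Qed.

Lemma nat_ultra : exists U : set_system nat, UltraFilter U /\ \oo `<=` U.
Proof. exact: ultraFilterLemma. Qed.

End UltraFilters.

Section DualTheory.
Context {R : realType} {V : normedModType R}.

Lemma dual_of (F : V -> R) (C : R) : linear F -> (forall x, `|F x| <= C * `|x|) ->
  exists f : dual V, forall x, f x = F x.
Proof.
move=> lF FC; pose FL : {linear V -> R} := HB.pack F (GRing.isLinear.Build _ _ _ _ _ lF).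
suff h : F \in continuous_functional by exists (Dual h).
apply/asboolP; split=> //.
suff : continuous FL by [].
apply/linear_bounded_continuous/bounded_funP => r; exists (`|C| * r) => x xr.
apply: (le_trans (FC x)); apply: (le_trans (ler_norm _)).
by rewrite normrM normr_id ler_wpM2l.
Qed.

Lemma dual_ext (f g : dual V) : (forall x, f x = g x) -> f = g.
Proof. by move=> fg; apply: val_inj; exact/funext. Qed.

Lemma hahn_banach_dual (P : V -> R) (C : R) (y : V) : sublinear P ->
  (forall x, P x <= C * `|x|) ->
  exists f : dual V, (forall x, f x <= P x) /\ f y = P y.
Proof.
move=> sP PC; have [F [lF FP Fy]] := hahn_banach_sublinear y sP.
pose FL : {linear V -> R} := HB.pack F (GRing.isLinear.Build _ _ _ _ _ lF).
have FN x : F (- x) = - F x by exact: (linearN FL).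
have [x|f fF] := @dual_of F C lF.
  rewrite ler_norml (le_trans (FP x) (PC x)) andbT lerNl -FN -normrN.
  exact: le_trans (FP _) (PC _).
by exists f; split=> [x|]; rewrite fF.
Qed.

Lemma norm_sublinear : sublinear (fun x : V => `|x|).
Proof. by split=> [x y|k x k0]; [exact: ler_normD|rewrite normrZ ger0_norm]. Qed.

Lemma norming_functional (y : V) :
  exists f : dual V, (forall x, `|f x| <= `|x|) /\ f y = `|y|.
Proof.
have [|f [fP fy]] := @hahn_banach_dual _ 1 y norm_sublinear.
  by move=> x; rewrite mul1r.
exists f; split=> // x; rewrite ler_norml fP andbT lerNl -linearN.
by apply: (le_trans (fP _)); rewrite normrN.
Qed.

Lemma dual_separates (x y : V) : (forall f : dual V, f x = f y) -> x = y.
Proof.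
move=> h; have [f [_ fxy]] := norming_functional (x - y).
by apply/eqP; rewrite -subr_eq0 -normr_eq0 -fxy linearB /= h subrr.
Qed.

Lemma dual_comp (W : normedModType R) (Q : {linear V -> W}) : continuous Q ->
  forall f : dual W, exists g : dual V, forall x, g x = f (Q x).
Proof.
move=> cQ f; suff h : (fun x => f (Q x)) \in continuous_functional.
  by exists (Dual h).
apply/asboolP; split=> [k x y|x]; first by rewrite linearP linearP.
exact: (@continuous_comp _ _ _ Q f x (cQ x) (@dual_continuous _ _ f (Q x))).
Qed.

(** Banach-Alaoglu as a pointwise limit: bounded scalars converge along an ultrafilter, and
    linearity and the bound pass to the limit. *)
Lemma dual_ultralimit (I : Type) (U : set_system I) (f : I -> dual V) (C : R) :
  UltraFilter U -> (forall i x, `|f i x| <= C * `|x|) ->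
  exists g : dual V, (forall x, f i x @[i --> U] --> g x) /\
    forall x, `|g x| <= C * `|x|.
Proof.
move=> uU fC.
have pU : ProperFilter U by exact: ultra_proper.
have h x : exists l : R, f i x @[i --> U] --> l /\ `|l| <= C * `|x|.
  have [|l ul lC] := @ultra_bounded_cvg R I U (fun i => f i x) (C * `|x|) uU.
    by apply: nearW => i; exact: fC.
  by exists l.
have [F hF] := choice h.
have [||g gF] := @dual_of F C.
- move=> k x y; have [cxy _] := hF (k *: x + y); have [cx _] := hF x.
  have [cy _] := hF y.
  apply: (cvg_unique _ cxy) => //.
  have -> : (fun i => f i (k *: x + y)) = (fun i => k *: f i x + f i y).
    by apply/funext => i; rewrite linearP.
  by apply: cvgD => //; apply: cvgZr.
- by move=> x; exact: (hF x).2.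
by exists g; split=> x; rewrite gF; [exact: (hF x).1|exact: (hF x).2].
Qed.

End DualTheory.

(** * Positive functionals *)

Section PositiveFunctionals.
Context {R : realType} {V : normedRieszType R}.
Implicit Types (x y z : V) (f g : dual V).

Definition pos_functional f := forall x, 0 <=^r x -> 0 <= f x.

Lemma pos_functional_mono f x y : pos_functional f -> x <=^r y -> f x <= f y.
Proof. by move=> pf /rsubge0/pf; rewrite linearB; lra. Qed.

Lemma norm_rpos_sublinear : sublinear (fun x => `|rpos x|).
Proof.
split=> [x y|k x k0]; last by rewrite rposZ// normrZ ger0_norm.
apply: le_trans (ler_normD _ _); apply: norm_mono; [exact: rpos_ge0|exact: rposD].
Qed.

(** Hahn-Banach for the norm of the positive part: a functional below it is at most 0 on negative
    elements, hence positive. *)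
Lemma pos_norming_functional z : exists f,
  [/\ pos_functional f, forall x, `|f x| <= `|x| & f z = `|rpos z|].
Proof.
have [|f [fP fz]] := @hahn_banach_dual _ _ _ 1 z norm_rpos_sublinear.
  by move=> x; rewrite mul1r norm_rpos.
exists f; split=> // [x x0|x].
  have := fP (- x); rewrite linearN rpos_le0 ?normr0; first by lra.
  by rewrite -oppr0; exact: rleN.
rewrite ler_norml (le_trans (fP x) (norm_rpos x)) andbT lerNl -linearN.
by apply: (le_trans (fP _)); rewrite -[leRHS]normrN norm_rpos.
Qed.

(** The functional that norms the negative part of [y - x] shows that this part is zero. Order
    relations thus pass to weak limits. *)
Lemma rle_functional x y :
  (forall f, pos_functional f -> f x <= f y) -> x <=^r y.
Proof.
move=> h; apply/rsubge0/norm_rpos_eq0.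
have [f [pf _ fE]] := pos_norming_functional (- (y - x)).
apply/eqP; rewrite eq_le normr_ge0 andbT -fE linearN linearB.
by have := h f pf; lra.
Qed.

(* The positive part of [f] carried by the positive part of [z]. *)
Lemma pos_functional_split f z : pos_functional f -> exists g,
  [/\ pos_functional g, forall x, 0 <=^r x -> g x <= f x & g z = f (rpos z)].
Proof.
move=> pf; have sP : sublinear (fun x => f (rpos x)).
  split=> [x y|k x k0]; last by rewrite rposZ// linearZ.
  by rewrite -linearD; apply: pos_functional_mono => //; exact: rposD.
have [|g [gP gz]] := @hahn_banach_dual _ _ _ (dual_norm f) z sP.
  move=> x; apply: (le_trans (ler_norm _)); apply: (le_trans (dual_norm_ub _ _)).
  rewrite ler_wpM2l ?norm_rpos//.
  by apply: le_trans (dual_norm_ball f (_ : `|0 : V| <= 1)); rewrite ?normr0.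
exists g; split=> // x x0; last by rewrite -[in leRHS](rpos_id x0).
have := gP (- x); rewrite linearN rpos_le0 ?linear0; first by lra.
by rewrite -oppr0; exact: rleN.
Qed.

End PositiveFunctionals.

(** * Directed suprema and limits superior *)

Section Sequences.

Lemma dep_choice (T : Type) (P : T -> Prop) (r : nat -> T -> T -> Prop) (x0 : T) :
  P x0 -> (forall n x, P x -> exists2 y, P y & r n x y) ->
  exists u : nat -> T, u 0%N = x0 /\ forall n, P (u n) /\ r n (u n) (u n.+1).
Proof.
move=> P0 h.
have /choice[g gP] (p : nat * {x | P x}) :
    exists y : {x | P x}, r p.1 (sval p.2) (sval y).
  by case: p => n [x Px]; have [y Py ry] := h n x Px; exists (exist _ y Py).
pose u := fix u n := if n is m.+1 then g (m, u m) else exist _ x0 P0.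
exists (fun n => sval (u n)); split=> // n; split; first exact: svalP (u n).
exact: gP (n, u n).
Qed.

Lemma cvgnP (R : realType) (V : normedModType R) (x : nat -> V) (a : V) :
  (x @ \oo --> a) <->
  (forall e : R, 0 < e -> exists N, forall n, (N <= n)%N -> `|a - x n| < e).
Proof.
split=> [/cvgrPdist_lt h e e0|h].
  by have [N _ hN] := h e e0; exists N => n; exact: hN.
by apply/cvgrPdist_lt => e e0; have [N hN] := h e e0; exists N.
Qed.

Lemma homo_nat (T : Type) (le : T -> T -> Prop) (x : nat -> T) :
  (forall a, le a a) -> (forall a b c, le a b -> le b c -> le a c) ->
  (forall n, le (x n) (x n.+1)) -> forall m n, (m <= n)%N -> le (x m) (x n).
Proof.
move=> lexx le_trans hx m n /subnK <-; elim: (n - m)%N => //= k ih.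
by rewrite addSn; exact: le_trans ih (hx _).
Qed.

Lemma half_cvg (R : realType) (K : R) : (fun n => K * 2^-1 ^+ n) @ \oo --> (0 : R).
Proof.
rewrite -[X in _ --> X](mulr0 K); apply: cvgM; first exact: cvg_cst.
by apply: cvg_expr; rewrite ger0_norm; lra.
Qed.

Lemma half_ge0 (R : realType) n : 0 <= (2^-1 : R) ^+ n.
Proof. by rewrite exprn_ge0. Qed.

Lemma half_gt0 (R : realType) n : 0 < (2^-1 : R) ^+ n.
Proof. by rewrite exprn_gt0. Qed.

Lemma le_cvg (R : realType) (I : Type) (F : set_system I)
    {FF : ProperFilter F} (f g : I -> R) l l' :
  (\forall i \near F, f i <= g i) ->
  f @ F --> l -> g @ F --> l' -> l <= l'.
Proof.
move=> fg fl gl; rewrite -subr_ge0.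
apply: (closed_cvg (fun r : R => 0 <= r) (@closed_ge R 0) _ _ (cvgB gl fl)).
by apply: filterS fg => i /=; rewrite subr_ge0.
Qed.

Lemma squeeze0 (R : realType) (I : Type) (F : set_system I)
    {FF : Filter F} (r s : I -> R) :
  (forall i, 0 <= r i <= s i) -> s @ F --> (0 : R) -> r @ F --> (0 : R).
Proof.
move=> rs s0; apply: (squeeze_cvgr _ _ s0); last exact: cvg_cst.
exact: nearW.
Qed.

Lemma cvgD0 (R : realType) (r s : nat -> R) :
  r @ \oo --> (0 : R) -> s @ \oo --> (0 : R) ->
  (fun n => r n + s n) @ \oo --> (0 : R).
Proof. by move=> r0 s0; rewrite -[X in _ --> X]addr0; exact: cvgD. Qed.

Lemma cvg_dist0 (R : realType) (V : normedModType R) (x : nat -> V) (a : V) :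
  (fun n => `|x n - a|) @ \oo --> (0 : R) -> x @ \oo --> a.
Proof.
move=> /cvgnP h; apply/cvgnP => e e0; have [N hN] := h e e0; exists N => n /hN.
by rewrite sub0r normrN normr_id distrC.
Qed.

End Sequences.

(** * Order and norm limits *)

Section OrderTopology.
Context {R : realType} {V : normedRieszType R}.
Implicit Types (x y z u : V).

Lemma dual_cvg (f : dual V) (I : Type) (F : set_system I)
    {FF : Filter F} (x : I -> V) a :
  x i @[i --> F] --> a -> f (x i) @[i --> F] --> f a.
Proof. by move=> xa; apply: (cvg_comp _ _ xa); exact: dual_continuous. Qed.

Lemma rle_cvg (I : Type) (F : set_system I) {FF : ProperFilter F}
    (x y : I -> V) a b :
  (\forall i \near F, x i <=^r y i) ->
  x @ F --> a -> y @ F --> b -> a <=^r b.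
Proof.
move=> xy xa yb; apply: rle_functional => f pf.
apply: (@le_cvg _ _ F _ (fun i => f (x i)) (fun i => f (y i)));
  [|exact: dual_cvg|exact: dual_cvg].
by apply: filterS xy => i; exact: pos_functional_mono.
Qed.

Lemma closed_rge b : closed [set x : V | b <=^r x].
Proof.
have -> : [set x : V | b <=^r x] =
    \bigcap_(f in @pos_functional R V) [set x : V | f b <= f x].
  apply/seteqP; split=> x /= h; first by move=> f pf; exact: pos_functional_mono.
  by apply: rle_functional => f /h.
apply: closed_bigI => f _; apply: (@closed_comp _ _ f [set r | f b <= r]).
  by move=> x _; exact: dual_continuous.
exact: closed_ge.
Qed.

Lemma closed_rle b : closed [set x : V | x <=^r b].
Proof.
have -> : [set x : V | x <=^r b] =
    \bigcap_(f in @pos_functional R V) [set x : V | f x <= f b].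
  apply/seteqP; split=> x /= h; first by move=> f pf; exact: pos_functional_mono.
  by apply: rle_functional => f /h.
apply: closed_bigI => f _; apply: (@closed_comp _ _ f [set r | r <= f b]).
  by move=> x _; exact: dual_continuous.
exact: closed_le.
Qed.

Lemma closed_interval x y : closed (order_interval x y).
Proof.
have -> : order_interval x y = [set z : V | x <=^r z] `&` [set z : V | z <=^r y] by [].
exact: closedI (@closed_rge x) (@closed_rle y).
Qed.

(* A directed set need not have a cofinal sequence, but its tails become small in
   norm along a suitable one. *)
Lemma directed_sup (D : set V) : D !=set0 ->
  (forall a b, D a -> D b -> exists c, [/\ D c, a <=^r c & b <=^r c]) ->
  (forall x : nat -> V, (forall n, D (x n)) -> (forall n, x n <=^r x n.+1) ->
     exists a : V, x @ \oo --> a) ->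
  exists (x : nat -> V) (s : V),
    [/\ forall n, D (x n), forall n, x n <=^r x n.+1, x @ \oo --> s &
        forall d, D d -> d <=^r s].
Proof.
move=> [d0 Dd0] dirD cvgD.
(* Without such a [d1] there would be an increasing sequence in [D] all of whose steps exceed [e],
   against its convergence. *)
have small (e : R) d : 0 < e -> D d -> exists d1, [/\ D d1, d <=^r d1 &
    forall d', D d' -> d1 <=^r d' -> `|d' - d1| <= e].
  move=> e0 Dd; apply: contrapT => /forallNP H.
  have [|n x Dx|x [_ xP]] := @dep_choice _ (fun a => D a /\ d <=^r a)
      (fun _ a b => a <=^r b /\ e < `|b - a|) d.
  - by split=> //; exact: rle_refl.
  - apply: contrapT => /forall2NP K; apply: (H x); split; [exact: Dx.1|exact: Dx.2|].
    move=> d' Dd' xd'; rewrite leNgt; apply/negP => ed'.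
    by case: (K d'); apply=> //; split=> //; exact: rle_trans Dx.2 xd'.
  - have [a /cvgnP xa] := cvgD x (fun n => (xP n).1.1) (fun n => (xP n).2.1).
    have [|N hN] := xa (e / 2); first by lra.
    have := (xP N).2.2; have := hN N (leqnn _); have := hN N.+1 (leqnSn _).
    have := ler_distD a (x N.+1) (x N); rewrite (distrC (x N.+1) a); lra.
have [n x Dx|x [_ xP]] := @dep_choice _ D (fun n a b => a <=^r b /\
    forall d', D d' -> b <=^r d' -> `|d' - b| <= 2^-1 ^+ n) d0 Dd0.
  have [d1 [D1 dd1 h1]] := small _ x (half_gt0 R n) Dx.
  by exists d1.
have [s xs] := cvgD x (fun n => (xP n).1) (fun n => (xP n).2.1).
exists x, s; split=> //; [by move=> n; exact: (xP n).1|by move=> n; exact: (xP n).2.1|].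
move=> d Dd; apply: (@rle_trans _ _ _ (rsup d s) _ (rsupl _ _)).
have /subr0_eq -> : rsup d s - s = 0; last exact: rle_refl.
rewrite rsup_pos addrAC subrr add0r.
apply/eqP; rewrite -normr_le0; apply/ler_addgt0Pr => e e0; rewrite add0r.
have [|N1 h1] := (cvgnP x s).1 xs (e / 2); first by lra.
have [|N2 h2] := (cvgnP _ _).1 (half_cvg (1 : R)) (e / 2); first by lra.
pose n := maxn N1 N2.
(* As [d'] dominates both [d] and [x n.+1], the positive part of [d - s] is at most
   [rabs (d' - x n.+1) + rabs (x n.+1 - s)], and both terms are small. *)
have [d' [Dd' dd' xd']] := dirD _ _ Dd ((xP n.+1).1).
have k1 : `|s - x n.+1| < e / 2 by apply: h1; rewrite leqW// leq_maxl.
have k2 : `|d' - x n.+1| <= e / 2.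
  apply: (le_trans ((xP n).2.2 _ Dd' xd')); apply: ltW.
  have := h2 n (leq_maxr _ _).
  by rewrite sub0r normrN mul1r ger0_norm// half_ge0.
have : `|rpos (d - s)| <= `|rabs (d' - x n.+1) + rabs (x n.+1 - s)|.
  apply: norm_mono; first exact: rpos_ge0.
  apply: rsup_lub; last by apply: raddge0; exact: rabs_ge0.
  apply: (@rle_trans _ _ _ (d' - s)); first by apply: rle_add2r.
  have -> : d' - s = (d' - x n.+1) + (x n.+1 - s) by rewrite addrA subrK.
  exact: rleD (rabs_ge _) (rabs_ge _).
move=> /le_trans; apply; apply: (le_trans (ler_normD _ _)).
by rewrite !norm_rabs (distrC (x n.+1)); lra.
Qed.

End OrderTopology.

(** A predicate rather than a structure, since [E] carries several at once: [f (rabs x)] for a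
    positive functional [f], the solid seminorm of an operator, the interpolation norm. *)
Definition lattice_seminorm (R : realType) (W : rieszType R) (N : W -> R) :=
  [/\ forall x y, N (x + y) <= N x + N y,
      forall (k : R) x, N (k *: x) = `|k| * N x &
      forall x y, rabs x <=^r rabs y -> N x <= N y].

Section LatticeSeminorm.
Context {R : realType} {W : rieszType R} (N : W -> R).
Hypothesis lN : lattice_seminorm N.
Implicit Types x y : W.

Lemma seminorm0 : N 0 = 0.
Proof. by have [_ NZ _] := lN; rewrite -(scale0r 0) NZ normr0 mul0r. Qed.

Lemma seminormN x : N (- x) = N x.
Proof. by have [_ NZ _] := lN; rewrite -scaleN1r NZ normrN normr1 mul1r. Qed.

Lemma seminormBC x y : N (x - y) = N (y - x).
Proof. by rewrite -seminormN opprB. Qed.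

Lemma seminorm_ge0 x : 0 <= N x.
Proof.
have [ND _ _] := lN; have := ND x (- x).
by rewrite subrr seminorm0 seminormN; lra.
Qed.

Lemma seminorm_rabs x : N (rabs x) = N x.
Proof.
by have [_ _ Nm] := lN; apply/eqP; rewrite eq_le; apply/andP; split; apply: Nm;
  rewrite rabs_rabs; exact: rle_refl.
Qed.

Lemma seminorm_mono x y : 0 <=^r x -> x <=^r y -> N x <= N y.
Proof.
move=> x0 xy; have [_ _ Nm] := lN; apply: Nm; rewrite !rabs_ge0_id//.
exact: rle_trans x0 xy.
Qed.

Lemma seminorm_rabs_le x y : rabs x <=^r y -> N x <= N y.
Proof. by move=> xy; rewrite -seminorm_rabs seminorm_mono//; exact: rabs_ge0. Qed.

Lemma seminormB x y : N (x - y) <= N x + N y.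
Proof. by have [ND _ _] := lN; rewrite -(seminormN y); exact: ND. Qed.

Lemma seminorm_triangle y x z : N (x - z) <= N (x - y) + N (y - z).
Proof. by have [ND _ _] := lN; apply: le_trans (ND _ _); rewrite addrA subrK. Qed.

Lemma seminorm_dist x y : `|N x - N y| <= N (x - y).
Proof.
have [ND _ _] := lN; rewrite ler_norml.
have := ND (x - y) y; have := ND (y - x) x; rewrite !subrK seminormBC.
by move=> *; apply/andP; split; lra.
Qed.

Lemma seminorm_sum (I : Type) (r : seq I) (P : pred I) (F : I -> W) :
  N (\sum_(i <- r | P i) F i) <= \sum_(i <- r | P i) N (F i).
Proof.
have [ND _ _] := lN; elim/big_ind2: _ => //; first by rewrite seminorm0.
by move=> a b c d ab cd; apply: (le_trans (ND _ _)); exact: lerD.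
Qed.

End LatticeSeminorm.

Lemma functional_lattice_seminorm (R : realType) (V : normedRieszType R)
    (f : dual V) : pos_functional f -> lattice_seminorm (fun x : V => f (rabs x)).
Proof.
move=> pf; split=> [x y|k x|x y]; last exact: pos_functional_mono.
- by rewrite -linearD; apply: pos_functional_mono => //; exact: rabsD.
- by rewrite rabsZ linearZ.
Qed.

(** The common ground of both directions: it holds in [E] by Dedekind completeness and order
    continuity, and in every KB-space. *)
Definition interval_monotone_cvg (R : realType) (V : normedRieszType R) :=
  forall (x : nat -> V) (u : V), (forall n, 0 <=^r x n) -> (forall n, x n <=^r u) ->
    (forall n, x n <=^r x n.+1) -> exists a : V, x @ \oo --> a.

(** Dedekind completeness supplies the supremum [s]; the differences [s - x n] decrease to 0 and
    form a net indexed by [nat]. *)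
Lemma order_continuous_monotone_cvg (R : realType) (V : normedRieszType R) :
  Dedekind_complete V -> order_continuous_norm V -> interval_monotone_cvg V.
Proof.
move=> dV oV x u x0 xu xi.
have xm := homo_nat (@rle_refl R V) (@rle_trans R V) xi.
have [||s [us ms]] := dV (range x).
- by exists (x 0%N), 0%N.
- by exists u => _ [n _ <-].
exists s; apply: cvg_dist0.
have dirn : directed (fun m n : nat => is_true (m <= n)%N).
  split; [by exists 0%N|by []|by move=> i j k; exact: leq_trans|].
  by move=> i j; exists (maxn i j); rewrite ?leq_maxl ?leq_maxr.
have decr i j : (i <= j)%N -> s - x j <=^r s - x i.
  by move=> ij; apply: (rle_lin1 (xm _ _ ij)); module (R : Type) (V : Type).
have inf0 : is_rinf (range (fun n => s - x n)) 0.
  split=> [_ [n _ <-]|y hy]; first by apply/rsubge0; apply: us; exists n.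
  have h : s <=^r s - y.
    apply: ms => _ [n _ <-]; have h : y <=^r s - x n by apply: hy; exists n.
    by apply: (rle_lin1 h); module (R : Type) (V : Type).
  by apply: (rle_lin1 h); module (R : Type) (V : Type).
move=> A /(oV _ _ _ dirn decr inf0)[N hN].
by exists N => //= n Nn; rewrite /preimage /= distrC; exact: hN.
Qed.

(** * Limits superior in order intervals *)

Section TailSup.
Context {R : realType} {V : rieszType R}.
Implicit Types (a : V) (x : nat -> V).

Local Ltac mod := module (R : Type) (V : Type).

Fixpoint tail_sup x (n m : nat) : V :=
  if m is k.+1 then rsup (tail_sup x n k) (x (n + m)%N) else x n.

Lemma tail_sup_ge x n m : x (n + m)%N <=^r tail_sup x n m.
Proof. by case: m => [|m]; rewrite /= ?addn0; [exact: rle_refl|exact: rsupr]. Qed.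

Lemma tail_sup_mono x n m : tail_sup x n m <=^r tail_sup x n m.+1.
Proof. exact: rsupl. Qed.

Lemma tail_sup_le x n m a : (forall k, x k <=^r a) -> tail_sup x n m <=^r a.
Proof. by move=> xa; elim: m => //= m ih; exact: rsup_lub. Qed.

Lemma tail_sup_head x n m : x n <=^r tail_sup x n m.
Proof. by elim: m => [|m ih] /=; [exact: rle_refl|exact: rle_trans ih (rsupl _ _)]. Qed.

Lemma tail_supS x n m : tail_sup x n.+1 m <=^r tail_sup x n m.+1.
Proof.
elim: m => [|m ih]; first by rewrite /= addn1; exact: rsupr.
rewrite [tail_sup x n.+1 m.+1]/=; apply: rsup_lub; first exact: rle_trans ih (rsupl _ _).
by rewrite addSnnS; exact: tail_sup_ge.
Qed.

(** Each term of the tail exceeds [x n] by at most the absolute increments in between. *)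
Lemma tail_sup_dist x n m :
  tail_sup x n m <=^r x n + \sum_(i < m) rabs (x (n + i).+1 - x (n + i)%N).
Proof.
elim: m => [|m ih]; first by rewrite big_ord0 addr0; exact: rle_refl.
rewrite big_ord_recr/=; set S := \sum_(i < m) _ in ih *.
apply: rsup_lub.
  by apply: (rle_lin2 ih (rabs_ge0 (x (n + m).+1 - x (n + m)%N))); mod.
have h := rle_trans (tail_sup_ge x n m) ih.
by rewrite addnS; apply: (rle_lin2 h (rabs_ge (x (n + m).+1 - x (n + m)%N))); mod.
Qed.

End TailSup.

Section Limsup.
Context {R : realType} {V : normedRieszType R}.
Hypothesis mV : interval_monotone_cvg V.
Implicit Types (u a : V) (x : nat -> V).

Local Ltac mod := module (R : Type) (V : Type).

(** Two monotone limits: the finite tail suprema increase to [s n], and [u - s n] increases, so [s]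
    decreases to the limit superior [a]. *)
Lemma limsup_exists x u : (forall n, 0 <=^r x n) -> (forall n, x n <=^r u) ->
  exists (s : nat -> V) (a : V),
    [/\ s @ \oo --> a, 0 <=^r a /\ a <=^r u,
        forall n, x n <=^r s n,
        forall n, s n.+1 <=^r s n &
        forall n, tail_sup x n @ \oo --> s n].
Proof.
move=> x0 xu.
have t0 n m : 0 <=^r tail_sup x n m.
  by apply: rle_trans (x0 n) _; exact: tail_sup_head.
have tu n m : tail_sup x n m <=^r u by exact: tail_sup_le.
have /choice[s sP] n : exists a : V, tail_sup x n @ \oo --> a.
  by apply: (mV (u := u)) => // m; exact: tail_sup_mono.
have s0 n : 0 <=^r s n.
  by apply: (rle_cvg _ (cvg_cst 0) (sP n)); exact: nearW.
have su n : s n <=^r u.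
  by apply: (rle_cvg _ (sP n) (cvg_cst u)); exact: nearW.
have ss n : s n.+1 <=^r s n.
  have h : (fun m => tail_sup x n m.+1) @ \oo --> s n.
    by have := sP n; rewrite -(cvg_shiftS (tail_sup x n)).
  by apply: (rle_cvg _ (sP n.+1) h); apply: nearW => m; exact: tail_supS.
have [n|n|n|b hb] := mV (x := fun n => u - s n) (u := u).
- exact/rsubge0.
- by apply: (rle_lin1 (s0 n)); mod.
- by apply: (rle_lin1 (ss n)); mod.
have sb : s @ \oo --> u - b.
  have -> : s = fun n => u - (u - s n) by apply/funext => n; mod.
  by apply: cvgB => //; exact: cvg_cst.
exists s, (u - b); split=> //.
  split; first by apply: (rle_cvg _ (cvg_cst 0) sb); exact: nearW.
  by apply: (rle_cvg _ sb (cvg_cst u)); exact: nearW.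
move=> n; apply: (rle_cvg _ (cvg_cst (x n)) (sP n)); apply: nearW => m.
exact: tail_sup_head.
Qed.

Lemma seminorm_cvg (N : V -> R) (C : R) (I : Type) (F : set_system I)
    {FF : Filter F} (x : I -> V) a :
  lattice_seminorm N -> (forall y : V, N y <= C * `|y|) ->
  x @ F --> a -> (fun i => N (x i)) @ F --> N a.
Proof.
move=> lN NC xa; apply/cvgrPdist_lt => e e0.
have C1 : 0 < `|C| + 1 by rewrite ltr_pwDr.
have e1 : 0 < e / (`|C| + 1) by rewrite divr_gt0.
move/cvgrPdist_lt : xa => /(_ _ e1); apply: filterS => i.
rewrite ltr_pdivlMr// => h; apply: le_lt_trans h.
apply: (le_trans (seminorm_dist lN _ _)); apply: (le_trans (NC _)).
rewrite mulrC ler_wpM2l//; apply: (le_trans (ler_norm _)); lra.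
Qed.

(** The 2 is the sum of the geometric series of the increments. The bound passes from finite tail
    suprema to [s n] because [N] is norm continuous. *)
Lemma limsup_seminorm x (s : nat -> V) (N : V -> R) (C K : R) :
  lattice_seminorm N -> (forall y : V, N y <= C * `|y|) ->
  (forall n, tail_sup x n @ \oo --> s n) ->
  (forall n, N (x n.+1 - x n) <= K * 2^-1 ^+ n) ->
  forall n, N (s n - x n) <= 2 * K * 2^-1 ^+ n.
Proof.
move=> lN NC sP xK n.
have h : (fun m => N (tail_sup x n m - x n)) @ \oo --> N (s n - x n).
  by apply: (seminorm_cvg lN NC); apply: cvgB => //; exact: cvg_cst.
apply: (le_cvg _ h (cvg_cst _)); apply: nearW => m.
have K0 : 0 <= K.
  by have := xK 0%N; rewrite expr0 mulr1; apply: le_trans; exact: seminorm_ge0.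
apply: (@le_trans _ _ (\sum_(i < m) N (x (n + i).+1 - x (n + i)%N))).
  apply: (@le_trans _ _ (N (\sum_(i < m) rabs (x (n + i).+1 - x (n + i)%N)))).
    apply: seminorm_mono => //; first by apply/rsubge0; exact: tail_sup_head.
    by apply: (rle_lin1 (tail_sup_dist x n m)); mod.
  apply: (le_trans (seminorm_sum lN _ _ _)); apply: ler_sum => i _.
  by rewrite seminorm_rabs.
apply: (@le_trans _ _ (\sum_(i < m) K * 2^-1 ^+ n * 2^-1 ^+ i)).
  by apply: ler_sum => i _; rewrite -mulrA -exprD; exact: xK.
rewrite -mulr_sumr.
have -> : \sum_(i < m) (2^-1 : R) ^+ i = 2 - 2 * 2^-1 ^+ m.
  by elim: m => [|m ih]; rewrite ?big_ord0 ?expr0 ?big_ord_recr/= ?ih ?exprS; lra.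
have : 0 <= K * 2^-1 ^+ n * 2^-1 ^+ m by rewrite !mulr_ge0// half_ge0.
by lra.
Qed.

(** Order intervals are complete for a lattice seminorm dominated by the norm. The limit is the
    limit superior: [s n] tends to [a] in norm, while [N (s n - x n)] tends to 0. *)
Lemma interval_seminorm_cvg x u (N : V -> R) (C K : R) :
  (forall n, 0 <=^r x n) -> (forall n, x n <=^r u) ->
  lattice_seminorm N -> (forall y : V, N y <= C * `|y|) ->
  (forall n, N (x n.+1 - x n) <= K * 2^-1 ^+ n) ->
  exists a : V, [/\ 0 <=^r a, a <=^r u & (fun n => N (x n - a)) @ \oo --> (0 : R)].
Proof.
move=> x0 xu lN NC xK; have [s [a [sa [a0 au] xs _ sP]]] := limsup_exists x0 xu.
exists a; split=> //.
have h := limsup_seminorm lN NC sP xK.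
have Ns : (fun n => N (s n - a)) @ \oo --> (0 : R).
  rewrite -(seminorm0 lN) -(subrr a); apply: (seminorm_cvg lN NC).
  by apply: cvgB => //; exact: cvg_cst.
have S := cvgD0 (half_cvg (2 * K)) Ns.
apply: (squeeze0 _ S) => n.
rewrite seminorm_ge0//=.
apply: (le_trans (seminorm_triangle lN (s n) _ _)).
by rewrite lerD2r seminormBC.
Qed.

Definition strictly_pos_on (f : dual V) u :=
  pos_functional f /\ forall z, 0 <=^r z -> z <=^r u -> f z = 0 -> z = 0.

(** A second limit superior turns convergence for [f (rabs _)] into norm convergence. The distances
    [b n] to the first limit have increments that are again geometrically small for [f]; their limit
    superior [c] satisfies [f c = 0], so it vanishes, and the [s n], which dominate the [b n], tend
    to 0 in norm. *)
Lemma interval_functional_cvg x u (f : dual V) (K : R) :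
  (forall n, 0 <=^r x n) -> (forall n, x n <=^r u) -> strictly_pos_on f u ->
  (forall n, f (rabs (x n.+1 - x n)) <= K * 2^-1 ^+ n) ->
  exists a : V, [/\ 0 <=^r a, a <=^r u & x @ \oo --> a].
Proof.
move=> x0 xu [pf fu] xK.
have lN := functional_lattice_seminorm pf.
have NC y : f (rabs y) <= dual_norm f * `|y|.
  by rewrite -(norm_rabs y); apply: le_trans (ler_norm _) (dual_norm_ub _ _).
have [a [a0 au fa]] := interval_seminorm_cvg x0 xu lN NC xK.
exists a; split=> //; apply: cvg_dist0.
pose b n := rabs (x n - a).
have b0 n : 0 <=^r b n by exact: rabs_ge0.
have bu n : b n <=^r u.
  apply/rabs_interval; split; first by apply: (rle_lin2 (x0 n) au); mod.
  by apply: (rle_lin2 (xu n) a0); mod.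
have bK n : f (rabs (b n.+1 - b n)) <= K * 2^-1 ^+ n.
  apply: le_trans (xK n); apply: pos_functional_mono => //.
  have -> : x n.+1 - x n = (x n.+1 - a) - (x n - a) by mod.
  exact: rabs_dist.
have [s [c [sc [c0 cu] bs _ sP]]] := limsup_exists b0 bu.
have h := limsup_seminorm lN NC sP bK.
have c00 : c = 0.
  apply: fu => //; apply/eqP; rewrite eq_le pf// andbT.
  have k : (fun n => f (s n)) @ \oo --> f c by exact: dual_cvg.
  have S := cvgD0 (half_cvg (2 * K)) fa.
  apply: (le_cvg _ k S); apply: nearW => n.
  have := h n; rewrite rabs_ge0_id; last exact/rsubge0.
  by rewrite linearB /=; lra.
apply: (squeeze0 (s := fun n => `|s n|)).
  by move=> n; rewrite normr_ge0/=; exact: norm_rabs_le (bs n).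
by rewrite -(normr0 V) -[in X in `|X|]c00; exact: cvg_norm.
Qed.

End Limsup.

(** * Weak compactness of order intervals *)

Section StrictlyPositive.
Context {R : realType} {V : normedRieszType R}.
Hypothesis mV : interval_monotone_cvg V.
Implicit Types (x y z u : V) (f g : dual V).

Local Ltac mod := module (R : Type) (V : Type).

(** Null elements of [0, u] are stable under suprema, since the supremum of two positive elements
    lies below their sum, and under norm limits; so there is a largest one. *)
Lemma null_part f u : 0 <=^r u -> pos_functional f -> exists n,
  [/\ 0 <=^r n, n <=^r u, f n = 0 &
      forall z, 0 <=^r z -> z <=^r u -> f z = 0 -> z <=^r n].
Proof.
move=> u0 pf; pose D : set V := [set z | [/\ 0 <=^r z, z <=^r u & f z = 0]].
have [|a b [a0 au fa] [b0 bu fb]|x Dx xi|x [s [Dx xi xs sD]]] := @directed_sup _ _ D.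
- by exists 0; split; [exact: rle_refl| |rewrite linear0].
- exists (rsup a b); split; [|exact: rsupl|exact: rsupr].
  split; [exact: rle_trans a0 (rsupl _ _)|exact: rsup_lub|].
  apply/eqP; rewrite eq_le; apply/andP; split; last first.
    by apply: pf; exact: rle_trans a0 (rsupl _ _).
  rewrite -[leRHS](addr0 0) -{1}fa -fb -linearD; apply: pos_functional_mono => //.
  by apply: rsup_lub; [apply: (rle_lin1 b0)|apply: (rle_lin1 a0)]; mod.
- by apply: (mV (u := u)) => // n; have [] := Dx n.
- exists s; split.
  + by apply: (rle_cvg _ (cvg_cst 0) xs); apply: nearW => n; have [] := Dx n.
  + by apply: (rle_cvg _ xs (cvg_cst u)); apply: nearW => n; have [] := Dx n.
  + have fs : (fun n => f (x n)) @ \oo --> f s by exact: dual_cvg.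
    apply: (cvg_unique _ fs) => //.
    rewrite (_ : (fun _ => _) = fun _ => 0); first exact: cvg_cst.
    by apply/funext => n; have [] := Dx n.
  + by move=> z z0 zu fz; apply: sD.
Qed.

Let normal f := pos_functional f /\ forall x, `|f x| <= `|x|.

Let normal_mean f g : normal f -> normal g -> normal (2^-1 *: (f + g)).
Proof.
have E x : (2^-1 *: (f + g)) x = 2^-1 * (f x + g x) by [].
move=> [pf f1] [pg g1]; split=> [x x0|x]; rewrite E.
  by have := pf x x0; have := pg x x0; lra.
rewrite normrM ger0_norm; last by lra.
by have := ler_normD (f x) (g x); have := f1 x; have := g1 x; lra.
Qed.

(** The functional [g] is the series of the [f n] with weights [2^-(n+1)], obtained as a pointwise
    limit of partial sums; on positive elements it dominates each of its terms. *)
Let normal_series (f : nat -> dual V) : (forall n, normal (f n)) ->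
  exists g, normal g /\ forall n x, 0 <=^r x -> g x = 0 -> f n x = 0.
Proof.
move=> nf; have [U [uU ooU]] := nat_ultra.
have pU : ProperFilter U by exact: ultra_proper.
pose s N := \sum_(k < N) (2^-1 : R) ^+ k.+1 *: f k.
have sE N x : s N x = \sum_(k < N) 2^-1 ^+ k.+1 * f k x.
  by rewrite /s; elim: N => [|N ih]; rewrite ?big_ord0// !big_ord_recr /= -ih.
have [|g [gU g1]] := @dual_ultralimit _ _ _ U s 1 uU.
  move=> N x; rewrite mul1r sE; apply: (le_trans (ler_norm_sum _ _ _)).
  apply: (@le_trans _ _ (\sum_(k < N) (2^-1 : R) ^+ k.+1 * `|x|)).
    apply: ler_sum => k _; rewrite normrM ger0_norm ?half_ge0// ler_wpM2l ?half_ge0//.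
    exact: (nf k).2.
  rewrite -mulr_suml ler_piMl//.
  have -> : \sum_(k < N) (2^-1 : R) ^+ k.+1 = 1 - 2^-1 ^+ N.
    by elim: N => [|m ih]; rewrite ?big_ord0 ?expr0 ?big_ord_recr/= ?ih ?exprS; lra.
  by have := half_ge0 R N; lra.
have pos n x : 0 <=^r x -> 2^-1 ^+ n.+1 * f n x <= g x.
  move=> x0; apply: (le_cvg _ (cvg_cst _) (gU x)); apply: ooU.
  exists n.+1 => //= N nN; rewrite sE (bigD1 (Ordinal nN))//= lerDl.
  by apply: sumr_ge0 => k _; rewrite mulr_ge0 ?half_ge0//; exact: (nf k).1.
exists g; split.
  split; last by move=> x; have := g1 x; rewrite mul1r.
  by move=> x x0; apply: le_trans (pos 0%N x x0); rewrite mulr_ge0 ?half_ge0//;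
    exact: (nf 0%N).1.
move=> n x x0 gx; apply/eqP; rewrite eq_le (nf n).1// andbT.
by have := pos n x x0; rewrite gx pmulr_rle0 ?half_gt0.
Qed.

(** Exhaustion. [P f d] says that [u - d] is the largest [f]-null element of [0, u], so that [d] is
    the carrier of [f]. Carriers are directed, because the carrier of a mean dominates both
    carriers, and a weighted series absorbs a whole sequence of them; the resulting carrier turns
    out to be [u]. *)
Lemma strictly_pos_exists u : 0 <=^r u -> exists f, strictly_pos_on f u.
Proof.
move=> u0; pose P f d := [/\ normal f, 0 <=^r d, d <=^r u, f (u - d) = 0 &
   forall z, 0 <=^r z -> z <=^r u -> f z = 0 -> z <=^r u - d].
have exP f : normal f -> exists d, P f d.
  move=> nf; have [n [n0 nu fn maxn]] := null_part u0 nf.1.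
  exists (u - n); split=> //; [exact/rsubge0|by apply: (rle_lin1 n0); mod| |].
    by rewrite opprB addrC subrK.
  by move=> z z0 zu fz; rewrite opprB addrC subrK; exact: maxn.
pose D : set V := [set d | exists f, P f d].
have ortho f d g e : P f d -> 0 <=^r e -> e <=^r u -> f (u - e) = 0 -> d <=^r e.
  move=> [_ _ _ _ h] e0 eu fe.
  have k : u - e <=^r u - d by apply: h => //; [exact/rsubge0|apply: (rle_lin1 e0); mod].
  by apply: (rle_lin1 k); mod.
have mean0 f g x : pos_functional f -> pos_functional g -> 0 <=^r x ->
    (2^-1 *: (f + g)) x = 0 -> f x = 0 /\ g x = 0.
  have -> : (2^-1 *: (f + g)) x = 2^-1 * (f x + g x) by [].
  by move=> pf pg x0 e; have := pf x x0; have := pg x x0; split; lra.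
have [|a b [f Pf] [g Pg]|x Dx xi|x [s [Dx xi xs sD]]] := @directed_sup _ _ D.
- have zeroE x : (0 : dual V) x = 0 by [].
  have n0 : normal 0 by split=> [x _|x]; rewrite zeroE ?normr0.
  by have [d Pd] := exP _ n0; exists d, 0.
- have [nf] := Pf; have [ng] := Pg => _ _ _ _ _ _ _ _.
  have [c Pc] := exP _ (normal_mean nf ng); exists c.
  have [_ c0 cu fc _] := Pc.
  have [fc0 gc0] := mean0 f g (u - c) nf.1 ng.1 ((rsubge0 _ _).2 cu) fc.
  by split; [by exists (2^-1 *: (f + g))|exact: (ortho f)|exact: (ortho g)].
- by apply: (mV (u := u)) => // n; have [f []] := Dx n.
- have /choice[f fP] := Dx.
  have [|g [ng gf]] := @normal_series f; first by move=> n; have [] := fP n.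
  have [d Pd] := exP _ ng; have [_ d0 du gd maxd] := Pd.
  have ud : 0 <=^r u - d by exact/rsubge0.
  have xd n : x n <=^r d by apply: (ortho (f n)) => //; exact: gf ud gd.
  have sd : s <=^r d by apply: (rle_cvg _ xs (cvg_cst d)); exact: nearW.
  (* If a functional [h] charged [u - d], the mean of [g] and [h] would have a carrier not below
     [d]; but all carriers lie below [s], hence below [d]. *)
  have n0 : u - d = 0.
    have [h [ph h1 hE]] := pos_norming_functional (u - d).
    apply/eqP; rewrite -normr_eq0 -(rpos_id ud) -hE; apply/eqP.
    have [e Pe] := exP _ (normal_mean ng (conj ph h1)).
    have [_ e0 eu ge _] := Pe.
    have [_ he] := mean0 g h (u - e) ng.1 ph ((rsubge0 _ _).2 eu) ge.
    have ed : e <=^r d by apply: (rle_trans _ sd); apply: sD; exists (2^-1 *: (g + h)).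
    apply/eqP; rewrite eq_le ph// andbT -he; apply: pos_functional_mono => //.
    by apply: (rle_lin1 ed); mod.
  exists g; split; first exact: ng.1.
  by move=> z z0 zu gz; apply: rle_anti => //; rewrite -n0; exact: maxd.
Qed.

End StrictlyPositive.

Section WeakCompactIntervals.
Context {R : realType} {V : normedRieszType R}.
Hypothesis mV : interval_monotone_cvg V.
Implicit Types (x y z u : V) (f g : dual V) (C : set V).

Local Ltac mod := module (R : Type) (V : Type).

Definition midpoint_convex (C : set V) :=
  forall x y, C x -> C y -> C (2^-1 *: (x + y)).

Lemma interval_midpoint x y : midpoint_convex (order_interval x y).
Proof.
have h0 : 0 <= (2^-1 : R) by [].
move=> a b [xa ay] [xb yb]; split.
  by have h := rle_scale h0 (rleD xa xb); apply: (rle_lin1 h); mod.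
by have h := rle_scale h0 (rleD ay yb); apply: (rle_lin1 h); mod.
Qed.

Section Energy.
Variables (u : V) (f : dual V).
Hypotheses (u0 : 0 <=^r u) (pf : pos_functional f).

(* [x ^ 2] is the supremum of its tangents [2 p x - p ^ 2 u]; only finite suprema
   are available. *)
Definition tangent (p : R) x : V := (2 * p) *: x - p ^+ 2 *: u.

Definition tangents (l : seq R) x : V :=
  foldr (fun p acc => rsup (tangent p x) acc) 0 l.

Definition energy x : R := sup [set f (tangents l x) | l in @setT (seq R)].

Lemma tangents_mem l p x : p \in l -> tangent p x <=^r tangents l x.
Proof.
elim: l => //= q l ih; rewrite inE => /orP[/eqP->|/ih h]; first exact: rsupl.
exact: rle_trans h (rsupr _ _).
Qed.

Lemma tangents_le l x y : 0 <=^r y -> (forall p, p \in l -> tangent p x <=^r y) ->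
  tangents l x <=^r y.
Proof.
move=> y0; elim: l => //= p l ih h; apply: rsup_lub; first by apply: h; rewrite mem_head.
by apply: ih => q ql; apply: h; rewrite inE ql orbT.
Qed.

(** For positive [p] this is [2 p x <= 2 p u <= (1 + p^2) u], where the last inequality is
    [(1 - p)^2 >= 0]. *)
Lemma tangents_le_unit l x : 0 <=^r x -> x <=^r u -> tangents l x <=^r u.
Proof.
move=> x0 xu; apply: tangents_le => // p _; rewrite /tangent; have [p0|p0] := leP p 0.
  have h1 : 0 <= - (2 * p) by lra.
  have h2 : 0 <= 1 + p ^+ 2 by rewrite addr_ge0// sqr_ge0.
  by apply: (rle_lin2 (rle_scale h1 x0) (rle_scale h2 u0)); mod.
have h1 : 0 <= 2 * p by lra.
apply: (rle_lin2 (rle_scale h1 xu) (rle_scale (sqr_ge0 (1 - p)) u0)); mod.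
Qed.

Lemma energy_has_sup x : 0 <=^r x -> x <=^r u ->
  has_sup [set f (tangents l x) | l in @setT (seq R)].
Proof.
move=> x0 xu; split; first by exists (f (tangents [::] x)), [::].
by exists (f u) => _ [l _ <-]; apply: pos_functional_mono => //; exact: tangents_le_unit.
Qed.

Lemma energy_ge x l : 0 <=^r x -> x <=^r u -> f (tangents l x) <= energy x.
Proof.
by move=> x0 xu; apply: ub_le_sup; [exact: (energy_has_sup x0 xu).2|exists l].
Qed.

Lemma energy_ge0 x : 0 <=^r x -> x <=^r u -> 0 <= energy x.
Proof. by move=> x0 xu; have := energy_ge [::] x0 xu; rewrite /= linear0. Qed.

Lemma energy_le x : 0 <=^r x -> x <=^r u -> energy x <= f u.
Proof.
move=> x0 xu; apply: ge_sup; first by exists (f (tangents [::] x)), [::].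
by move=> _ [l _ <-]; apply: pos_functional_mono => //; exact: tangents_le_unit.
Qed.

(* The tangents at [r + t/2] and [r - t/2] add up to twice the tangent at [r] of
   the midpoint plus [t (x - y) - t^2/2 u]. *)
Lemma energy_midpoint x y (t : R) : 0 <=^r x -> x <=^r u -> 0 <=^r y -> y <=^r u ->
  0 < t ->
  2 * energy (2^-1 *: (x + y)) + t * f (rabs (x - y)) <=
    energy x + energy y + t ^+ 2 / 2 * f u.
Proof.
move=> x0 xu y0 yu t0; set m := 2^-1 *: (x + y).
suff h l : 2 * f (tangents l m) + t * f (rabs (x - y)) <=
    energy x + energy y + t ^+ 2 / 2 * f u.
  suff : energy m <= (energy x + energy y + t ^+ 2 / 2 * f u - t * f (rabs (x - y))) / 2.
    by lra.
  apply: ge_sup; first by exists (f (tangents [::] m)), [::].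
  by move=> _ [l _ <-]; have := h l; lra.
(* The added slope 0 accounts for the 0 from which [tangents] starts: [key 0] gives [t *: rabs (x -
   y) <= X + Y + (t ^+ 2 / 2) *: u]. *)
pose l' := [seq r + t / 2 | r <- 0 :: l] ++ [seq r - t / 2 | r <- 0 :: l].
pose X := tangents l' x; pose Y := tangents l' y.
have key r : r \in 0 :: l -> (2 : R) *: tangent r m + t *: rabs (x - y) <=^r
    X + Y + (t ^+ 2 / 2) *: u.
  move=> rl.
  have pl : r + t / 2 \in l' by rewrite mem_cat; apply/orP; left; exact: (map_f (fun r => r + t / 2)).
  have ql : r - t / 2 \in l' by rewrite mem_cat; apply/orP; right; exact: (map_f (fun r => r - t / 2)).
  have -> : t *: rabs (x - y) = rabs (t *: (x - y)) by rewrite rabsZ gtr0_norm.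
  suff : rabs (t *: (x - y)) <=^r X + Y + (t ^+ 2 / 2) *: u - 2%:R *: tangent r m.
    by move=> k; apply: (rle_lin1 k); mod.
  apply: rabs_le.
    apply: (rle_lin2 (tangents_mem x pl) (tangents_mem y ql)); rewrite /tangent /m /X /Y.
    by mod.
  apply: (rle_lin2 (tangents_mem x ql) (tangents_mem y pl)); rewrite /tangent /m /X /Y.
  by mod.
suff : 2%:R *: tangents l m + t *: rabs (x - y) <=^r X + Y + (t ^+ 2 / 2) *: u.
  move/(pos_functional_mono pf); rewrite !linearD !linearZ /=.
  have := energy_ge l' x0 xu; have := energy_ge l' y0 yu; rewrite -/X -/Y.
  have E (k : R) z : k *: f z = k * f z by [].
  by rewrite !E; lra.
have half : 0 <= (2^-1 : R) by [].
set B := X + Y + _ in key *.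
suff : tangents l m <=^r 2^-1 *: (B - t *: rabs (x - y)).
  move=> /(rle_scale (ler0n R 2)) h; apply: (rle_lin1 h); mod.
apply: tangents_le.
  have := key 0 (mem_head _ _); rewrite /tangent mulr0 expr0n/= !scale0r subrr scaler0 => h.
  by apply: (rle_lin1 (rle_scale half h)); mod.
move=> r rl; have := key r; rewrite inE rl orbT => /(_ isT) h.
by apply: (rle_lin1 (rle_scale half h)); mod.
Qed.

End Energy.

(* Minimising the strictly convex [energy] over smaller and smaller members of the
   family gives a Cauchy sequence, so the family has a common point. *)
Lemma interval_convex_cluster (J : Type) (F : set_system J) {FF : ProperFilter F}
    (x : J -> V) u : 0 <=^r u -> (\forall j \near F, order_interval 0 u (x j)) ->
  exists a, forall C, closed C -> midpoint_convex C -> (\forall j \near F, C (x j)) -> C a.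
Proof.
move=> u0 xI; have [f fS] := strictly_pos_exists mV u0; have [pf fu] := fS.
set I := order_interval 0 u in xI *.
pose fam C := [/\ closed C, midpoint_convex C, (\forall j \near F, C (x j)) & C `<=` I].
have famI : fam I.
  by split=> //; [exact: closed_interval|exact: interval_midpoint].
have famC A B : closed A -> midpoint_convex A -> (\forall j \near F, A (x j)) ->
    fam B -> fam (A `&` B).
  move=> cA mA FA [cB mB FB BI]; split; [exact: closedI| |exact: filterI|by move=> z []/= _ /BI].
  by move=> z w [Az Bz] [Aw Bw]; split; [exact: mA|exact: mB].
have fam0 C : fam C -> C !=set0.
  by move=> [_ _ /filter_ex[j Cj] _]; exists (x j).
pose Phi := energy u f.
(* The supremum [s] of [S] is the supremum, over the members of the family, of the infimum of
   [Phi]. *)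
pose S := [set c | exists C, fam C /\ forall z, C z -> c <= Phi z].
have hS : has_sup S.
  split; first by exists 0, I; split=> // z [z0 zu]; exact: energy_ge0.
  exists (f u) => c [C [fC hc]]; have [z Cz] := fam0 _ fC.
  by apply: (le_trans (hc z Cz)); have [_ _ _ /(_ z Cz) [z0 zu]] := fC; exact: energy_le.
pose s := sup S.
pose h n := (2^-1 : R) ^+ n.
have h0 n : 0 < h n * h n by rewrite mulr_gt0// half_gt0.
have hS_ n : h n.+1 = h n / 2 by rewrite /h exprS mulrC.
have /choice[Cn CnP] n : exists C, fam C /\ forall z, C z -> s - h n * h n < Phi z.
  have [c [C [fC hc]] sc] := sup_adherent (h0 n) hS.
  by exists C; split=> // z Cz; exact: lt_le_trans sc (hc z Cz).
pose D := fix D n := if n is m.+1 then Cn n `&` D m else Cn 0%N.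
have famD n : fam (D n).
  elim: n => [|n ih]; first exact: (CnP 0%N).1.
  by have [[cA mA FA _] _] := CnP n.+1; exact: famC.
have DD n : D n.+1 `<=` D n by move=> z [].
have DP n z : D n z -> s - h n * h n < Phi z.
  by case: n => [|n] Dz; apply: (CnP _).2 => //; exact: Dz.1.
have low C (e : R) : fam C -> 0 < e -> exists2 z, C z & Phi z < s + e.
  move=> fC e0; apply: contrapT => /forall2NP H.
  suff : s + e <= s by lra.
  apply: ub_le_sup; first exact: hS.2.
  exists C; split=> // z Cz; rewrite leNgt; apply/negP => K.
  by case: (H z).
(* With [t = h n], [energy_midpoint] bounds [2 (s - h^2) + h f(|a - b|)] by
   [2 (s + h^2) + h^2 / 2 * f u]. Dividing by [h] leaves [K * h n]; the tolerance is squared so that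
   a factor [h] survives. *)
pose K := 4 + f u / 2.
have close n a b : D n a -> D n b -> Phi a < s + h n * h n -> Phi b < s + h n * h n ->
    f (rabs (a - b)) <= K * h n.
  move=> Da Db Pa Pb; have [_ mD _ DI] := famD n.
  have [a0 au] := DI a Da; have [b0 bu] := DI b Db.
  have hn : 0 < h n by exact: half_gt0.
  have := energy_midpoint u0 pf a0 au b0 bu hn.
  have := DP n _ (mD _ _ Da Db); rewrite -/Phi => m1 m2.
  rewrite -(ler_pM2r hn) /K; lra.
(* Each member [B] has its own minimizing sequence, but all of them run through the same sets [D n],
   so [close] identifies their limits. *)
have seqB B : fam B -> exists (z : nat -> V) (b : V), [/\ forall n, D n (z n) /\ Phi (z n) < s + h n * h n,
    I b, B b & z @ \oo --> b].
  move=> fB; have [cB mB FB BI] := fB.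
  have /choice[z zP] n : exists z, (B `&` D n) z /\ Phi z < s + h n * h n.
    by have [z ? ?] := low _ _ (famC _ _ cB mB FB (famD n)) (h0 n); exists z.
  have zI n : I (z n) by apply: BI; have [[]] := zP n.
  have [||//|n|b [b0 bu zb]] := @interval_functional_cvg _ _ mV z u f K.
  - by move=> n; have [] := zI n.
  - by move=> n; have [] := zI n.
  - apply: close; [exact/DD/(zP n.+1).1.2|exact: (zP n).1.2| |exact: (zP n).2].
    apply: (lt_le_trans (zP n.+1).2); rewrite lerD2l !hS_.
    by have := h0 n; lra.
  exists z, b; split=> //.
    by move=> n; split; [exact: (zP n).1.2|exact: (zP n).2].
  by apply: (closed_cvg B cB _ _ zb); apply: nearW => n; exact: (zP n).1.1.
have [z [a [zP [a0 au] _ za]]] := seqB I famI.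
exists a => C cC mC FC; have [w [b [wP [b0 bu] [Cb _] wb]]] := seqB _ (famC _ _ cC mC FC famI).
suff -> : a = b by [].
apply/subr0_eq; suff ab0 : rabs (a - b) = 0.
  by apply/eqP; rewrite -normr_eq0 -norm_rabs ab0 normr0.
apply: fu; first exact: rabs_ge0.
  by apply/rabs_interval; split; [apply: (rle_lin2 a0 bu)|apply: (rle_lin2 au b0)]; mod.
have lN := functional_lattice_seminorm pf.
have NC y : f (rabs y) <= dual_norm f * `|y|.
  by rewrite -(norm_rabs y); apply: le_trans (ler_norm _) (dual_norm_ub _ _).
have lim : (fun n => f (rabs (z n - w n))) @ \oo --> f (rabs (a - b)).
  by apply: (seminorm_cvg lN NC); exact: cvgB.
apply/eqP; rewrite eq_le pf ?andbT; last exact: rabs_ge0.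
apply: (le_cvg _ lim (half_cvg K)); apply: nearW => n.
by apply: close; [exact: (zP n).1|exact: (wP n).1|exact: (zP n).2|exact: (wP n).2].
Qed.

(** Along an ultrafilter [f (x j)] has some limit [l]. The strips [|f z - l| <= e] are closed and
    convex and eventually contain [x j], so they contain the common point [a], and [f a = l]. *)
Lemma interval_weak_limit (J : Type) (U : set_system J) (x : J -> V) u :
  UltraFilter U -> 0 <=^r u -> (\forall j \near U, order_interval 0 u (x j)) ->
  exists a, [/\ order_interval 0 u a, forall f, f (x j) @[j --> U] --> f a &
    forall C, closed C -> midpoint_convex C -> (\forall j \near U, C (x j)) -> C a].
Proof.
move=> uU u0 xI; have pU : ProperFilter U by exact: ultra_proper.
have [a aP] := interval_convex_cluster u0 xI; exists a; split=> //.
  by apply: aP => //; [exact: closed_interval|exact: interval_midpoint].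
move=> f; have [|l fl _] := @ultra_bounded_cvg R J U (fun j => f (x j)) (dual_norm f * `|u|) uU.
  apply: filterS xI => j [x0 xu]; apply: (le_trans (dual_norm_ub _ _)).
  rewrite ler_wpM2l//; last exact: norm_mono.
  by apply: le_trans (dual_norm_ball f (_ : `|0 : V| <= 1)); rewrite ?normr0.
suff -> : f a = l by [].
apply/eqP; rewrite -subr_eq0 -normr_le0; apply/ler_addgt0Pr => e e0; rewrite add0r.
apply: (aP [set z | `|f z - l| <= e]).
- apply: (@closed_comp _ _ (fun z => `|f z - l|) [set r | r <= e]); last exact: closed_le.
  move=> z _; apply: cvg_norm; apply: cvgB; last exact: cvg_cst.
  exact: dual_continuous.
- move=> y z /= ye ze; rewrite linearZ linearD /=.
  have -> : 2^-1 *: (f y + f z) - l = 2^-1 * ((f y - l) + (f z - l)).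
    by rewrite /GRing.scale /=; lra.
  rewrite normrM ger0_norm//.
  by have := ler_normD (f y - l) (f z - l); lra.
- move/cvgrPdist_lt : fl => /(_ e e0); apply: filterS => j.
  by rewrite distrC => /ltW.
Qed.

End WeakCompactIntervals.

(** * Factoring through a KB-space implies weak compactness *)

Section WeakTopology.
Context {R : realType} {X : normedModType R}.

Lemma weak_hausdorff : hausdorff_space (weak_space X).
Proof.
move=> p q pq; apply: (@dual_separates _ X) => f.
apply/eqP; rewrite -subr_eq0 -normr_le0; apply/ler_addgt0Pr => e e0; rewrite add0r.
have near (z : weak_space X) : nbhs z [set y : weak_space X | `|f z - f y| < e / 2].
  have /weak_cvgP/(_ f)/cvgrPdist_lt/(_ (e / 2)) : nbhs z --> z by exact: cvg_id.
  by apply; rewrite divr_gt0.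
have [y [/= py qy]] := pq _ _ (near p) (near q).
by have := ler_distD (f y) (f p) (f q); rewrite (distrC (f y)); lra.
Qed.

End WeakTopology.

Section BoundedOperators.
Context {R : realType}.

Lemma operator_bound (V W : normedModType R) (Q : {linear V -> W}) : continuous Q ->
  exists2 C : R, 0 <= C & forall x, `|Q x| <= C * `|x|.
Proof.
move=> /linear_bounded_continuous/bounded_funP/(_ 1)[M QM].
have M0 : 0 <= M by have := QM 0; rewrite normr0 linear0 normr0 ler01 => /(_ isT).
exists M => // x; have [->|x0] := eqVneq x 0.
  by rewrite linear0 !normr0 mulr0.
have nx : 0 < `|x| by rewrite normr_gt0.
have := QM (`|x|^-1 *: x); rewrite linearZ !normrZ normfV normr_id mulVf ?gt_eqF//.
by move=> /(_ (lexx _)); rewrite mulrC ler_pdivrMr.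
Qed.

Lemma bounded_operator (V W : normedModType R) (Q : {linear V -> W}) (C : R) :
  (forall x, `|Q x| <= C * `|x|) -> continuous Q.
Proof.
move=> QC; apply/linear_bounded_continuous/bounded_funP => r; exists (`|C| * r) => x xr.
apply: (le_trans (QC x)); apply: (le_trans (ler_norm _)).
by rewrite normrM normr_id ler_wpM2l.
Qed.

Lemma interval_image_weakly_compact (H : normedRieszType R) (X : normedModType R)
    (S : {linear H -> X}) (v w : H) (A : set H) :
  interval_monotone_cvg H -> continuous S -> A `<=` order_interval v w ->
  relatively_weakly_compact (S @` A).
Proof.
move=> mH cS AI; pose I := order_interval v w.
suff cK : compact (S @` I : set (weak_space X)).
  apply: (subclosed_compact _ cK); first exact: closed_closure.
  have h : (S @` A : set (weak_space X)) `<=` S @` I by exact: image_subset.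
  apply: (subset_trans (closure_subset h)).
  exact: compact_closed weak_hausdorff cK.
rewrite compact_ultra => U uU UK; have pU : ProperFilter U by exact: ultra_proper.
(* For [y] outside the image, [r y] comes from an arbitrary point of the interval, so that [rI]
   holds for every [y]. *)
have /choice[r rP] (y : X) : exists x, I (v + x) /\ ((S @` I) y -> S (v + x) = y).
  have [[x Ix Sx]|nI] := pselect ((S @` I) y); first by exists (x - v); rewrite addrC subrK.
  have [y' [x Ix _]] := filter_ex UK.
  by exists (x - v); rewrite addrC subrK; split.
have rI y : order_interval 0 (w - v) (r y).
  have [[h1 h2] _] := rP y; split; [apply: (rle_lin1 h1)|apply: (rle_lin1 h2)];
    module (R : Type) (H : Type).
have wv : 0 <=^r w - v by have [h1 h2] := rI 0; exact: rle_trans h1 h2.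
have [|a [[a0 aw] aU _]] := interval_weak_limit mH (x := r) uU wv.
  exact: nearW.
exists (S (v + a)); split.
  exists (v + a) => //; split; [apply: (rle_lin1 a0)|apply: (rle_lin1 aw)];
    module (R : Type) (H : Type).
apply/(@weak_cvgP R X U) => f; have [g gf] := dual_comp cS f.
have := aU g => ga; have gv : g (v + r y) @[y --> U] --> f (S (v + a)).
  rewrite -gf linearD; under eq_fun do rewrite linearD.
  by apply: cvgD => //; exact: cvg_cst.
apply: cvg_trans gv; apply: near_eq_cvg; apply: filterS UK => y Ky /=.
by rewrite gf (rP y).2.
Qed.

End BoundedOperators.

Section KBSpaces.
Context {R : realType} (H : banachLatticeType R).
Hypothesis kH : KB_space H.
Implicit Types (x y b : H) (f g : dual H).

Local Ltac mod := module (R : Type) (H : Type).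

Lemma KB_bounded_cvg (x : nat -> H) (C : R) :
  (forall n, `|x n| <= C) -> (forall n, x n <=^r x n.+1) ->
  exists a : H, x @ \oo --> a.
Proof.
move=> xC xi; have xm := homo_nat (@rle_refl R H) (@rle_trans R H) xi.
pose y n := x n - x 0%N.
have y0 n : 0 <=^r y n by apply/rsubge0; exact: xm.
have ym m n : (m <= n)%N -> y m <=^r y n by move=> mn; apply: rle_add2r; exact: xm.
have yb : bounded_fun y.
  apply/(@ex_bound _ _ _ y _ (@globally_properfilter _ setT 0%N I)).
  exists (C + C) => n _ /=.
  by apply: (le_trans (ler_normB _ _)); exact: lerD.
have ya : y @ \oo --> (limn y : H) by exact: kH.
exists (x 0%N + limn y).
rewrite [X in X @ _](_ : x = fun n => x 0%N + y n).
  by apply: cvgD => //; exact: cvg_cst.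
by apply/funext => n; rewrite addrC subrK.
Qed.

Lemma KB_monotone_cvg : interval_monotone_cvg H.
Proof.
by move=> x u x0 xu; apply: (@KB_bounded_cvg x `|u|) => n; exact: norm_mono.
Qed.

(* The elements below the functional [G] form a directed norm bounded set. *)
Lemma KB_bidual_ubound (B : set H) (G : dual H -> R) (C : R) :
  {morph G : f g / f + g} -> (forall f, (forall x, `|f x| <= `|x|) -> G f <= C) ->
  (forall b f, B b -> pos_functional f -> f b <= G f) ->
  exists s, forall b, B b -> b <=^r s.
Proof.
move=> GD GC BG; have [[b0 Bb0]|nB] := pselect (B !=set0); last first.
  by exists 0 => b Bb; case: nB; exists b.
pose D : set H := [set d | b0 <=^r d /\ forall f, pos_functional f -> f d <= G f].
have supD a b : (forall f, pos_functional f -> f a <= G f) ->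
    (forall f, pos_functional f -> f b <= G f) ->
    forall f, pos_functional f -> f (rsup a b) <= G f.
  (* With [g] equal to [f] on the positive part of [a - b], [f (rsup a b) = g a + (f - g) b], which
     is at most [G g + G (f - g) = G f]. *)
  move=> ha hb f pf; have [g [pg gf gE]] := pos_functional_split (a - b) pf.
  rewrite rsup_pos linearD /= -gE linearB /=.
  have pfg : pos_functional (f - g).
    by move=> x x0; have := gf x x0; rewrite [X in _ -> 0 <= X](_ : _ = f x - g x)//; lra.
  have := ha g pg; have := hb _ pfg; rewrite [X in X <= _ -> _](_ : _ = f b - g b)//.
  have -> : G f = G (f - g) + G g by rewrite -GD subrK.
  by lra.
have [||x Dx xi|_ [s [_ _ _ sD]]] := @directed_sup _ _ D.
- by exists b0; split; [exact: rle_refl|move=> f; exact: BG].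
- move=> a b [a0 ha] [_ hb]; exists (rsup a b).
  split; [|exact: rsupl|exact: rsupr].
  by split; [exact: rle_trans a0 (rsupl _ _)|exact: supD].
- apply: (@KB_bounded_cvg x (`|b0| + (C + `|b0|))) => // n.
  have -> : x n = b0 + (x n - b0) by rewrite addrC subrK.
  apply: (le_trans (ler_normD _ _)); rewrite lerD2l.
  have [b0x xG] := Dx n.
  (* The lower bound [b0] makes [x n - b0] positive, so its norm is the value of a positive
     functional, which [G] controls. *)
  have [f [pf f1 fE]] := pos_norming_functional (x n - b0).
  move: fE; rewrite rpos_id; last exact/rsubge0.
  move=> <-; rewrite linearB /=.
  have := xG f pf; have := GC f f1; have := f1 b0; rewrite ler_norml => /andP[].
  by lra.
- exists s => b Bb; apply: (rle_trans (rsupl b b0)); apply: sD; split; first exact: rsupr.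
  by apply: supD => f; exact: BG.
Qed.

End KBSpaces.

(** Here [c] is the adjoint of [Q]. Composed with [c], the bound [G] gives an upper bound of the
    image in [H]; [- F] does the same for the opposite of the image, which yields a lower bound. *)
Lemma KB_factor_b_weakly_compact (R : realType) (E : normedRieszType R)
    (X : completeNormedModType R) (T : {linear E -> X})
    (H : banachLatticeType R) (Q : {linear E -> H}) (S : {linear H -> X}) :
  KB_space H -> continuous Q -> positive_operator Q -> continuous S ->
  (forall x, T x = S (Q x)) -> generalized_b_weakly_compact T.
Proof.
move=> kH cQ pQ cS TE A [F [G FG]].
have [C C0 QC] := operator_bound cQ.
have /choice[c cE] := dual_comp cQ.
have cD (f g : dual H) : c (f + g) = c f + c g.
  by apply: dual_ext => x; rewrite cE [RHS](_ : _ = c f x + c g x)// !cE.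
have cpos (f : dual H) : pos_functional f -> pos_functional (c f).
  by move=> pf x x0; rewrite cE; apply/pf/pQ.
have cnorm (f : dual H) : (forall x : H, `|f x| <= `|x|) -> `|c f| <= C.
  move=> f1; apply: dual_norm_le => x x1; rewrite cE.
  by apply: (le_trans (f1 _)); apply: (le_trans (QC x)); rewrite ler_piMr.
have bound (K : dual (dual E)) (f : dual H) : (forall x : H, `|f x| <= `|x|) ->
    `|K (c f)| <= `|K| * C.
  move=> f1; apply: (le_trans (dual_norm_ub K (c f))).
  by rewrite ler_wpM2l ?cnorm// -[X in 0 <= X]/(`|K|).
have [w hw] : exists w, forall b, (Q @` A) b -> b <=^r w.
  apply: (KB_bidual_ubound kH (G := fun f => G (c f)) (C := `|G| * C)).
  - by move=> f g; rewrite cD linearD.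
  - by move=> f f1; apply: le_trans (ler_norm _) (bound G f f1).
  - by move=> _ f [x Ax <-] pf; rewrite -cE; apply: (FG x Ax).2; exact: cpos.
have [v hv] : exists w, forall b, ((fun x => - Q x) @` A) b -> b <=^r w.
  apply: (KB_bidual_ubound kH (G := fun f => - F (c f)) (C := `|F| * C)).
  - by move=> f g; rewrite cD linearD opprD.
  - by move=> f f1; apply: le_trans (ler_norm _) _; rewrite normrN; exact: bound.
  - move=> _ f [x Ax <-] pf; rewrite linearN /= -cE lerN2.
    by apply: (FG x Ax).1; exact: cpos.
have -> : T @` A = S @` (Q @` A).
  apply/seteqP; split=> [_ [x Ax <-]|_ [_ [x Ax <-] <-]]; last by exists x.
  by rewrite TE; exists (Q x) => //; exists x.
apply: (interval_image_weakly_compact (v := - v) (w := w)) => //.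
  exact: KB_monotone_cvg.
move=> b Bb; split; last exact: hw.
have [x Ax <-] := Bb; rewrite -[Q x]opprK; apply: rleN; apply: hv; by exists x.
Qed.

(** * Increasing norm bounded sequences *)

Section GlidingHump.
Context {R : realType} {X : normedModType R}.

(** The indices below [s k] and the indices [s k], ..., [s (k + m - 1)] are distinct and lie below
    [s (k + m)]. *)
Lemma subsequence_sum_le (F : nat -> R) (s : nat -> nat) k m : (forall n, 0 <= F n) ->
  (forall n, (s n < s n.+1)%N) ->
  \sum_(i < m) F (s (k + i)%N) + \sum_(j < s k) F j <= \sum_(j < s (k + m)%N) F j.
Proof.
move=> F0 si; have mono a b : (a <= b)%N -> \sum_(j < a) F j <= \sum_(j < b) F j.
  move=> ab; rewrite -(subnKC ab) big_split_ord /= lerDl.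
  by apply: sumr_ge0 => i _; exact: F0.
elim: m => [|m ih]; first by rewrite big_ord0 add0r addn0.
rewrite big_ord_recr/= addrAC addnS.
have := mono _ _ (si (k + m)%N); rewrite big_ord_recr/=; apply: le_trans.
by rewrite lerD2r.
Qed.

(* Subtracting from the norming functionals their cluster value makes them null on
   every [a j]; an almost biorthogonal subsequence then stays bounded away from
   zero at the weak limit of the partial sums, where its cluster functional
   vanishes. *)
Lemma weakly_summable_null (a : nat -> X) :
  (forall g : dual X, exists C : R, forall N, \sum_(j < N) `|g (a j)| <= C) ->
  (forall s : nat -> nat, (forall n, (s n < s n.+1)%N) ->
     exists (U : set_system nat) (x : X), [/\ UltraFilter U, \oo `<=` U &
       forall f : dual X, f (\sum_(l < n) a (s l)) @[n --> U] --> f x]) ->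
  forall e : R, 0 < e -> exists j, `|a j| <= e.
Proof.
move=> wuc wcl e e0; apply: contrapT => /forallNP H.
have {}H j : e < `|a j| by rewrite ltNge; apply/negP; exact: H.
have /choice[f fP] j := norming_functional (a j).
have [U0 [uU ooU]] := nat_ultra; have pU : ProperFilter U0 by exact: ultra_proper.
have [|F [FU F1]] := @dual_ultralimit _ _ _ U0 f 1 uU.
  by move=> j x; rewrite mul1r; exact: (fP j).1.
pose g j := f j - F.
have gE j x : g j x = f j x - F x by [].
have g0 x : (fun j => `|g j x|) @ U0 --> (0 : R).
  have h : (fun j => f j x - F x) @ U0 --> F x - F x.
    by apply: cvgB => //; exact: cvg_cst.
  by rewrite -(normr0 R) -(subrr (F x)); exact: cvg_norm h.
have g2 j x : `|g j x| <= 2 * `|x|.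
  by have := ler_normB (f j x) (F x); have := (fP j).1 x; have := F1 x; rewrite gE; lra.
pose c (h : dual X) n := \sum_(j < n) `|h (a j)|.
have cS h n : c h n.+1 = c h n + `|h (a n)| by rewrite /c big_ord_recr.
have cmono h m n : (m <= n)%N -> c h m <= c h n.
  move=> mn; rewrite /c -(subnKC mn) big_split_ord /= lerDl.
  exact: sumr_ge0.
have tail (h : dual X) d : 0 < d -> exists N, forall m n, (N <= m)%N -> (m <= n)%N ->
    c h n - c h m <= d.
  move=> d0; have [C hC] := wuc h.
  have hcv : c h @ \oo --> limn (c h).
    apply: nondecreasing_is_cvgn; first by move=> m n; exact: cmono.
    by exists C => _ [n _ <-]; exact: hC.
  have [|N hN] := (@cvgnP R R (c h) _).1 hcv (d / 2); first by lra.
  exists N => m n Nm mn; have := hN m Nm; have := hN n (leq_trans Nm mn).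
  have := ler_normB (limn (c h) - c h m) (limn (c h) - c h n).
  have := ler_norm (c h n - c h m).
  by rewrite (_ : limn (c h) - c h m - (limn (c h) - c h n) = c h n - c h m); lra.
have [|N0 hN0] := tail F (e / 2); first by lra.
(* The values [F (a j)] are terms of an absolutely convergent series, so beyond [N0] they take away
   at most [e / 2] from [f j (a j) = |a j| > e]. *)
have gbig j : (N0 <= j)%N -> e / 2 < g j (a j).
  move=> Nj; have := hN0 j j.+1 Nj (leqnSn _); rewrite cS gE (fP j).2.
  by have := H j; have := ler_norm (F (a j)); lra.
have csmall m (d : R) : 0 < d -> \forall j \near U0, c (g j) m <= d.
  elim: m d => [|m ih] d d0.
    by apply: nearW => j; rewrite /c big_ord0 ltW.
  have d20 : 0 < d / 2 by lra.
  move/cvgrPdist_lt : (g0 (a m)) => /(_ _ d20) k.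
  apply: filterS2 k (ih _ d20) => j; rewrite sub0r normrN normr_id cS; lra.
(* The next index [i'] is chosen so that [g i'] is almost null on [a 0], ..., [a i], and so that
   [g i] is almost null on the terms from [a i'] on. In [low] the diagonal term then loses at most
   [e / 8] on either side, which leaves [e / 4]. *)
have [||s [s0 sP]] := @dep_choice nat (fun i => (N0 <= i)%N) (fun k i i' =>
    [/\ (i < i')%N, c (g i') i.+1 <= e / 8 * 2^-1 ^+ k &
        forall M, (i' <= M)%N -> c (g i) M - c (g i) i' <= e / 8]) N0.
- by [].
- move=> k i Ni; have [|N hN] := tail (g i) (e / 8); first by lra.
  have k0 : 0 < e / 8 * 2^-1 ^+ k by rewrite mulr_gt0 ?half_gt0//; lra.
  have big : \forall j \near U0, (maxn i.+1 N <= j)%N.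
    by apply: ooU; exists (maxn i.+1 N).
  have [j [jm jc]] := filter_ex (filterI big (csmall i.+1 _ k0)).
  move: jm; rewrite /= geq_max => /andP[ij Nj].
  exists j; first by rewrite (leq_trans Ni)// ltnW.
  by split=> // M jM; exact: hN.
have sinc n : (s n < s n.+1)%N by have [_ []] := sP n.
have [U [x [uU1 ooU1 xU]]] := wcl s sinc.
have pU1 : ProperFilter U by exact: ultra_proper.
have sub (h : dual X) k m : \sum_(i < m) `|h (a (s (k + i)%N))| + c h (s k) <=
    c h (s (k + m)%N) by exact: (subsequence_sum_le (F := fun j => `|h (a j)|)).
have head k : \sum_(l < k.+1) `|g (s k.+1) (a (s l))| <= e / 8 * 2^-1 ^+ k.
  have [_ [_ h1 _]] := sP k; apply: le_trans h1.
  rewrite cS big_ord_recr/= lerD2r.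
  have := sub (g (s k.+1)) 0%N k; rewrite add0n; apply: le_trans.
  by rewrite lerDl; exact: sumr_ge0.
have e2h (k : nat) : e / 8 * 2^-1 ^+ k <= e / 8.
  by rewrite ler_piMr//; [lra|rewrite exprn_ile1//; lra].
have low k m : e / 4 <= g (s k) (\sum_(l < k.+1 + m) a (s l)).
  rewrite linear_sum big_split_ord big_ord_recr/=.
  have [N0k [_ _ h2]] := sP k; have gk := gbig _ N0k.
  have t1 : `|\sum_(l < k) g (s k) (a (s l))| <= e / 8.
    apply: (le_trans (ler_norm_sum _ _ _)); case: k {h2 N0k gk} => [|k].
      by rewrite big_ord0; lra.
    exact: le_trans (head k) (e2h k).
  have t2 : `|\sum_(i < m) g (s k) (a (s (k.+1 + i)%N))| <= e / 8.
    apply: (le_trans (ler_norm_sum _ _ _)).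
    have k1 : (s k.+1 <= s (k.+1 + m)%N)%N.
      apply: (@homo_nat nat (fun a b => (a <= b)%N) s) => //; last exact: leq_addr.
        by move=> ? ? ?; exact: leq_trans.
      by move=> n; exact: ltnW.
    by have := h2 _ k1; have := sub (g (s k)) k.+1 m; lra.
  move: t1 t2; rewrite !ler_norml => /andP[? _] /andP[? _].
  by rewrite [X in _ <= _ + X](_ : _ = \sum_(i < m) g (s k) (a (s (k.+1 + i)%N))); lra.
have gx k : e / 4 <= g (s k) x.
  apply: (le_cvg _ (cvg_cst _) (xU (g (s k)))); apply: ooU1.
  by exists k.+1 => //= n kn; rewrite -(subnKC kn); exact: low.
have [h [hU _]] := @dual_ultralimit _ _ _ U (fun k => g (s k)) 2 uU1 (fun k => g2 (s k)).
have h0 l : h (a (s l)) = 0.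
  have hn : (fun k => `|g (s k) (a (s l))|) @ U --> `|h (a (s l))|.
    by apply: cvg_norm; exact: hU.
  apply/eqP; rewrite -normr_le0.
  (* The bound [e / 8 * 2^-k] of [head] concerns the index [k.+1], hence the constant [e / 4]. *)
  have K : (fun k => e / 4 * 2^-1 ^+ k) @ U --> (0 : R).
    by move=> A /(half_cvg (e / 4)) hA; exact: ooU1.
  apply: (le_cvg _ hn K); apply: ooU1; exists l.+1 => // -[//|k] lk.
  rewrite exprS; apply: (@le_trans _ _ (e / 8 * 2^-1 ^+ k)); last by lra.
  apply: le_trans (head k); have lk1 : (l < k.+1)%N by exact: lk.
  by rewrite (bigD1 (Ordinal lk1))//= lerDl; exact: sumr_ge0.
have hx : h x = 0.
  apply: (cvg_unique _ (xU h)) => //; rewrite (_ : (fun _ => _) = fun _ => 0).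
    exact: cvg_cst.
  by apply/funext => n; rewrite linear_sum big1// => l _; exact: h0.
have : e / 4 <= h x by apply: (le_cvg _ (cvg_cst _) (hU x)); exact: nearW.
by rewrite hx; lra.
Qed.

End GlidingHump.

(** * The solid seminorm of an operator *)

Section SolidSeminorm.
Context {R : realType} {E : normedRieszType R} {X : normedModType R}.
Variables (T : {linear E -> X}) (C : R).
Hypothesis TC : forall x, `|T x| <= C * `|x|.
Hypothesis C0 : 0 <= C.
Implicit Types x y z : E.

Local Ltac mod := module (R : Type) (E : Type).

Definition solid_seminorm x : R := sup [set `|T y| | y in [set y : E | rabs y <=^r rabs x]].

Let has_sup_solid x : has_sup [set `|T y| | y in [set y : E | rabs y <=^r rabs x]].
Proof.
split; first by exists `|T x|, x => //=; exact: rle_refl.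
exists (C * `|x|) => _ [y /= yx <-]; apply: (le_trans (TC y)).
by rewrite ler_wpM2l// lattice_norm.
Qed.

Lemma solid_seminorm_ge x y : rabs y <=^r rabs x -> `|T y| <= solid_seminorm x.
Proof. by move=> yx; apply: ub_le_sup; [exact: (has_sup_solid x).2|exists y]. Qed.

Lemma solid_seminorm_le x (r : R) : (forall y, rabs y <=^r rabs x -> `|T y| <= r) ->
  solid_seminorm x <= r.
Proof. by move=> h; apply: ge_sup; [exact: (has_sup_solid x).1|move=> _ [y yx <-]; exact: h]. Qed.

Lemma solid_seminorm_bound x : solid_seminorm x <= C * `|x|.
Proof.
apply: solid_seminorm_le => y yx; apply: (le_trans (TC y)).
by rewrite ler_wpM2l// lattice_norm.
Qed.

(** For the triangle inequality, the positive and negative parts of [w] are each decomposed along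
    [rabs x + rabs y]; the differences of corresponding pieces are bounded in absolute value by
    [rabs x] and by [rabs y]. *)
Lemma solid_seminorm_lattice : lattice_seminorm solid_seminorm.
Proof.
have mono x y : rabs x <=^r rabs y -> solid_seminorm x <= solid_seminorm y.
  move=> xy; apply: solid_seminorm_le => z zx; apply: solid_seminorm_ge.
  exact: rle_trans zx xy.
have Zle k x : solid_seminorm (k *: x) <= `|k| * solid_seminorm x.
  have [->|kn0] := eqVneq k 0.
    rewrite scale0r normr0 mul0r; apply: (le_trans (solid_seminorm_bound _)).
    by rewrite normr0 mulr0.
  apply: solid_seminorm_le => y; rewrite rabsZ => yx.
  have nk : 0 <= `|k|^-1 by rewrite invr_ge0.
  have := solid_seminorm_ge (x := x) (y := k^-1 *: y).
  rewrite linearZ normrZ normfV rabsZ normfV ler_pdivrMl ?normr_gt0//; apply.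
  have := rle_scale nk yx; rewrite scalerA mulVf ?scale1r//.
  by rewrite normr_eq0.
split=> // [x y|k x].
- apply: solid_seminorm_le => w wxy; have := rle_trans wxy (rabsD x y).
  set a := rabs x; set b := rabs y => wab.
  have a0 : 0 <=^r a by exact: rabs_ge0.
  have b0 : 0 <=^r b by exact: rabs_ge0.
  have wp : rpos w <=^r a + b by exact: rle_trans (rpos_le_rabs _) wab.
  have wn : rpos (- w) <=^r a + b by apply: rle_trans (rpos_le_rabs _) _; rewrite rabsN.
  have [p1 p2 p3 p4] := rdecomp (rpos_ge0 w) a0 b0 wp.
  have [n1 n2 n3 n4] := rdecomp (rpos_ge0 (- w)) a0 b0 wn.
  move: p1 p2 p3 p4 n1 n2 n3 n4; set p := rinf _ _; set n := rinf _ _ => *.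
  have -> : w = (p - n) + ((rpos w - p) - (rpos (- w) - n)).
    by rewrite -{1}(rposBN w); mod.
  rewrite linearD; apply: (le_trans (ler_normD _ _)).
  apply: lerD; apply: solid_seminorm_ge; rewrite -/a -/b; apply/rabs_interval; split.
  + by apply: (@rle_lin2 _ _ 0 p n a) => //; mod.
  + by apply: (@rle_lin2 _ _ 0 n p a) => //; mod.
  + by apply: (@rle_lin2 _ _ 0 (rpos w - p) (rpos (- w) - n) b) => //; mod.
  + by apply: (@rle_lin2 _ _ 0 (rpos (- w) - n) (rpos w - p) b) => //; mod.
- apply/eqP; rewrite eq_le Zle/=; have [->|kn0] := eqVneq k 0.
    rewrite normr0 mul0r; apply: (@le_trans _ _ `|T 0|) => //.
    by apply: solid_seminorm_ge; rewrite rabs0; exact: rabs_ge0.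
  by rewrite -ler_pdivlMl ?normr_gt0// -normfV -{1}[x](scalerK kn0) Zle.
Qed.

(** Of the positive and negative parts of a near maximizer, one contributes at least half. *)
Lemma solid_seminorm_pos x (e : R) : 0 <=^r x -> 0 < e -> e < solid_seminorm x ->
  exists y, [/\ 0 <=^r y, y <=^r x & e / 2 < `|T y|].
Proof.
move=> x0 e0 ex; apply: contrapT => /forallNP H.
have {}H y : 0 <=^r y -> y <=^r x -> `|T y| <= e / 2.
  by move=> y0 yx; rewrite leNgt; apply/negP => k; apply: (H y).
suff : solid_seminorm x <= e by lra.
apply: solid_seminorm_le => y; rewrite (rabs_ge0_id x0) => yx.
rewrite -(rposBN y) linearB; apply: (le_trans (ler_normB _ _)).
have h1 : `|T (rpos y)| <= e / 2.
  by apply: H; [exact: rpos_ge0|exact: rle_trans (rpos_le_rabs _) yx].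
have h2 : `|T (rpos (- y))| <= e / 2.
  apply: H; first exact: rpos_ge0.
  by apply: rle_trans (rpos_le_rabs _) _; rewrite rabsN.
by lra.
Qed.

(* A signed sum of the [y j] lies between the sum of the [y j] and its opposite. *)
Lemma functional_sum_bound (g : dual E) (y : nat -> E) (x : E) N :
  (forall j, 0 <=^r y j) -> \sum_(j < N) y j <=^r x ->
  \sum_(j < N) `|g (y j)| <= dual_norm g * `|x|.
Proof.
move=> y0 yx; pose s j : R := if 0 <= g (y j) then 1 else -1.
have -> : \sum_(j < N) `|g (y j)| = g (\sum_(j < N) s j *: y j).
  rewrite linear_sum; apply: eq_bigr => j _; rewrite linearZ /s /=.
  case: leP => [h|h]; first by rewrite ger0_norm// scale1r.
  by rewrite ltr0_norm// scaleN1r.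
apply: (le_trans (ler_norm _)); apply: (le_trans (dual_norm_ub _ _)).
rewrite ler_wpM2l//.
  by apply: le_trans (dual_norm_ball g (_ : `|0 : E| <= 1)); rewrite ?normr0.
apply: norm_rabs_le; apply: rle_trans yx; apply: (rle_trans (rabs_sum _ _ _)).
apply: rle_sum => j _; rewrite rabsZ (rabs_ge0_id (y0 j)) /s.
by case: ifP => _; rewrite ?normrN normr1 scale1r; exact: rle_refl.
Qed.

End SolidSeminorm.

(** The upper bound in the bidual is a limit of the evaluations at [x n] along an ultrafilter; the
    lower bound is 0. *)
Lemma monotone_b_order_bounded (R : realType) (E : normedRieszType R) (x : nat -> E) (M : R) :
  (forall n, `|x n| <= M) -> (forall n, x n <=^r x n.+1) ->
  topologically_b_order_bounded [set e : E | 0 <=^r e /\ exists n, e <=^r x n].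
Proof.
move=> xM xi; have [U [uU ooU]] := nat_ultra.
have pU : ProperFilter U by exact: ultra_proper.
have [|G [GU _]] := @dual_ultralimit _ _ _ U (fun n => evaluation (x n)) M uU.
  move=> n f; apply: (le_trans (dual_norm_ub f (x n))).
  rewrite mulrC ler_wpM2r//.
  by apply: le_trans (dual_norm_ball f (_ : `|0 : E| <= 1)); rewrite ?normr0.
exists 0, G => e [e0 [n en]]; split=> f pf; first exact: (pf e e0).
apply: (le_cvg _ (cvg_cst _) (GU f)); apply: ooU; exists n => //= m nm.
apply: pos_functional_mono => //; apply: rle_trans en _.
exact: (homo_nat (@rle_refl R E) (@rle_trans R E) xi).
Qed.

(** Otherwise some increments [x (t n.+1) - x (t n)] have seminorm above [e], and there are positive
    [y n] below them with [|T (y n)| > e / 2]. Sums of the [y n] along a subsequence stay below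
    terms of [x]: being norm bounded they make the [T (y n)] weakly summable, and lying in one
    topologically b-order bounded set they provide the weak limits that [weakly_summable_null] asks
    for. *)
Lemma b_weakly_compact_cauchy (R : realType) (E : normedRieszType R)
    (X : completeNormedModType R) (T : {linear E -> X}) (x : nat -> E) (M : R) :
  continuous T -> generalized_b_weakly_compact T ->
  (forall n, 0 <=^r x n) -> (forall n, `|x n| <= M) -> (forall n, x n <=^r x n.+1) ->
  forall e : R, 0 < e -> exists N, forall n, (N <= n)%N ->
    solid_seminorm T (x n - x N) <= e.
Proof.
move=> cT bT x0 xM xi e e0.
have [C C0 TC] := operator_bound cT; have lq := solid_seminorm_lattice TC C0.
have xm := homo_nat (@rle_refl R E) (@rle_trans R E) xi.
apply: contrapT => /forallNP H.
have [|k n _|t [_ tP]] := @dep_choice nat (fun=> True) (fun _ m n => (m < n)%N /\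
    e < solid_seminorm T (x n - x m)) 0%N.
- by [].
- have /existsNP[m /not_implyP[nm /negP]] := H n; rewrite -ltNge => em.
  exists m => //; split=> //; rewrite ltn_neqAle nm andbT; apply/eqP => nE.
  by move: em; rewrite -nE subrr (seminorm0 lq); lra.
have tm n : (t n < t n.+1)%N by exact: (tP n).2.1.
have /choice[y yP] n : exists y, [/\ 0 <=^r y, y <=^r x (t n.+1) - x (t n) & e / 2 < `|T y|].
  apply: (solid_seminorm_pos TC C0) => //; last exact: (tP n).2.2.
  by apply/rsubge0; apply: xm; exact: ltnW.
have y0 n : 0 <=^r y n by have [] := yP n.
(* The increment under which [y (s n)] lies ends at [t (s n).+1], which is at most [t (s n.+1)]. *)
have ysum (s : nat -> nat) : (forall n, (s n < s n.+1)%N) ->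
    forall n, \sum_(l < n) y (s l) <=^r x (t (s n)).
  move=> sm; elim=> [|n ih]; first by rewrite big_ord0.
  rewrite big_ord_recr/=; have [_ h _] := yP (s n).
  have tle := homo_nat (@leqnn) (fun a b c => @leq_trans b a c) (fun n => ltnW (tm n)).
  have k : x (t (s n).+1) <=^r x (t (s n.+1)) by apply: xm; apply: tle; exact: sm.
  by apply: rle_trans k; apply: (rle_lin2 ih h); module (R : Type) (E : Type).
have [||//|j] := @weakly_summable_null R X (fun j => T (y j)) _ _ (e / 2).
- move=> g; have [h hE] := dual_comp cT g; exists (dual_norm h * M) => N.
  under eq_bigr do rewrite -hE.
  apply: (le_trans (functional_sum_bound h y0 (ysum id (fun n => ltnSn n) N))).
  rewrite ler_wpM2l//.
  by apply: le_trans (dual_norm_ball h (_ : `|0 : E| <= 1)); rewrite ?normr0.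
- move=> s sm; have [U [uU ooU]] := nat_ultra.
  have pU : ProperFilter U by exact: ultra_proper.
  have := bT _ (monotone_b_order_bounded xM xi); rewrite /relatively_weakly_compact.
  rewrite compact_ultra => /(_ _ (ultra_fmap (fun n => \sum_(l < n) T (y (s l))) uU)).
  case=> [|z [_ /= zU]].
    apply: nearW => n; apply: subset_closure; exists (\sum_(l < n) y (s l)).
      by split; [exact: rsum_ge0|exists (t (s n)); exact: ysum].
    by rewrite linear_sum.
  exists U, z; split=> // f.
  by have /weak_cvgP/(_ f) := zU.
- by lra.
- by have [_ _] := yP j; lra.
Qed.

(** * The interpolation norm *)

Section Interpolation.
Context {R : realType} {E : normedRieszType R}.
Variables (q : E -> R) (C : R).
Hypotheses (lq : lattice_seminorm q) (qC : forall x, q x <= C * `|x|) (C0 : 0 <= C).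
Implicit Types x y z v : E.

Local Ltac mod := module (R : Type) (E : Type).

Section KFunctional.
Variables a b : R.
Hypotheses (a0 : 0 < a) (b0 : 0 < b).

Let splits x : set (E * E) :=
  [set yz | [/\ 0 <=^r yz.1, 0 <=^r yz.2 & rabs x <=^r yz.1 + yz.2]].

Let cost (yz : E * E) : R := a * `|yz.1| + b * q yz.2.

(** Peetre's K-functional for the norm and [q]. Splits only have to dominate [rabs x], which makes
    monotonicity immediate. *)
Definition K_functional x : R := inf (cost @` splits x).

Let cost_ge0 yz : 0 <= cost yz.
Proof.
apply: addr_ge0; first exact: mulr_ge0 (ltW a0) (normr_ge0 _).
exact: mulr_ge0 (ltW b0) (seminorm_ge0 lq _).
Qed.

Let has_inf_cost x : has_inf (cost @` splits x).
Proof.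
split; last by exists 0 => _ [yz _ <-]; exact: cost_ge0.
exists (cost (rabs x, 0)), (rabs x, 0) => //; split; rewrite ?addr0 //=;
  by [exact: rabs_ge0|exact: rle_refl].
Qed.

Lemma K_functional_le x y z : 0 <=^r y -> 0 <=^r z -> rabs x <=^r y + z ->
  K_functional x <= a * `|y| + b * q z.
Proof.
move=> y0 z0 xyz; apply: ge_inf; first exact: (has_inf_cost x).2.
by exists (y, z).
Qed.

Lemma K_functional_lt x (r : R) : K_functional x < r ->
  exists y z, [/\ 0 <=^r y, 0 <=^r z, rabs x <=^r y + z & a * `|y| + b * q z < r].
Proof.
move=> xr; have r0 : 0 < r - K_functional x by lra.
have [_ [[y z] [y0 z0 xyz] <-] h] := inf_adherent r0 (has_inf_cost x).
by exists y, z; split=> //; move: h; rewrite /cost -/(K_functional x) /=; lra.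
Qed.

Lemma K_functional_lower x (r : R) :
  (forall y z, 0 <=^r y -> 0 <=^r z -> rabs x <=^r y + z -> r <= a * `|y| + b * q z) ->
  r <= K_functional x.
Proof.
move=> h; apply: lb_le_inf; first exact: (has_inf_cost x).1.
by move=> _ [[y z] [y0 z0 xyz] <-]; exact: h.
Qed.

Lemma K_functional_norm x : K_functional x <= a * `|x|.
Proof.
have := @K_functional_le x (rabs x) 0 (rabs_ge0 x) (rle_refl 0).
by rewrite addr0 norm_rabs (seminorm0 lq) mulr0 addr0; apply; exact: rle_refl.
Qed.

Lemma K_functional_seminorm x : K_functional x <= b * q x.
Proof.
have := @K_functional_le x 0 (rabs x) (rle_refl 0) (rabs_ge0 x).
by rewrite add0r normr0 mulr0 add0r (seminorm_rabs lq); apply; exact: rle_refl.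
Qed.

Lemma K_functional_lattice : lattice_seminorm K_functional.
Proof.
have Zle k x : K_functional (k *: x) <= `|k| * K_functional x.
  have [->|kn0] := eqVneq k 0.
    rewrite scale0r normr0 mul0r; apply: (le_trans (K_functional_norm _)).
    by rewrite normr0 mulr0.
  rewrite -ler_pdivrMl ?normr_gt0//; apply: K_functional_lower => y z y0 z0 xyz.
  rewrite ler_pdivrMl ?normr_gt0//.
  have := @K_functional_le (k *: x) (`|k| *: y) (`|k| *: z).
  rewrite normrZ normr_id; have [_ qZ _] := lq; rewrite qZ normr_id => h.
  rewrite mulrDr !(mulrCA `|k|); apply: h; try exact: scaler_rge0.
  by rewrite rabsZ -scalerDr; exact: rle_scale.
split=> [x x'|k x|x x' xx'].
- apply/ler_addgt0Pr => e e0.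
  have [|y [z [y0 z0 xyz h]]] := @K_functional_lt x (K_functional x + e / 2); first by lra.
  have [|y' [z' [y0' z0' xyz' h']]] := @K_functional_lt x' (K_functional x' + e / 2).
    by lra.
  have := @K_functional_le (x + x') (y + y') (z + z') (raddge0 y0 y0') (raddge0 z0 z0').
  move=> k; apply: (le_trans (k _)).
    by apply: (rle_trans (rabsD _ _)); apply: (rle_lin2 xyz xyz'); mod.
  have := ler_wpM2l (ltW a0) (ler_normD y y').
  have [qD _ _] := lq; have := ler_wpM2l (ltW b0) (qD z z').
  by rewrite !mulrDr; lra.
- apply/eqP; rewrite eq_le Zle/=; have [->|kn0] := eqVneq k 0.
    by rewrite normr0 mul0r; apply: K_functional_lower => y z _ _ _; exact: (cost_ge0 (y, z)).
  by rewrite -ler_pdivlMl ?normr_gt0// -normfV -{1}[x](scalerK kn0) Zle.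
- apply: K_functional_lower => y z y0 z0 h; apply: K_functional_le => //.
  exact: rle_trans xx' h.
Qed.

End KFunctional.

Let h n : R := 2^-1 ^+ n.
Let h0 n : 0 < h n. Proof. exact: half_gt0. Qed.
Let hV0 n : 0 < (h n)^-1. Proof. by rewrite invr_gt0. Qed.

(** The weight [2^-n] on the norm makes the series converge; the weight [2^n] on [q] forces the
    second part of a cheap split to be small for [q]. *)
Definition interp_term n x : R := K_functional (h n) (h n)^-1 x.

Definition interp_sum N x : R := \sum_(n < N) interp_term n x.

(* The sum over [n] of the gauges of [2^n B + 2^-n Q], with [B] and [Q] the unit balls
   of the norm and of [q]. *)
Definition interp_norm x : R := limn (interp_sum ^~ x).

Let lterm n : lattice_seminorm (interp_term n).
Proof. exact: K_functional_lattice. Qed.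

Let sum_mono x m n : (m <= n)%N -> interp_sum m x <= interp_sum n x.
Proof.
move=> mn; rewrite /interp_sum -(subnKC mn) big_split_ord /= lerDl.
by apply: sumr_ge0 => i _; exact: seminorm_ge0 (lterm _) _.
Qed.

Let sum_le x N : interp_sum N x <= 2 * `|x|.
Proof.
apply: (@le_trans _ _ (\sum_(n < N) h n * `|x|)).
  by apply: ler_sum => n _; exact: K_functional_norm.
rewrite -mulr_suml ler_wpM2r//.
have -> : \sum_(n < N) h n = 2 - 2 * h N.
  by rewrite /h; elim: N => [|m ih]; rewrite ?big_ord0 ?expr0 ?big_ord_recr/= ?ih ?exprS; lra.
by have := h0 N; lra.
Qed.

Lemma interp_norm_cvg x : (interp_sum ^~ x) @ \oo --> interp_norm x.
Proof.
apply: nondecreasing_is_cvgn; first by move=> m n; exact: sum_mono.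
by exists (2 * `|x|) => _ [N _ <-]; exact: sum_le.
Qed.

Lemma interp_norm_le x : interp_norm x <= 2 * `|x|.
Proof. by apply: (le_cvg _ (@interp_norm_cvg x) (cvg_cst _)); exact: nearW. Qed.

Lemma interp_sum_le x N : interp_sum N x <= interp_norm x.
Proof.
apply: (le_cvg _ (cvg_cst _) (@interp_norm_cvg x)); exists N => // n.
exact: sum_mono.
Qed.

Lemma interp_term_le x n : interp_term n x <= interp_norm x.
Proof.
apply: le_trans (interp_sum_le x n.+1); rewrite /interp_sum big_ord_recr/= lerDr.
by apply: sumr_ge0 => i _; exact: seminorm_ge0 (lterm _) _.
Qed.

(** The term of index 0, where both weights are 1, suffices: [q x <= q y + q z <= C |y| + q z]. *)
Lemma seminorm_le_interp x : q x <= (C + 1) * interp_norm x.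
Proof.
have C1 : 0 < C + 1 by apply: ltr_wpDl.
rewrite mulrC -ler_pdivrMr//; apply: le_trans (interp_term_le x 0).
apply: (K_functional_lower (h0 0) (hV0 0)) => y z y0 z0 xyz.
rewrite /h expr0 invr1 !mul1r ler_pdivrMr//.
have := seminorm_rabs_le lq xyz; have [qD _ _] := lq.
move=> /le_trans; apply; apply: (le_trans (qD _ _)).
rewrite mulrDl; have := qC y; have := seminorm_ge0 lq z; have := mulr_ge0 C0 (seminorm_ge0 lq z).
by have := normr_ge0 y; lra.
Qed.

Lemma interp_norm_lattice : lattice_seminorm interp_norm.
Proof.
split=> [x y|k x|x y xy].
- have k : (fun N => interp_sum N x + interp_sum N y) @ \oo -->
      interp_norm x + interp_norm y by apply: cvgD; exact: interp_norm_cvg.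
  apply: (le_cvg _ (@interp_norm_cvg _) k); apply: nearW => N.
  rewrite /interp_sum -big_split /=.
  by apply: ler_sum => n _; have [pD _ _] := lterm n.
- apply: (cvg_unique _ (@interp_norm_cvg _)) => //.
  rewrite (_ : interp_sum ^~ _ = fun N => `|k| * interp_sum N x).
    by apply: cvgMr; exact: interp_norm_cvg.
  apply/funext => N; rewrite /interp_sum mulr_sumr; apply: eq_bigr => n _.
  by have [_ pZ _] := lterm n.
- apply: (le_cvg _ (@interp_norm_cvg x) (@interp_norm_cvg y)); apply: nearW => N.
  by apply: ler_sum => n _; have [_ _ pm] := lterm n; exact: pm.
Qed.

(** The difference is the sum of the terms from [N] on, each monotone on positive elements. *)
Lemma interp_tail_mono N x y : 0 <=^r x -> x <=^r y ->
  interp_norm x - interp_sum N x <= interp_norm y - interp_sum N y.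
Proof.
move=> x0 xy.
have k z : (fun n => interp_sum n z - interp_sum N z) @ \oo -->
    interp_norm z - interp_sum N z.
  by apply: cvgB; [exact: interp_norm_cvg|exact: cvg_cst].
apply: (le_cvg _ (k x) (k y)); exists N => // n /= Nn.
rewrite /interp_sum -(subnKC Nn) !big_split_ord /=.
have cancel (c d : R) : c + d - c = d by ring.
rewrite !cancel.
by apply: ler_sum => i _; exact: (seminorm_mono (lterm _)).
Qed.

Hypothesis mE : interval_monotone_cvg E.
Hypothesis q_cauchy : forall (x : nat -> E) (M : R), (forall n, 0 <=^r x n) ->
  (forall n, `|x n| <= M) -> (forall n, x n <=^r x n.+1) ->
  forall e : R, 0 < e -> exists N, forall n, (N <= n)%N -> q (x n - x N) <= e.

(* Each [v k] splits as [y k + z k] with [y k] norm bounded and [q (z k)] small; weak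
   limits in [j] of the infima of [v k] and [y j] make the first part monotone. *)
Lemma interp_bounded_q_cauchy (v : nat -> E) (M : R) :
  (forall n, 0 <=^r v n) -> (forall n, v n <=^r v n.+1) ->
  (forall n, interp_norm (v n) <= M) ->
  forall e : R, 0 < e -> exists N, forall n, (N <= n)%N -> q (v n - v N) <= e.
Proof.
move=> v0 vi vM e e0; have vm := homo_nat (@rle_refl R E) (@rle_trans R E) vi.
(* The final estimate uses the error [(M + 1) * h n] twice, at [k] and at [N], besides an error
   [e / 2] from [q_cauchy]. *)
have [n Mn] : exists n, (M + 1) * h n < e / 4.
  have [|N hN] := (@cvgnP R R _ _).1 (half_cvg (M + 1)) (e / 4); first by lra.
  exists N; apply: le_lt_trans (hN N (leqnn _)).
  by rewrite sub0r normrN; exact: ler_norm.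
have /choice[y yP] k : exists y : E, exists z, [/\ 0 <=^r y, 0 <=^r z, v k <=^r y + z,
    `|y| <= (M + 1) / h n & q z <= (M + 1) * h n].
  have lt1 : interp_term n (v k) < M + 1.
    by apply: (le_lt_trans (interp_term_le _ _)); have := vM k; lra.
  have [y [z [y0 z0 vyz yz]]] := K_functional_lt (h0 n) (hV0 n) lt1.
  exists y, z; split=> //; first by rewrite -(rabs_ge0_id (v0 k)).
    rewrite ler_pdivlMr// mulrC.
    have := mulr_ge0 (ltW (hV0 n)) (seminorm_ge0 lq z); lra.
  rewrite -ler_pdivrMr// mulrC.
  have := mulr_ge0 (ltW (h0 n)) (normr_ge0 y); lra.
have y0 j : 0 <=^r y j by have [z []] := yP j.
have [U [uU ooU]] := nat_ultra; have pU : ProperFilter U by exact: ultra_proper.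
have inI k j : order_interval 0 (v k) (rinf (v k) (y j)).
  by split; [exact: rinf_glb|exact: rinfl].
(* The third clause carries the norm bound and the [q] bound from the infima to [a k], as both
   describe closed midpoint-convex sets. *)
have /choice[a aP] k : exists a, [/\ order_interval 0 (v k) a,
    forall f : dual E, f (rinf (v k) (y j)) @[j --> U] --> f a &
    forall C, closed C -> midpoint_convex C ->
      (\forall j \near U, C (rinf (v k) (y j))) -> C a].
  by apply: (interval_weak_limit mE uU (v0 k)); apply: nearW => j; exact: inI.
have a0 k : 0 <=^r a k by have [[]] := aP k.
have ai k : a k <=^r a k.+1.
  apply: rle_functional => f pf; have [_ fk _] := aP k; have [_ fk1 _] := aP k.+1.
  apply: (le_cvg _ (fk f) (fk1 f)); apply: nearW => j.
  by apply: pos_functional_mono => //; apply: rinf_mono => //; exact: rle_refl.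
have aM k : `|a k| <= (M + 1) / h n.
  have [_ _ cl] := aP k; apply: (cl [set x | `|x| <= (M + 1) / h n]).
  - apply: (@closed_comp _ _ (fun x : E => `|x|) [set r | r <= (M + 1) / h n]).
      by move=> x _; exact: norm_continuous.
    exact: closed_le.
  - move=> x x' /= h1 h2; rewrite normrZ ger0_norm//.
    by have := ler_normD x x'; lra.
  - apply: nearW => j; have [z [_ _ _ ym _]] := yP j; apply: le_trans ym.
    by apply: norm_mono; [exact: (inI k j).1|exact: rinfr].
have qa k : q (v k - a k) <= (M + 1) * h n.
  have [_ _ cl] := aP k; apply: (cl [set x | q (v k - x) <= (M + 1) * h n]).
  - apply: (@closed_comp _ _ (fun x : E => q (v k - x)) [set r | r <= (M + 1) * h n]).
      move=> x _; apply: (seminorm_cvg lq qC); apply: cvgB; first exact: cvg_cst.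
      exact: cvg_id.
    exact: closed_le.
  - have [qD qZ _] := lq => x x' /= h1 h2.
    have -> : v k - 2^-1 *: (x + x') = 2^-1 *: ((v k - x) + (v k - x')) by mod.
    rewrite qZ ger0_norm//.
    by have := qD (v k - x) (v k - x'); lra.
  (* For [j >= k], [v k <= v j <= y j + z], so the positive part of [v k - y j] lies below [z]. *)
  - apply: ooU; exists k => //= j kj; have [z [_ z0 vyz _ qz]] := yP j.
    apply: le_trans qz; rewrite rsub_rinf; apply: (seminorm_mono lq); first exact: rpos_ge0.
    by apply: rsup_lub => //; apply: (rle_lin2 (vm _ _ kj) vyz); mod.
have [|N hN] := q_cauchy a0 aM ai (e := e / 2); first by lra.
exists N => k Nk; have := hN k Nk; have := qa k; have := qa N; have [qD _ _] := lq.
have -> : v k - v N = (a k - a N) + ((v k - a k) - (v N - a N)) by mod.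
have := qD (a k - a N) ((v k - a k) - (v N - a N)).
by have := seminormB lq (v k - a k) (v N - a N); lra.
Qed.

(** The tails of the series are uniformly small along [v], hence at the differences [v n - v m], by
    [interp_tail_mono]; the remaining finite sum is at most a multiple of [q], for which [v] is
    Cauchy. *)
Lemma interp_bounded_cauchy (v : nat -> E) (M : R) :
  (forall n, 0 <=^r v n) -> (forall n, v n <=^r v n.+1) ->
  (forall n, interp_norm (v n) <= M) ->
  forall e : R, 0 < e -> exists N, forall n, (N <= n)%N -> interp_norm (v n - v N) <= e.
Proof.
move=> v0 vi vM e e0; have vm := homo_nat (@rle_refl R E) (@rle_trans R E) vi.
have lp := interp_norm_lattice.
pose S := range (fun n => interp_norm (v n)).
have hS : has_sup S.
  by split; [exists (interp_norm (v 0%N)), 0%N|exists M => _ [n _ <-]].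
have [|_ [k0 _ <-] k0S] := @sup_adherent R S (e / 4) _ hS; first by lra.
have [|N1 hN1] := (@cvgnP R R _ _).1 (@interp_norm_cvg (v k0)) (e / 4); first by lra.
have {}hN1 := hN1 N1 (leqnn _).
(* Beyond [k0], [interp_norm (v n)] exceeds its value at [k0] by at most [e / 4], while the partial
   sum does not decrease and at [k0] is within [e / 4] of the full one. *)
have tail n : (k0 <= n)%N -> interp_norm (v n) - interp_sum N1 (v n) <= e / 2.
  move=> kn; have : interp_norm (v n) <= sup S by apply: ub_le_sup; [exact: hS.2|exists n].
  have : interp_sum N1 (v k0) <= interp_sum N1 (v n).
    by apply: ler_sum => i _; apply: (seminorm_mono (lterm _)) => //; exact: vm.
  by have := ler_norm (interp_norm (v k0) - interp_sum N1 (v k0)); lra.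
pose B := \sum_(i < N1) (h i)^-1.
have B0 : 0 <= B by apply: sumr_ge0 => i _; exact: ltW.
(* The added 1 covers [B = 0], which occurs for [N1 = 0]. *)
have e1 : 0 < e / 2 / (B + 1) by rewrite divr_gt0//; lra.
have [N hN] := interp_bounded_q_cauchy v0 vi vM e1.
exists (maxn N k0) => n; rewrite geq_max => /andP[Nn kn].
set m := maxn N k0; have mN : (N <= m)%N by rewrite leq_maxl.
have vmn : v m <=^r v n by apply: vm; rewrite geq_max Nn.
have vmn0 : 0 <=^r v n - v m by exact/rsubge0.
have vnm : v n - v m <=^r v n by apply: (rle_lin1 (v0 m)); mod.
have qs : q (v n - v m) <= e / 2 / (B + 1).
  apply: le_trans (hN n Nn); apply: (seminorm_mono lq) => //.
  by apply: (rle_lin1 (vm _ _ mN)); mod.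
have := interp_tail_mono N1 vmn0 vnm; have := tail n kn.
have : interp_sum N1 (v n - v m) <= e / 2.
  apply: (@le_trans _ _ (B * q (v n - v m))).
    by rewrite mulr_suml; apply: ler_sum => i _; exact: K_functional_seminorm.
  apply: (le_trans (ler_wpM2l B0 qs)).
  rewrite mulrCA ler_piMr//; first by lra.
  by rewrite ler_pdivrMr; lra.
by lra.
Qed.

End Interpolation.

(** * Completion of a lattice seminorm *)

(** Bundled with its proof, so that the quotient type and its instances can depend on it. *)
Record lseminorm (R : realType) (W : rieszType R) := LSeminorm {
  lseminorm_fun :> W -> R ;
  lseminormP : lattice_seminorm lseminorm_fun }.

Section SeminormQuotient.
Context {R : realType} {W : rieszType R} (P : lseminorm W).
Implicit Types x y z : W.

Local Ltac mod := module (R : Type) (W : Type).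

Let lP : lattice_seminorm P := lseminormP P.

Definition seminorm_kernel : {pred W} := [pred x | P x == 0].

Lemma seminorm_kernel_closed : zmod_closed seminorm_kernel.
Proof.
split=> [|x y]; rewrite !inE; first by rewrite (seminorm0 lP).
move=> /eqP x0 /eqP y0; rewrite eq_le (seminorm_ge0 lP) andbT.
by apply: (le_trans (seminormB lP x y)); rewrite x0 y0 addr0.
Qed.

HB.instance Definition _ := GRing.isZmodClosed.Build W seminorm_kernel
  seminorm_kernel_closed.

Definition seminorm_quotient : Type := {ideal_quot seminorm_kernel}.

HB.instance Definition _ := GRing.Zmodule.on seminorm_quotient.

Local Notation H := seminorm_quotient.

Definition quotient_map x : H :=
  (\pi_({ideal_quot seminorm_kernel}) x)%qT.

Definition quotient_repr (a : H) : W := repr (a : {ideal_quot seminorm_kernel}).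

Lemma quotient_reprK a : quotient_map (quotient_repr a) = a.
Proof. exact: reprK. Qed.

Lemma quotient_mapP x y : quotient_map x = quotient_map y <-> P (x - y) = 0.
Proof.
have := Quotient.idealrBE seminorm_kernel x y; rewrite inE => E; split=> [xy|/eqP].
  by apply/eqP; rewrite E; apply/eqP.
by rewrite E => /eqP.
Qed.

Lemma quotient_mapD x y : quotient_map (x + y) = quotient_map x + quotient_map y.
Proof. by rewrite /quotient_map raddfD. Qed.

Lemma quotient_mapB x y : quotient_map (x - y) = quotient_map x - quotient_map y.
Proof. by rewrite /quotient_map raddfB. Qed.

Lemma quotient_map0 : quotient_map 0 = 0.
Proof. by have := quotient_mapB 0 0; rewrite !subrr. Qed.

Lemma quotient_repr_map x : P (quotient_repr (quotient_map x) - x) = 0.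
Proof. by apply/quotient_mapP; rewrite quotient_reprK. Qed.

Definition quotient_scale (k : R) (a : H) : H := quotient_map (k *: quotient_repr a).

Lemma quotient_scale_map k x : quotient_scale k (quotient_map x) = quotient_map (k *: x).
Proof.
apply/quotient_mapP; rewrite -scalerBr; have [_ PZ _] := lP.
by rewrite PZ quotient_repr_map mulr0.
Qed.

Lemma quotient_scalerA a b v : quotient_scale a (quotient_scale b v) = quotient_scale (a * b) v.
Proof. by rewrite -[v]quotient_reprK !quotient_scale_map scalerA. Qed.

Lemma quotient_scale1r : left_id 1 quotient_scale.
Proof. by move=> v; rewrite -[v]quotient_reprK !quotient_scale_map scale1r. Qed.

Lemma quotient_scalerDr : right_distributive quotient_scale +%R.
Proof.
move=> k u v; rewrite -[u]quotient_reprK -[v]quotient_reprK -quotient_mapD.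
by rewrite !quotient_scale_map scalerDr quotient_mapD.
Qed.

Lemma quotient_scalerDl v : {morph quotient_scale^~ v : a b / a + b}.
Proof.
move=> a b; rewrite -[v]quotient_reprK !quotient_scale_map scalerDl.
by rewrite quotient_mapD.
Qed.

HB.instance Definition _ := GRing.Zmodule_isLmodule.Build R H quotient_scalerA
  quotient_scale1r quotient_scalerDr quotient_scalerDl.

Lemma quotient_mapZ (k : R) x : quotient_map (k *: x) = k *: quotient_map x.
Proof. by rewrite -quotient_scale_map. Qed.

Definition quotient_norm (a : H) : R := P (quotient_repr a).

Lemma quotient_norm_map x : quotient_norm (quotient_map x) = P x.
Proof.
apply/eqP; rewrite -subr_eq0 -normr_le0; apply: (le_trans (seminorm_dist lP _ _)).
by rewrite quotient_repr_map.
Qed.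

Lemma quotient_normD a b : quotient_norm (a + b) <= quotient_norm a + quotient_norm b.
Proof.
rewrite -[a]quotient_reprK -[b]quotient_reprK -quotient_mapD !quotient_norm_map.
by have [PD _ _] := lP.
Qed.

Lemma quotient_normZ (k : R) a : quotient_norm (k *: a) = `|k| * quotient_norm a.
Proof.
rewrite -[a]quotient_reprK -quotient_mapZ !quotient_norm_map.
by have [_ PZ _] := lP.
Qed.

Lemma quotient_norm0 a : quotient_norm a = 0 -> a = 0.
Proof.
rewrite -[a]quotient_reprK quotient_norm_map => a0.
by rewrite -quotient_map0; apply/quotient_mapP; rewrite subr0.
Qed.

HB.instance Definition _ := Lmodule_isNormed.Build R H quotient_normD
  quotient_normZ quotient_norm0.

(** The order up to null elements: [x <= y] holds modulo the kernel when the positive part of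
    [x - y] is null. *)
Definition quotient_le (a b : H) := P (rpos (quotient_repr a - quotient_repr b)) = 0.

Lemma quotient_le_map x y :
  quotient_le (quotient_map x) (quotient_map y) <-> P (rpos (x - y)) = 0.
Proof.
suff h x' y' : P (x' - x) = 0 -> P (y' - y) = 0 ->
    P (rpos (x' - y')) = P (rpos (x - y)).
  by rewrite /quotient_le h// quotient_repr_map.
move=> hx hy; apply/eqP; rewrite -subr_eq0 -normr_le0.
apply: (le_trans (seminorm_dist lP _ _)).
apply: (@le_trans _ _ (P ((x' - x) - (y' - y)))).
  have [_ _ Pm] := lP; apply: Pm; apply: (rle_trans (rsup_dist _ _ _)).
  have -> : x' - x - (y' - y) = x' - y' - (x - y) by mod.
  exact: rle_refl.
by apply: (le_trans (seminormB lP _ _)); rewrite hx hy addr0.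
Qed.

Let P_eq0 x : 0 <=^r x -> P x <= 0 -> P x = 0.
Proof. by move=> x0 h; apply/eqP; rewrite eq_le h (seminorm_ge0 lP). Qed.

Let P_le0 x y : 0 <=^r x -> x <=^r y -> P y = 0 -> P x = 0.
Proof. by move=> x0 xy y0; apply: P_eq0 => //; rewrite -y0; exact: seminorm_mono. Qed.

Let P_leD0 x y z : 0 <=^r x -> x <=^r y + z -> P y = 0 -> P z = 0 -> P x = 0.
Proof.
move=> x0 xyz y0 z0; apply: P_eq0 => //; apply: (le_trans (seminorm_mono lP x0 xyz)).
by have [PD _ _] := lP; apply: (le_trans (PD _ _)); rewrite y0 z0 addr0.
Qed.

Definition quotient_sup (a b : H) : H := quotient_map (rsup (quotient_repr a) (quotient_repr b)).

Definition quotient_inf (a b : H) : H := quotient_map (rinf (quotient_repr a) (quotient_repr b)).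

Let dist2 x y x' y' z : rabs z <=^r rabs (x' - x) + rabs (y' - y) ->
  P (x' - x) = 0 -> P (y' - y) = 0 -> P z = 0.
Proof.
move=> h hx hy; rewrite -(seminorm_rabs lP); apply: P_leD0 h _ _; first exact: rabs_ge0.
  by rewrite seminorm_rabs.
by rewrite seminorm_rabs.
Qed.

Lemma quotient_map_sup x y :
  quotient_map (rsup x y) = quotient_sup (quotient_map x) (quotient_map y).
Proof.
apply/esym/quotient_mapP.
by apply: (dist2 (rsup_dist2 _ _ _ _)); exact: quotient_repr_map.
Qed.

Lemma quotient_map_inf x y :
  quotient_map (rinf x y) = quotient_inf (quotient_map x) (quotient_map y).
Proof.
apply/esym/quotient_mapP.
by apply: (dist2 (rinf_dist2 _ _ _ _)); exact: quotient_repr_map.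
Qed.

Lemma quotient_le_refl a : quotient_le a a.
Proof. by rewrite /quotient_le subrr (rpos_id (rle_refl 0)) (seminorm0 lP). Qed.

Lemma quotient_le_anti a b : quotient_le a b -> quotient_le b a -> a = b.
Proof.
rewrite /quotient_le -{3}[a]quotient_reprK -{3}[b]quotient_reprK.
set x := quotient_repr a; set y := quotient_repr b => xy yx; apply/quotient_mapP.
rewrite -(seminorm_rabs lP) rabs_pos opprB; apply: (P_leD0 _ (rle_refl _)) => //.
by apply: raddge0; exact: rpos_ge0.
Qed.

Lemma quotient_le_trans a b c : quotient_le a b -> quotient_le b c -> quotient_le a c.
Proof.
rewrite /quotient_le => ab bc; apply: P_leD0 ab bc; first exact: rpos_ge0.
apply: rle_trans (rposD _ _); rewrite addrA subrK; exact: rle_refl.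
Qed.

Lemma quotient_sup_le a b c :
  quotient_le (quotient_sup a b) c <-> quotient_le a c /\ quotient_le b c.
Proof.
rewrite -[c]quotient_reprK /quotient_sup quotient_le_map.
rewrite -[a in _ <-> quotient_le a _ /\ _]quotient_reprK.
rewrite -[b in _ <-> _ /\ quotient_le b _]quotient_reprK !quotient_le_map.
set x := quotient_repr a; set y := quotient_repr b; set z := quotient_repr c.
split=> [h|[h1 h2]].
  by split; apply: P_le0 h; (exact: rpos_ge0 || apply: rpos_le; apply: rle_add2r;
    (exact: rsupl || exact: rsupr)).
apply: P_leD0 h1 h2; first exact: rpos_ge0.
apply: rsup_lub; last by apply: raddge0; exact: rpos_ge0.
rewrite rsupDr; apply: rsup_lub.
  by apply: (rle_lin2 (rpos_ge (x - z)) (rpos_ge0 (y - z))); mod.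
by apply: (rle_lin2 (rpos_ge (y - z)) (rpos_ge0 (x - z))); mod.
Qed.

Lemma quotient_le_inf a b c :
  quotient_le c (quotient_inf a b) <-> quotient_le c a /\ quotient_le c b.
Proof.
rewrite -[c]quotient_reprK /quotient_inf quotient_le_map.
rewrite -[a in _ <-> quotient_le _ a /\ _]quotient_reprK.
rewrite -[b in _ <-> _ /\ quotient_le _ b]quotient_reprK !quotient_le_map.
set x := quotient_repr a; set y := quotient_repr b; set z := quotient_repr c.
split=> [h|[h1 h2]].
  by split; apply: P_le0 h; (exact: rpos_ge0 || apply: rpos_le; apply: rleD;
    (exact: rle_refl || apply: rleN; (exact: rinfl || exact: rinfr))).
apply: P_leD0 h1 h2; first exact: rpos_ge0.
apply: rsup_lub; last by apply: raddge0; exact: rpos_ge0.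
rewrite roppinf addrC rsupDr; apply: rsup_lub.
  by apply: (rle_lin2 (rpos_ge (z - x)) (rpos_ge0 (z - y))); mod.
by apply: (rle_lin2 (rpos_ge (z - y)) (rpos_ge0 (z - x))); mod.
Qed.

Lemma quotient_le_add2r c a b : quotient_le a b -> quotient_le (a + c) (b + c).
Proof.
rewrite -[a]quotient_reprK -[b]quotient_reprK -[c]quotient_reprK -!quotient_mapD.
by rewrite !quotient_le_map opprD addrACA subrr addr0.
Qed.

Lemma quotient_scaler_rge0 (k : R) a : 0 <= k -> quotient_le 0 a -> quotient_le 0 (k *: a).
Proof.
move=> k0; rewrite -[a]quotient_reprK -quotient_mapZ -quotient_map0 !quotient_le_map.
rewrite !sub0r -scalerN rposZ// => h; have [_ PZ _] := lP.
by rewrite PZ h mulr0.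
Qed.

HB.instance Definition _ := Lmodule_isRiesz.Build R H quotient_le_refl
  quotient_le_anti quotient_le_trans quotient_sup_le quotient_le_inf
  quotient_le_add2r quotient_scaler_rge0.

Lemma quotient_lattice_norm (a b : H) : rabs a <=^r rabs b -> `|a| <= `|b|.
Proof.
have rabsE x : rabs (quotient_map x) = quotient_map (rabs x).
  have mapN : quotient_map (- x) = - quotient_map x.
    by rewrite -sub0r quotient_mapB quotient_map0 sub0r.
  by rewrite /rabs quotient_map_sup mapN.
rewrite -[a]quotient_reprK -[b]quotient_reprK !rabsE => /quotient_le_map.
set x := quotient_repr a; set y := quotient_repr b => h.
rewrite -[X in X <= _]/(quotient_norm _) -[X in _ <= X]/(quotient_norm _).
rewrite !quotient_norm_map -(seminorm_rabs lP x) -(seminorm_rabs lP y).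
apply: (@le_trans _ _ (P (rabs y + rpos (rabs x - rabs y)))).
  apply: (seminorm_mono lP); first exact: rabs_ge0.
  by apply: (rle_lin1 (rpos_ge (rabs x - rabs y))); mod.
by have [PD _ _] := lP; apply: (le_trans (PD _ _)); rewrite h addr0.
Qed.

HB.instance Definition _ := NormedModule_Riesz_isNormedRiesz.Build R H
  quotient_lattice_norm.

End SeminormQuotient.


Lemma cauchy_seq_cvg (R : realType) (V : completeNormedModType R) (u : nat -> V) :
  (forall e : R, 0 < e -> exists N, forall n, (N <= n)%N -> `|u N - u n| <= e) ->
  exists a : V, u @ \oo --> a.
Proof.
move=> h; exists (limn u); apply: cauchy_cvg; apply: cauchy_exP => e e0.
have [|N hN] := h (e / 2); first by lra.
exists (u N); exists N => // n Nn; rewrite /= -ball_normE /=.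
by apply: le_lt_trans (hN n Nn) _; lra.
Qed.

(** * Completion by Cauchy sequences *)

Section CauchySequences.
Context {R : realType} {E : rieszType R} (p : lseminorm E).

Let lp : lattice_seminorm p := lseminormP p.

Definition is_seminorm_cauchy : {pred (nat -> E)} :=
  [pred w | `[< forall e : R, 0 < e -> exists N, forall m n, (N <= m)%N -> (N <= n)%N ->
    p (w m - w n) <= e >]].

Lemma is_seminorm_cauchy_submod : submod_closed is_seminorm_cauchy.
Proof.
have [pD pZ _] := lp; split.
  apply/asboolP => e e0; exists 0%N => m n _ _.
  by rewrite subrr (seminorm0 lp) ltW.
move=> a u v /asboolP hu /asboolP hv; apply/asboolP => e e0.
have a1 : 0 < `|a| + 1 by rewrite ltr_wpDl.
have e1 : 0 < e / 2 / (`|a| + 1) by rewrite !divr_gt0.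
have e2 : 0 < e / 2 by rewrite divr_gt0.
have [N1 h1] := hu _ e1; have [N2 h2] := hv _ e2.
exists (maxn N1 N2) => m n; rewrite !geq_max => /andP[m1 m2] /andP[n1 n2].
have -> : (a *: u + v) m - (a *: u + v) n = a *: (u m - u n) + (v m - v n).
  rewrite [(a *: u + v) m](_ : _ = a *: u m + v m)//.
  rewrite [(a *: u + v) n](_ : _ = a *: u n + v n)//.
  by rewrite scalerBr opprD addrACA.
apply: (le_trans (pD _ _)); rewrite pZ.
have := h2 m n m2 n2; suff : `|a| * p (u m - u n) <= e / 2 by lra.
apply: (le_trans (ler_wpM2l _ (h1 m n m1 n1))) => //.
by rewrite mulrCA ler_piMr ?(ltW e2)// ler_pdivrMr// mul1r lerDl.
Qed.

HB.instance Definition _ := GRing.isSubmodClosed.Build R (nat -> E)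
  is_seminorm_cauchy is_seminorm_cauchy_submod.

Record cauchy_seq := CauchySeq {
  cauchy_fun :> nat -> E ;
  cauchy_funP : cauchy_fun \in is_seminorm_cauchy }.

HB.instance Definition _ := [isSub for cauchy_fun].
HB.instance Definition _ := [Choice of cauchy_seq by <:].
HB.instance Definition _ := [SubChoice_isSubLmodule of cauchy_seq by <:].

Implicit Types u v w : cauchy_seq.

Lemma cauchy_seq_dist2 (f : E -> E -> E) :
  (forall a b c d, rabs (f a b - f c d) <=^r rabs (a - c) + rabs (b - d)) ->
  forall u v, (fun n => f (u n) (v n)) \in is_seminorm_cauchy.
Proof.
move=> fd u v; apply/asboolP => e e0; have e2 : 0 < e / 2 by rewrite divr_gt0.
have /asboolP/(_ _ e2)[N1 h1] := cauchy_funP u.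
have /asboolP/(_ _ e2)[N2 h2] := cauchy_funP v.
exists (maxn N1 N2) => m n; rewrite !geq_max => /andP[m1 m2] /andP[n1 n2].
apply: (le_trans (seminorm_rabs_le lp (fd _ _ _ _))); have [pD _ _] := lp.
apply: (le_trans (pD _ _)); rewrite !(seminorm_rabs lp).
by have := h1 m n m1 n1; have := h2 m n m2 n2; lra.
Qed.

(** Termwise at every index, which makes the Cauchy sequences a Riesz space; the quotient by the
    limit seminorm then relaxes it to an asymptotic order. *)
Definition cauchy_le u v := forall n, u n <=^r v n.
Definition cauchy_sup u v := CauchySeq (cauchy_seq_dist2 (@rsup_dist2 R E) u v).
Definition cauchy_inf u v := CauchySeq (cauchy_seq_dist2 (@rinf_dist2 R E) u v).

Lemma cauchy_ext u v : (forall n, u n = v n) -> u = v.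
Proof. by move=> uv; apply: val_inj; exact/funext. Qed.

Lemma cauchy_le_refl u : cauchy_le u u.
Proof. by move=> n; exact: rle_refl. Qed.

Lemma cauchy_le_anti u v : cauchy_le u v -> cauchy_le v u -> u = v.
Proof. by move=> uv vu; apply: cauchy_ext => n; exact: rle_anti. Qed.

Lemma cauchy_le_trans u v w : cauchy_le u v -> cauchy_le v w -> cauchy_le u w.
Proof. by move=> uv vw n; exact: rle_trans (uv n) (vw n). Qed.

Lemma cauchy_sup_le u v w : cauchy_le (cauchy_sup u v) w <-> cauchy_le u w /\ cauchy_le v w.
Proof.
split=> [h|[uw vw] n]; last exact: rsup_lub.
by split=> n; have /rsup_le[] := h n.
Qed.

Lemma cauchy_le_inf u v w : cauchy_le w (cauchy_inf u v) <-> cauchy_le w u /\ cauchy_le w v.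
Proof.
split=> [h|[uw vw] n]; last exact: rinf_glb.
by split=> n; have /le_rinf[] := h n.
Qed.

Lemma cauchy_le_add2r w u v : cauchy_le u v -> cauchy_le (u + w) (v + w).
Proof. by move=> uv n; exact: (rle_add2r (w n) (uv n)). Qed.

Lemma cauchy_scaler_rge0 (a : R) u : 0 <= a -> cauchy_le 0 u -> cauchy_le 0 (a *: u).
Proof. by move=> a0 u0 n; exact: (scaler_rge0 a0 (u0 n)). Qed.

HB.instance Definition _ := Lmodule_isRiesz.Build R cauchy_seq cauchy_le_refl
  cauchy_le_anti cauchy_le_trans cauchy_sup_le cauchy_le_inf
  cauchy_le_add2r cauchy_scaler_rge0.

Definition cauchy_seminorm w : R := limn (fun n => p (w n)).

Lemma cauchy_seminorm_cvg w : (fun n => p (w n)) @ \oo --> cauchy_seminorm w.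
Proof.
have [|l hl] := @cauchy_seq_cvg R R (fun n => p (w n)); last first.
  by rewrite /cauchy_seminorm (cvg_lim _ hl).
move=> e e0; have /asboolP/(_ _ e0)[N hN] := cauchy_funP w.
by exists N => n Nn; apply: (le_trans (seminorm_dist lp _ _)); exact: hN.
Qed.

Lemma cauchy_seminorm_lattice : lattice_seminorm cauchy_seminorm.
Proof.
have [pD pZ pm] := lp; split=> [u v|a u|u v uv].
- have k : (fun n => p (u n) + p (v n)) @ \oo --> cauchy_seminorm u + cauchy_seminorm v.
    by apply: cvgD; exact: cauchy_seminorm_cvg.
  apply: (le_cvg _ (@cauchy_seminorm_cvg _) k); apply: nearW => n; exact: pD.
- apply: (cvg_unique _ (@cauchy_seminorm_cvg _)) => //.
  rewrite (_ : (fun n => p ((a *: u) n)) = fun n => `|a| * p (u n)).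
    by apply: cvgMr; exact: cauchy_seminorm_cvg.
  by apply/funext => n; exact: pZ.
- apply: (le_cvg _ (@cauchy_seminorm_cvg u) (@cauchy_seminorm_cvg v)).
  by apply: nearW => n; apply: pm; exact: uv.
Qed.

Definition lattice_completion : Type :=
  seminorm_quotient (LSeminorm cauchy_seminorm_lattice).

HB.instance Definition _ := NormedRiesz.on lattice_completion.

Lemma const_cauchy x : (fun=> x) \in is_seminorm_cauchy.
Proof. by apply/asboolP => e e0; exists 0%N => m n _ _; rewrite subrr (seminorm0 lp) ltW. Qed.

Definition to_completion x : lattice_completion :=
  quotient_map (LSeminorm cauchy_seminorm_lattice) (CauchySeq (const_cauchy x)).

Local Notation mapH := (quotient_map (LSeminorm cauchy_seminorm_lattice)).

Lemma to_completion_linear : linear to_completion.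
Proof.
move=> a x y; rewrite /to_completion -quotient_mapZ -quotient_mapD; congr (mapH _).
exact: cauchy_ext.
Qed.

HB.instance Definition _ := GRing.isLinear.Build R E lattice_completion *:%R
  to_completion to_completion_linear.

Lemma to_completion_sup x y :
  to_completion (rsup x y) = rsup (to_completion x) (to_completion y).
Proof.
rewrite /to_completion -[RHS]quotient_map_sup; apply: congr1.
by apply: cauchy_ext => n.
Qed.

Lemma to_completion_inf x y :
  to_completion (rinf x y) = rinf (to_completion x) (to_completion y).
Proof.
rewrite /to_completion -[RHS]quotient_map_inf; apply: congr1.
by apply: cauchy_ext => n.
Qed.

Lemma completion_dist w x (e : R) N : (forall n, (N <= n)%N -> p (w n - x) <= e) ->
  `|(mapH w : lattice_completion) - to_completion x| <= e.
Proof.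
move=> h; rewrite /to_completion -quotient_mapB.
rewrite -[X in X <= _]/(quotient_norm _) quotient_norm_map /=.
apply: (le_cvg _ (@cauchy_seminorm_cvg _) (cvg_cst e)).
by exists N => // n; exact: h.
Qed.

Lemma to_completion_norm x : `|to_completion x| = p x.
Proof.
rewrite -[LHS]/(quotient_norm _) quotient_norm_map.
have c := @cauchy_seminorm_cvg (CauchySeq (const_cauchy x)).
have k : (fun=> p x) @ \oo --> p x by exact: cvg_cst.
by apply: (cvg_unique _ c) => //; exact: k.
Qed.

Lemma to_completion_dense (a : lattice_completion) (e : R) : 0 < e ->
  exists x, `|a - to_completion x| < e.
Proof.
move=> e0; have e2 : 0 < e / 2 by rewrite divr_gt0.
have -> : a = mapH (quotient_repr a) by rewrite quotient_reprK.
have /asboolP/(_ _ e2)[N hN] := cauchy_funP (quotient_repr a).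
exists (quotient_repr a N); apply: (@le_lt_trans _ _ (e / 2)); last by lra.
by apply: (completion_dist (N := N)) => n Nn; exact: hN.
Qed.

(** A Cauchy filter is followed by approximants taken in [E] itself; they form a [p]-Cauchy
    sequence, and its class is the limit. *)
Lemma lattice_completion_complete (F : set_system lattice_completion) :
  ProperFilter F -> cauchy F -> cvg F.
Proof.
move=> FF /cauchyP cF.
pose h n := (2^-1 : R) ^+ n; have h0 n : 0 < h n by exact: half_gt0.
have hm m n : (m <= n)%N -> h n <= h m.
  by move=> mn; rewrite /h ler_wiXn2l//; lra.
have /choice[a aP] n : exists a, F (ball a (h n)) by exact: cF.
have /choice[x xP] n := to_completion_dense (a n) (h0 n).
have adist m n : `|a m - a n| <= h m + h n.
  have [c [/=]] := filter_ex (filterI (aP m) (aP n)).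
  rewrite -!ball_normE /= => h1 h2; have := ler_distD c (a m) (a n).
  by rewrite (distrC c); lra.
have pdist m n : p (x m - x n) <= 2 * h m + 2 * h n.
  rewrite -to_completion_norm linearB /=.
  have := ler_distD (a m) (to_completion (x m)) (to_completion (x n)).
  have := ler_distD (a n) (a m) (to_completion (x n)).
  by have := xP m; have := xP n; have := adist m n; rewrite (distrC (to_completion _) (a m)); lra.
(* The 6 adds up 4 from [bx], 1 from the approximation of [a N] in [E] and 1 from the radius of the
   ball around [a N]. *)
have hsmall (e : R) : 0 < e -> exists N, 6 * h N < e.
  move=> e0; have [N hN] := (@cvgnP R R _ _).1 (half_cvg (6 : R)) e e0; exists N.
  by have := hN N (leqnn _); rewrite sub0r normrN; apply: le_lt_trans; exact: ler_norm.
have xc : x \in is_seminorm_cauchy.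
  apply/asboolP => e e0; have [N hN] := hsmall e e0; exists N => m n Nm Nn.
  apply: (le_trans (pdist m n)); have := hm _ _ Nm; have := hm _ _ Nn; have := h0 N.
  by lra.
pose b : lattice_completion := mapH (CauchySeq xc).
apply/cvg_ex; exists b; apply/cvgrPdist_lt => e e0.
have [N hN] := hsmall e e0.
have bx : `|b - to_completion (x N)| <= 4 * h N.
  apply: (completion_dist (N := N)) => n Nn; apply: (le_trans (pdist n N)).
  by have := hm _ _ Nn; lra.
apply: filterS (aP N) => c; rewrite -ball_normE /= => ac.
have := ler_distD (to_completion (x N)) b c; have := ler_distD (a N) (to_completion (x N)) c.
by have := xP N; rewrite (distrC (to_completion _) (a N)); lra.
Qed.

HB.instance Definition _ := Uniform_isComplete.Build lattice_completion
  lattice_completion_complete.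

End CauchySequences.

Lemma lattice_completion_exists (R : realType) (E : rieszType R) (p : E -> R) :
  lattice_seminorm p -> exists (H : banachLatticeType R) (Q : {linear E -> H}),
    [/\ lattice_homomorphism Q, forall x, `|Q x| = p x &
        forall (a : H) (e : R), 0 < e -> exists x, `|a - Q x| < e].
Proof.
move=> lp; pose P := LSeminorm lp.
exists (lattice_completion P), (to_completion P); split.
- by split=> x y; [exact: to_completion_sup|exact: to_completion_inf].
- exact: to_completion_norm.
- exact: to_completion_dense.
Qed.

(** * The factorization *)

(** The value at [a] is chosen with [|S a - T x| <= C |a - Q x|] for all [x]. By density this
    estimate alone yields linearity, continuity and [S (Q x) = T x]. *)
Lemma dense_extension (R : realType) (E : lmodType R) (H : normedModType R)
    (X : completeNormedModType R) (Q : {linear E -> H}) (T : {linear E -> X}) (C : R) :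
  0 <= C -> (forall x, `|T x| <= C * `|Q x|) ->
  (forall (a : H) (e : R), 0 < e -> exists x, `|a - Q x| < e) ->
  exists S : {linear H -> X}, continuous S /\ forall x, T x = S (Q x).
Proof.
move=> C0 TQ dense; have C1 : 0 < C + 1 by rewrite ltr_wpDl.
have /choice[S SP] (a : H) : exists y : X, forall x, `|y - T x| <= C * `|a - Q x|.
  have /choice[x xP] n := dense a _ (half_gt0 R n).
  have xd m n : (m <= n)%N -> `|T (x m) - T (x n)| <= 2 * C * 2^-1 ^+ m.
    move=> mn; rewrite -linearB; apply: (le_trans (TQ _)).
    rewrite [leRHS]mulrAC [leRHS]mulrC ler_wpM2l// linearB /=.
    have := ler_distD a (Q (x m)) (Q (x n)); rewrite (distrC (Q _) a).
    have : (2^-1 : R) ^+ n <= 2^-1 ^+ m by rewrite ler_wiXn2l//; lra.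
    by have := xP m; have := xP n; lra.
  have [|y xy] := @cauchy_seq_cvg _ X (fun n => T (x n)).
    move=> e e0; have [N hN] := (@cvgnP R R _ _).1 (half_cvg (2 * C)) e e0.
    exists N => n Nn; apply: (le_trans (xd _ _ Nn)).
    by have := hN N (leqnn _); rewrite sub0r normrN => /(le_lt_trans (ler_norm _))/ltW.
  exists y => z.
  have l1 : (fun n => `|T (x n) - T z|) @ \oo --> `|y - T z|.
    by apply: cvg_norm; apply: cvgB => //; exact: cvg_cst.
  have l2 : (fun n => C * `|a - Q z| + C * 2^-1 ^+ n) @ \oo --> C * `|a - Q z|.
    rewrite -[X in _ --> X]addr0; apply: cvgD; first exact: cvg_cst.
    exact: half_cvg.
  apply: (le_cvg _ l1 l2); apply: nearW => n.
  rewrite -linearB -mulrDr; apply: (le_trans (TQ _)); rewrite ler_wpM2l// linearB /=.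
  have := ler_distD a (Q (x n)) (Q z); rewrite (distrC (Q _) a).
  by have := xP n; lra.
have lS : linear S.
  move=> k a b; apply/eqP; rewrite -subr_eq0 -normr_le0.
  apply/ler_addgt0Pr => e e0; rewrite add0r.
  have k1 : 0 < `|k| + 1 by rewrite ltr_wpDl.
  (* Chosen so that [C (|k| d + d) <= e / 2]; this error occurs twice. *)
  pose d := e / 2 / (C + 1) / (`|k| + 1).
  have d0 : 0 < d by rewrite /d !divr_gt0.
  have [x xa] := dense a d d0; have [y yb] := dense b d d0.
  have ka : `|k| * `|a - Q x| <= `|k| * d by rewrite ler_wpM2l// ltW.
  have dE : (C + 1) * (`|k| * d + d) = e / 2.
    by rewrite /d; field; rewrite !gt_eqF.
  have h1 : C * (`|k| * `|a - Q x| + `|b - Q y|) <= e / 2.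
    have s0 : 0 <= `|k| * `|a - Q x| + `|b - Q y| by rewrite addr_ge0// mulr_ge0.
    by rewrite -dE; apply: ler_pM; [exact: C0|exact: s0|lra|lra].
  have -> : S (k *: a + b) - (k *: S a + S b) =
      (S (k *: a + b) - T (k *: x + y)) - (k *: (S a - T x) + (S b - T y)).
    rewrite [T (_ + _)]linearD [T (_ *: _)]linearZ /=.
    by module (R : Type) (X : Type).
  apply: (le_trans (ler_normB _ _)).
  have h2 : `|S (k *: a + b) - T (k *: x + y)| <= e / 2.
    apply: (le_trans (SP _ _)); apply: le_trans h1; rewrite ler_wpM2l//.
    have -> : k *: a + b - Q (k *: x + y) = k *: (a - Q x) + (b - Q y).
      rewrite [Q (_ + _)]linearD [Q (_ *: _)]linearZ /=.
      by module (R : Type) (H : Type).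
    by apply: (le_trans (ler_normD _ _)); rewrite normrZ.
  have h3 : `|k *: (S a - T x) + (S b - T y)| <= e / 2.
    apply: (le_trans (ler_normD _ _)); apply: le_trans h1.
    rewrite normrZ mulrDr lerD// mulrCA ler_wpM2l//.
  by lra.
pose SL : {linear H -> X} := HB.pack S (GRing.isLinear.Build _ _ _ _ _ lS).
exists SL; split.
  apply: (@bounded_operator _ _ _ SL C) => a.
  by have := SP a 0; rewrite [T 0]linear0 [Q 0]linear0 !subr0.
move=> x; apply/esym/subr0_eq/eqP; rewrite -normr_le0.
by apply: (le_trans (SP _ _)); rewrite subrr normr0 mulr0.
Qed.

Section DenseLatticeImage.
Context {R : realType} {E : rieszType R} {H : normedRieszType R}.
Variable Q : {linear E -> H}.
Hypotheses (lQ : lattice_homomorphism Q)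
  (dense : forall (a : H) (e : R), 0 < e -> exists x, `|a - Q x| < e).

Local Ltac mod := module (R : Type) (H : Type).

Lemma lattice_hom_rpos x : Q (rpos x) = rpos (Q x).
Proof. by rewrite /rpos lQ.1 linear0. Qed.

Lemma lattice_hom_positive : positive_operator Q.
Proof. by move=> x x0; rewrite -(rpos_id x0) lattice_hom_rpos; exact: rpos_ge0. Qed.

Lemma lattice_hom_mono x y : x <=^r y -> Q x <=^r Q y.
Proof. by move=> /rsubge0/lattice_hom_positive; rewrite linearB => /rsubge0. Qed.

Lemma dense_pos (a : H) (e : R) : 0 <=^r a -> 0 < e ->
  exists2 x, 0 <=^r x & `|a - Q x| < e.
Proof.
move=> a0 e0; have [x ax] := dense a e0; exists (rpos x); first exact: rpos_ge0.
rewrite lattice_hom_rpos -(rpos_id a0); apply: le_lt_trans ax.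
by rewrite -[leRHS]norm_rabs; apply: norm_rabs_le; exact: rsup_dist.
Qed.

(** Truncating a positive approximant by [x] moves it no farther from [a], since [Q] preserves
    infima and [a] lies below [Q x]. *)
Lemma dense_interval (a : H) (x : E) (e : R) : 0 <=^r x -> 0 <=^r a -> a <=^r Q x ->
  0 < e -> exists y, order_interval 0 x y /\ `|a - Q y| < e.
Proof.
move=> x0 a0 ax e0; have [y y0 ay] := dense_pos a0 e0.
exists (rinf y x); split; first by split; [exact: rinf_glb|exact: rinfr].
rewrite lQ.2 -(rinf_idl ax); apply: le_lt_trans ay.
rewrite -[leRHS]norm_rabs; apply: norm_rabs_le.
apply: (rle_trans (rinf_dist2 _ _ _ _)); rewrite subrr rabs0 addr0.
exact: rle_refl.
Qed.

(* Suprema of approximants are monotone and stay within [2 * 2^-N] of [x]. *)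
Lemma dense_monotone_cauchy (x : nat -> H) (M : R) :
  (forall (v : nat -> E) (M : R), (forall n, 0 <=^r v n) -> (forall n, v n <=^r v n.+1) ->
     (forall n, `|Q (v n)| <= M) ->
     forall e : R, 0 < e -> exists N, forall n, (N <= n)%N -> `|Q (v n) - Q (v N)| <= e) ->
  (forall n, 0 <=^r x n) -> (forall n, x n <=^r x n.+1) -> (forall n, `|x n| <= M) ->
  forall e : R, 0 < e -> exists N, forall n, (N <= n)%N -> `|x N - x n| <= e.
Proof.
move=> cE x0 xi xM e e0; pose h n := (2^-1 : R) ^+ n.
have h0 n : 0 < h n by exact: half_gt0.
have hS n : h n.+1 = h n / 2 by rewrite /h exprS mulrC.
have /choice[y yP] n : exists y, 0 <=^r y /\ `|x n - Q y| < h n.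
  by have [y y0 xy] := dense_pos (x0 n) (h0 n); exists y.
pose v N k := tail_sup y N k.
(* Each step adds an error [h (N + k).+1], which equals [h (N + k) - h (N + k).+1], so the bound
   telescopes. *)
have xv N k : `|Q (v N k) - x (N + k)%N| <= 2 * h N - h (N + k)%N.
  elim: k => [|k ih]; first by rewrite addn0 /= distrC; have := (yP N).2; lra.
  rewrite addnS /= lQ.1 -[x (N + k).+1](rsup_idl (xi (N + k)%N)) [rsup (x _) _]rsupC addnS.
  have := norm_rabs_le (rsup_dist2 (Q (v N k)) (Q (y (N + k).+1)) (x (N + k)%N) (x (N + k).+1)).
  have := ler_normD (rabs (Q (v N k) - x (N + k)%N)) (rabs (Q (y (N + k).+1) - x (N + k).+1)).
  rewrite !norm_rabs (distrC (Q (y _))); have := (yP (N + k).+1).2; rewrite hS.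
  by have := h0 (N + k)%N; move: ih; lra.
(* The error [2 * h N] occurs at both [K] and [k]. *)
have [N hN] : exists N, 4 * h N <= e / 2.
  have [|N hN] := (@cvgnP R R _ _).1 (half_cvg (4 : R)) (e / 2); first by rewrite divr_gt0.
  exists N; apply: ltW; apply: le_lt_trans (hN N (leqnn _)).
  by rewrite sub0r normrN; exact: ler_norm.
have xv2 k : `|Q (v N k) - x (N + k)%N| <= 2 * h N.
  by have := xv N k; have := h0 (N + k)%N; lra.
have v0 k : 0 <=^r v N k by apply: rle_trans (yP N).1 _; exact: tail_sup_head.
have [|||K hK] := cE (v N) (M + 2 * h N) v0 _ _ (e / 2).
- by move=> k; exact: tail_sup_mono.
- move=> k; have := ler_normD (Q (v N k) - x (N + k)%N) (x (N + k)%N); rewrite subrK.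
  by have := xv2 k; have := xM (N + k)%N; lra.
- by rewrite divr_gt0.
exists (N + K)%N => n /subnKC <-; rewrite -addnA; set k := (K + _)%N.
have Kk : (K <= k)%N by rewrite leq_addr.
have := ler_distD (Q (v N K)) (x (N + K)%N) (x (N + k)%N).
have := ler_distD (Q (v N k)) (Q (v N K)) (x (N + k)%N).
have := hK k Kk; have := xv2 K; have := xv2 k.
by rewrite (distrC (Q (v N k)) (Q (v N K))) (distrC (Q (v N K)) (x (N + K)%N)); lra.
Qed.

End DenseLatticeImage.

Lemma b_weakly_compact_KB_factor (R : realType) (E : normedRieszType R)
    (X : completeNormedModType R) (T : {linear E -> X}) :
  interval_monotone_cvg E -> continuous T -> generalized_b_weakly_compact T ->
  exists (H : banachLatticeType R) (Q : {linear E -> H}) (S : {linear H -> X}),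
    [/\ KB_space H,
        continuous Q /\ interval_preserving Q /\ lattice_homomorphism Q,
        continuous S &
        forall x, T x = S (Q x)].
Proof.
move=> mE cT bT; have [C C0 TC] := operator_bound cT.
pose q := solid_seminorm T; have lq : lattice_seminorm q by exact: solid_seminorm_lattice TC C0.
have qC x : q x <= C * `|x| by exact: solid_seminorm_bound.
pose p := interp_norm q; have lp : lattice_seminorm p by exact: interp_norm_lattice lq.
have p2 x : p x <= 2 * `|x| by exact: interp_norm_le.
have [H [Q [lQ Qp dense]]] := lattice_completion_exists lp.
have TQ x : `|T x| <= (C + 1) * `|Q x|.
  rewrite Qp; apply: le_trans (seminorm_le_interp lq qC C0 x).
  by apply: solid_seminorm_ge => //; exact: rle_refl.
have [|S [cS TS]] := dense_extension _ TQ dense; first by rewrite addr_ge0.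
exists H, Q, S; split=> //.
- move=> x x0 xm xb.
  have [M xM] : exists M, forall n, `|x n| <= M.
    have [M [_ hM]] := xb; exists (M + 1) => n.
    by apply: (hM (M + 1)) => //; rewrite ltrDl.
  apply/cvg_ex; apply: cauchy_seq_cvg; apply: (dense_monotone_cauchy lQ dense) xM => //.
  + move=> v K v0 vi vK e e0.
    have vp n : interp_norm q (v n) <= K by rewrite -/(p _) -Qp.
    have [N hN] := interp_bounded_cauchy lq qC mE
      (fun y L y0 yL yi => b_weakly_compact_cauchy cT bT y0 yL yi) v0 vi vp e0.
    by exists N => n Nn; rewrite -linearB Qp; exact: hN.
  + by move=> n; exact: xm.
- split; first by apply: (bounded_operator (C := 2)) => x; rewrite Qp.
  split=> //; split; first exact: lattice_hom_positive.
  move=> x x0; apply/seteqP; split=> [_ [y [y0 yx] <-]|b [b0 bx]].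
    by split; [exact: lattice_hom_positive|exact: lattice_hom_mono].
  (* A preimage of [b] is found as the [p]-limit of approximants inside [0, x], where
     [interval_seminorm_cvg] provides completeness; the limit stays in [0, x]. *)
  have /choice[y yP] n := dense_interval lQ dense x0 b0 bx (half_gt0 R n).
  have yd n : p (y n.+1 - y n) <= 2 * 2^-1 ^+ n.
    rewrite -Qp linearB; have := ler_distD b (Q (y n.+1)) (Q (y n)).
    have := (yP n).2; have := (yP n.+1).2; rewrite exprS (distrC (Q _) b) /=.
    by have := half_gt0 R n; lra.
  have [a [a0 ax ya]] := interval_seminorm_cvg mE (fun n => (yP n).1.1)
    (fun n => (yP n).1.2) lp p2 yd.
  exists a; first by split.
  apply/esym/subr0_eq/eqP; rewrite -normr_le0.
  have k := cvgD0 (half_cvg (1 : R)) ya.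
  apply: (le_cvg _ (cvg_cst _) k); apply: nearW => n.
  rewrite mul1r -Qp linearB; apply: (le_trans (ler_distD (Q (y n)) _ _)).
  by rewrite lerD2r ltW// (yP n).2.
Qed.

Theorem theorem5p2 (R : realType) (E : normedRieszType R)
    (hE : Dedekind_complete E) (hE_oc : order_continuous_norm E)
    (X : completeNormedModType R) (T : {linear E -> X}) (hT : continuous T) :
  generalized_b_weakly_compact T <->
  exists (H : banachLatticeType R) (Q : {linear E -> H}) (S : {linear H -> X}),
    [/\ KB_space H,
        continuous Q /\ interval_preserving Q /\ lattice_homomorphism Q,
        continuous S &
        forall x, T x = S (Q x)].
Proof.
split.
  exact: b_weakly_compact_KB_factor (order_continuous_monotone_cvg hE hE_oc) hT.
move=> [H [Q [S [kH [cQ [[pQ _] _]] cS TS]]]].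
exact: KB_factor_b_weakly_compact kH cQ pQ cS TS.
Qed.
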